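(* Let $N\ge 1$, $0<s<1$, $1<p<2$, with $sp<1$. Let $u\ge 0$ be a nonnegative semigroup solution of the fractional $p$-Laplacian evolution equation $\partial_t u+\mathcal L_{s,p}u=0$ in a strip $Q=\mathbb R^N\times(0,T)$ with $T>0$. Then for every weight $\varphi\in\mathcal C(s,p)$ there is a finite constant $K>0$ depending only on $\varphi$ (and on $N,s,p$, not on $u$) such that, writing $X(t)=\int_{\mathbb R^N}u(x,t)\varphi(x)\,dx$, $$|X(t_1)^{2-p}-X(t_2)^{2-p}|\le K\,|t_1-t_2|$$ for all $t_1,t_2\in[0,T)$ at which these weighted masses are finite. Actually, one may take $K=(2-p)\,C(\varphi)^{2-p}$.
   Context: Let $\Phi_p(z)=|z|^{p-2}z$. The fractional $p$-Laplacian is $\mathcal L_{s,p}(u)(x)=P.V.\int_{\mathbb R^N}\frac{\Phi_p(u(x)-u(y))}{|x-y|^{N+sp}}\,dy$. In $L^2(\mathbb R^N)$ it is the subdifferential of the convex functional $J(u)=\frac1{2p}\iint\frac{|u(x)-u(y)|^p}{|x-y|^{N+sp}}\,dxdy$; it generates a contraction semigroup $S_t$ which extends to an order-preserving contraction semigroup on every $L^q(\mathbb R^N)$, $1\le q<\infty$. A semigroup solution is $u(\cdot,t)=S_tu_0$ with $u_0\in L^q(\mathbb R^N)$ for some $1\le q<\infty$. For a function $\varphi$ on $\mathbb R^N$ put $(\mathcal M_{sp/2}\varphi)(x)=P.V.\int_{\mathbb R^N}\frac{|\varphi(x)-\varphi(y)|}{|x-y|^{N+sp}}\,dy$. The class $\mathcal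 C(s,p)$ consists of the smooth, strictly positive functions $\varphi$ on $\mathbb R^N$, with $\varphi(x)\to0$ as $|x|\to\infty$, such that $\mathcal M_{sp/2}\varphi$ is locally bounded and $$C(\varphi):=\int_{\mathbb R^N}\frac{|\mathcal M_{sp/2}\varphi(x)|^{1/(2-p)}}{\varphi(x)^{(p-1)/(2-p)}}\,dx<\infty .$$ *)

(* Defs.v *)
From HB Require Import structures.
From mathcomp Require Import all_boot all_order all_algebra.
From mathcomp Require Import all_classical all_reals all_analysis.

Set Implicit Arguments.
Unset Strict Implicit.
Unset Printing Implicit Defensive.

Import Order.TTheory GRing.Theory Num.Theory.
Import numFieldNormedType.Exports.

Local Open Scope classical_set_scope.
Local Open Scope ring_scope.

(** * Lebesgue measure on R^n

    R^n is ['rV[R]_n], with the sigma-algebra generated by the coordinates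
    (that is, the Borel sigma-algebra). The Lebesgue measure on R^(n+1) is the
    image of the product of the measures on R and R^n under (a, v) |-> (a, v_1,
    ..., v_n); on R^0 it is the unit mass. *)

Definition rV_display : measure_display -> measure_display.
Proof. exact. Qed.

Section rV_measurable.
Context {R : realType}.
Variable n : nat.

Definition rV_coord (i : 'I_n) (x : 'rV[R]_n) : R := x ord0 i.

Let rV_set0 : g_sigma_preimage rV_coord set0.
Proof. exact: sigma_algebra0. Qed.

Let rV_setC A : g_sigma_preimage rV_coord A -> g_sigma_preimage rV_coord (~` A).
Proof. exact: sigma_algebraC. Qed.

Let rV_bigcup (F : _^nat) : (forall i, g_sigma_preimage rV_coord (F i)) ->
  g_sigma_preimage rV_coord (\bigcup_i (F i)).
Proof. exact: sigma_algebra_bigcup. Qed.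

HB.instance Definition _ :=
  @isMeasurable.Build (rV_display default_measure_display)
    'rV[R]_n (g_sigma_preimage rV_coord) rV_set0 rV_setC rV_bigcup.

Lemma measurable_rV_coord i : measurable_fun setT (rV_coord i).
Proof.
move=> _ Y mY; rewrite setTI; apply: sub_sigma_algebra => /=.
rewrite -bigcup_seq/=; exists i => /=; first by rewrite mem_index_enum.
by exists Y => //; rewrite setTI.
Qed.

Lemma measurable_fun_rVP d (T : measurableType d) (f : T -> 'rV[R]_n) :
  (forall i, measurable_fun setT (rV_coord i \o f)) -> measurable_fun setT f.
Proof.
move=> mf _ A mA; rewrite setTI.
suff : g_sigma_preimage (fun i => rV_coord i \o f) `<=` measurable.
  by apply; rewrite g_sigma_preimage_comp; exists A => //; rewrite setTI.
apply: smallest_sub; first exact: sigma_algebra_measurable.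
move=> B; rewrite -bigcup_seq => -[i _] [C mC <-].
exact: mf.
Qed.

End rV_measurable.

Section lebesgue_rV.
Context {R : realType}.

Definition rV_cons n (z : R * 'rV[R]_n) : 'rV[R]_n.+1 :=
  row_mx (const_mx z.1 : 'rV_1) z.2.

Lemma rV_cons0 n (z : R * 'rV[R]_n) : rV_cons z ord0 ord0 = z.1.
Proof.
transitivity (rV_cons z ord0 (lshift n (ord0 : 'I_1))).
  by congr (rV_cons z _ _); exact/val_inj.
by apply: etrans (row_mxEl _ _ _ _) _; rewrite mxE.
Qed.

Lemma rV_consS n (z : R * 'rV[R]_n) i : rV_cons z ord0 (lift ord0 i) = z.2 ord0 i.
Proof.
transitivity (rV_cons z ord0 (rshift 1 i)).
  by congr (rV_cons z _ _); exact/val_inj.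
exact: row_mxEr.
Qed.

Lemma measurable_rV_cons n : measurable_fun setT (@rV_cons n).
Proof.
apply: measurable_fun_rVP => i.
have [j ->|->] := unliftP ord0 i.
  rewrite (_ : _ \o _ = rV_coord j \o snd).
    by apply: measurableT_comp => //; exact: measurable_rV_coord.
  by apply/funext => z; rewrite /= /rV_coord rV_consS.
rewrite (_ : _ \o _ = fst) //.
by apply/funext => z; rewrite /= /rV_coord rV_cons0.
Qed.

Section cons_measure.
Variables (n : nat) (m : {measure set 'rV[R]_n -> \bar R}).
Local Open Scope ereal_scope.

Definition cons_measure : set 'rV[R]_n.+1 -> \bar R :=
  pushforward (@lebesgue_measure R \x^ m) (@rV_cons n).

Let cons_measure0 : cons_measure set0 = 0.
Proof. by rewrite /cons_measure /pushforward preimage_set0 measure0. Qed.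

Let cons_measure_ge0 A : 0 <= cons_measure A.
Proof. exact: (measure_ge0 (@lebesgue_measure R \x^ m)). Qed.

Let cons_measure_sigma_additive : semi_sigma_additive cons_measure.
Proof.
have mf := @measurable_rV_cons n.
move=> F mF tF mUF; rewrite /cons_measure /pushforward preimage_bigcup.
apply: measure_semi_sigma_additive.
- by move=> k; rewrite -[X in measurable X]setTI; exact: mf.
- apply/trivIsetP => /= i j _ _ ij; rewrite -preimage_setI.
  by move/trivIsetP : tF => /(_ _ _ _ _ ij) ->//; rewrite preimage_set0.
- by rewrite -preimage_bigcup -[X in measurable X]setTI; exact: mf.
Qed.

HB.instance Definition _ := isMeasure.Build _ _ _ cons_measure
  cons_measure0 cons_measure_ge0 cons_measure_sigma_additive.

End cons_measure.

Fixpoint leb n : {measure set 'rV[R]_n -> \bar R} :=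
  match n with
  | 0 => dirac (0 : 'rV[R]_0)
  | m.+1 => cons_measure (leb m)
  end.

Lemma leb_box n (A : 'I_n -> set R) : (forall i, measurable (A i)) ->
  leb n [set x | forall i, A i (x ord0 i)] =
  (\prod_(i < n) lebesgue_measure (A i))%E.
Proof.
elim: n A => [|n IHn] A mA.
  rewrite big_ord0 /= diracE mem_set//; by case.
have mB : measurable [set x : 'rV[R]_n | forall i, A (lift ord0 i) (x ord0 i)].
  rewrite (_ : [set _ | _] = \bigcap_(i in [set: 'I_n])
      (rV_coord i @^-1` A (lift ord0 i))); last first.
    by apply/seteqP; split => [x Ax i _|x Ax i]; apply: Ax.
  apply: fin_bigcap_measurable => // i _; rewrite -[X in measurable X]setTI.
  exact: measurable_rV_coord.
rewrite big_ord_recl -IHn; last by move=> i; exact: mA.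
rewrite -(product_measure2E lebesgue_measure (leb n) (mA ord0) mB).
rewrite /= /cons_measure /pushforward; congr (_ _).
apply/seteqP; split => [z /= Az|z /= [A0 Az] i].
  split; first by have := Az ord0; rewrite rV_cons0.
  by move=> i; have := Az (lift ord0 i); rewrite rV_consS.
have [j ->|->] := unliftP ord0 i; first by rewrite rV_consS.
by rewrite rV_cons0.
Qed.

End lebesgue_rV.

Section fractional_p_laplacian.
Context {R : realType} {N : nat}.
Local Notation E := 'rV[R]_N.
Local Notation mu := (@leb R N).
Implicit Types (s p q T : R) (f g w xi phi : E -> R).

(** The norm of the normed module ['rV[R]_N] is the sup norm. *)
Definition enorm (x : E) : R := Num.sqrt (\sum_i x ord0 i ^+ 2).

Local Open Scope ereal_scope.

Definition dist_Lp q f g : \bar R := 'N[mu]_q%:E[EFin \o (f \- g)%R].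

(** * The energy and its subdifferential in L^2 *)

Definition energy s p f : \bar R :=
  ((2 * p)^-1)%:E * \int[mu]_x \int[mu]_y
    ((`|f x - f y| `^ p) / (enorm (x - y) `^ (N%:R + s * p)))%:E.

Definition subdifferential (F : (E -> R) -> \bar R) f xi : Prop :=
  [/\ f \in Lfun mu 2%:E, xi \in Lfun mu 2%:E, F f < +oo &
    forall w, w \in Lfun mu 2%:E ->
      F f + \int[mu]_x (xi x * (w x - f x))%:E <= F w].

(** * Semigroup solutions *)

Definition L2_continuous (v : R -> E -> R) : Prop :=
  forall t0, (0 <= t0)%R ->
    dist_Lp 2 (v t) (v t0) @[t --> within [set t | (0 <= t)%R] (nbhs t0)] --> 0.

Definition L2_absolutely_continuous (a b : R) (v : R -> E -> R) : Prop :=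
  forall e : R, (0 < e)%R -> exists2 d : R, (0 < d)%R &
    forall (n : nat) (l r : 'I_n -> R),
      (forall i, (a <= l i)%R /\ (l i <= r i)%R /\ (r i <= b)%R) ->
      (forall i j, i != j -> (r i <= l j)%R \/ (r j <= l i)%R) ->
      (\sum_i (r i - l i) < d)%R ->
      \sum_i dist_Lp 2 (v (r i)) (v (l i)) < e%:E.

(** [v t] is the orbit [S_t (v 0)] of the contraction semigroup generated on
    L^2 by the subdifferential of the energy: the strong solution of
    [v'(t) + d(energy)(v(t)) \ni 0] on [0, +oo[, the time derivative being
    taken in L^2. *)
Definition L2_semigroup_orbit s p (v : R -> E -> R) : Prop :=
  [/\ forall t, (0 <= t)%R -> v t \in Lfun mu 2%:E,
      L2_continuous v,
      forall a b, (0 < a)%R -> (a <= b)%R -> L2_absolutely_continuous a b v &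
      {ae lebesgue_measure, forall t : R, (0 < t)%R ->
        exists2 xi, subdifferential (energy s p) (v t) xi &
          dist_Lp 2 (fun x => h^-1 * (v (t + h) x - v t x))%R (\- xi)%R
            @[h --> (0 : R)%R^'] --> 0}].

(** The extension of [S_t] to L^q is the extension by density of its
    restriction to the intersection of L^2 and L^q: [S_t u0] is the limit in
    L^q of [S_t (f n)] for [f n] in this intersection converging to [u0] in
    L^q. By contractivity the limit does not depend on the sequence. *)
Definition Lq_semigroup_orbit s p q T (u0 : E -> R) (u : R -> E -> R) : Prop :=
  u0 \in Lfun mu q%:E /\
  exists v : nat -> R -> E -> R,
    [/\ forall n, L2_semigroup_orbit s p (v n),
        forall n, v n 0%R \in Lfun mu q%:E,
        dist_Lp q (v n 0%R) u0 @[n --> \oo] --> 0 &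
        forall t, (0 <= t)%R -> (t < T)%R ->
          u t \in Lfun mu q%:E /\ dist_Lp q (v n t) (u t) @[n --> \oo] --> 0].

Definition semigroup_solution s p T (u : R -> E -> R) : Prop :=
  exists q (u0 : E -> R), (1 <= q)%R /\ Lq_semigroup_orbit s p q T u0 u.

Definition nonnegative_on T (u : R -> E -> R) : Prop :=
  forall t, (0 <= t)%R -> (t < T)%R -> {ae mu, forall x, (0 <= u t x)%R}.

(** * Weights *)

Definition pv_integral (x : E) (k : E -> \bar R) : \bar R :=
  lim ((\int[mu]_(y in [set y | (e < enorm (x - y))%R]) k y) @[e --> (0 : R)%R^'+]).

Definition Msp s p phi (x : E) : \bar R :=
  pv_integral x (fun y =>
    (`|phi x - phi y| / (enorm (x - y) `^ (N%:R + s * p)))%:E).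

Definition weight_const s p phi : \bar R :=
  \int[mu]_x (`|Msp s p phi x| `^ (2 - p)^-1 *
              ((phi x `^ ((p - 1) / (2 - p)))^-1)%:E).

(** All iterated directional derivatives exist and are differentiable. *)
Definition smooth phi : Prop :=
  forall (vs : seq E) (x : E),
    differentiable (foldr (fun v f => 'D_v f : E -> R) phi vs) x.

Definition vanishes_at_infinity phi : Prop :=
  forall e : R, (0 < e)%R -> exists r : R,
    forall x, (r < enorm x)%R -> (`|phi x| < e)%R.

Definition locally_bounded (g : E -> \bar R) : Prop :=
  forall x : E, exists B : R, \forall y \near x, `|g y| <= B%:E.

Definition weight_class s p phi : Prop :=
  [/\ smooth phi, (forall x, 0 < phi x)%R, vanishes_at_infinity phi,
      locally_bounded (Msp s p phi) & weight_const s p phi < +oo].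

Definition weighted_mass (u : R -> E -> R) phi (t : R) : \bar R :=
  \int[mu]_x (u t x * phi x)%:E.

End fractional_p_laplacian.

(* Main.v *)
Require Import Defs.
From HB Require Import structures.
From mathcomp Require Import all_boot all_order all_algebra.
From mathcomp Require Import all_classical all_reals all_analysis.
From mathcomp Require Import measurable_realfun ring lra.

Set Implicit Arguments.
Unset Strict Implicit.
Unset Printing Implicit Defensive.

Import Order.TTheory GRing.Theory Num.Theory.
Import numFieldNormedType.Exports.

Local Open Scope classical_set_scope.
Local Open Scope ring_scope.

(** Let [k] be the kernel of the energy and [M] the operator [M_{sp/2}]. Testing the
    equation with [phi] gives, formally,
      d/dt int u phi = - 1/2 int int Phi_p(u(x) - u(y)) (phi(x) - phi(y)) k(x, y),
    and, since [|a - b|^(p-1) <= a^(p-1) + b^(p-1)] for [a, b >= 0], the symmetry of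
    [k] and Hoelder's inequality bound the right-hand side by
      int u^(p-1) M phi <= C(phi)^(2-p) X^(p-1).
    Hence [X^(2-p)] is Lipschitz with constant [(2-p) C(phi)^(2-p)].

    To make this rigorous one only has orbits [v] in [L^2] which approximate [u] in
    [L^q] at each time; they may change sign, and neither [phi] nor [|v| phi] has to
    be integrable. The two one-sided bounds are obtained from different tests.

    Growth. Let [G] be a convex [C^(1,1)] truncation of [|r|] that vanishes for
    [|r| <= e] ([soft_abs]) and [g] its derivative. Then [G(v) phi] is integrable
    because [v] is in [L^2] and [phi] is bounded. The test function is [g(v) phi]:
    the increments of [g(v)] have the sign of those of [v] and only help, and what
    remains is [g] at the value of smaller modulus, where convexity gives
    [g(a) (b - a) <= G(b)]. So [F = int G(v) phi] satisfies
    [F' <= C(phi)^(2-p) F^(p-1)] with no error term ([trunc_perturb],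
    [dissipation_trunc], [trunc_mass_growth]). This passes to the limit in [v], then
    in [e], and shows that a finite mass of [u] stays finite ([mass_growth]).

    Decay. The test function is [(phi - e')^+], which lives on a set of finite measure
    because [phi] vanishes at infinity, and for which [M] does not exceed [M phi].
    Splitting [|v|^(p-1)] into [G(v)^(p-1)] and [(2 e)^(p-1)], the second part is
    negligible as [e] tends to 0, and the first is controlled at all later times
    by the growth estimate ([linear_mass_decay]). The bound therefore involves only
    the values at the initial time and passes to the limit without any integral in
    time ([mass_decay]); subdividing the time interval restores the sharp constant
    ([powR_decay]).

    The subdifferential is used only through its defining inequality at
    [v - tau h], with [tau] tending to 0 ([energy_dissipation]), and the time
    derivative, known almost everywhere for an absolutely continuous curve, through
    a monotonicity criterion that rests on Cousin's lemma ([abs_cont_ler]). *)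

(** * Powers *)
Section scalar.
Context {R : realType}.
Implicit Types a b c d e p q r x y : R.

Lemma le_powR r x y : 0 <= r -> 0 <= x -> x <= y -> x `^ r <= y `^ r.
Proof.
by move=> r0 x0 xy; apply: ge0_ler_powR; rewrite ?nnegrE// (le_trans x0).
Qed.

Lemma powRD_subadd r a b : 0 < r -> r <= 1 -> 0 <= a -> 0 <= b ->
  (a + b) `^ r <= a `^ r + b `^ r.
Proof.
move=> r0 r1 a0 b0.
have [s0|] := ltP 0 (a + b); last first.
  move=> ab; have a00 : a = 0 by lra.
  have b00 : b = 0 by lra.
  by rewrite a00 b00 addr0 powR0 ?gt_eqF// addr0.
have H x : 0 <= x -> x <= a + b -> x <= x `^ r * (a + b) `^ (1 - r).
  rewrite le_eqVlt => /predU1P[<-|x0] xs; first by rewrite mulr_ge0 ?powR_ge0.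
  rewrite -[leLHS]powRr1 ?(ltW x0)// -{1}(subrKC r 1) powRD; last first.
    by rewrite (gt_eqF x0) implybT.
  by rewrite ler_wpM2l ?powR_ge0// le_powR ?subr_ge0// ltW.
rewrite -(ler_pM2r (powR_gt0 (1 - r) s0)) mulrDl -powRD; last first.
  by rewrite (gt_eqF s0) implybT.
rewrite subrKC powRr1 ?(ltW s0)//.
by apply: lerD; apply: H => //; lra.
Qed.

Lemma powR_tangent_concave r x y : 0 < r -> r < 1 -> 0 <= x -> 0 < y ->
  x `^ r <= y `^ r + r * y `^ (r - 1) * (x - y).
Proof.
move=> r0 r1 x0 y0.
have r1' : 0 < 1 - r by rewrite subr_gt0.
have /= := @conjugate_powR R (x `^ r) (y `^ (1 - r)) r^-1 (1 - r)^-1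
  (powR_ge0 _ _) (powR_ge0 _ _).
rewrite !invr_gt0 => /(_ r0 r1'); rewrite !invrK => /(_ (subrKC _ _)).
rewrite -!powRrM !mulfV ?gt_eqF// !powRr1 ?(ltW y0)// => H.
have E1 : y * y `^ (r - 1) = y `^ r by rewrite mulr_powRB1// ltW.
have E2 : y `^ (1 - r) * y `^ (r - 1) = 1.
  by rewrite -powRD ?(gt_eqF y0) ?implybT// addrC subrKA subrr powRr0.
have := ler_wpM2r (powR_ge0 y (r - 1)) H.
rewrite -(mulrA (x `^ r)) E2 mulr1 => /le_trans; apply.
by rewrite mulrDl -E1; nra.
Qed.

Lemma powR_tangent_convex p x y : 1 < p -> 0 <= x -> 0 <= y ->
  x `^ p + p * x `^ (p - 1) * (y - x) <= y `^ p.
Proof.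
move=> p1 x0 y0.
have p0 : 0 < p by rewrite (lt_trans _ p1).
have p10 : 0 < p - 1 by rewrite subr_gt0.
have := @conjugate_powR R y (x `^ (p - 1)) p (p / (p - 1)) y0 (powR_ge0 _ _) p0.
rewrite divr_gt0// => /(_ isT); rewrite invfM invrK => /(_ _)/wrap[].
  by field; rewrite gt_eqF.
rewrite -powRrM (_ : (p - 1) * (p / (p - 1)) = p) => [H|]; last first.
  by field; rewrite gt_eqF.

have E : x * x `^ (p - 1) = x `^ p by rewrite mulr_powRB1.
have {H} : p * (y * x `^ (p - 1)) <= y `^ p + (p - 1) * x `^ p.
  rewrite -(ler_pM2l p0) in H; apply: (le_trans H).
  rewrite [leLHS](_ : _ = y `^ p + (p - 1) * x `^ p)//.
  by field; rewrite ?gt_eqF.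
by rewrite -E; lra.
Qed.

(** The remainder in [e] is of the order [tau ^ p], which is what lets the
    difference quotients of the energy converge without domination. *)
Lemma powR_perturb p d d' e tau : 1 < p -> p < 2 -> `|d'| <= `|d| -> 0 <= tau ->
  `|d' - tau * e| `^ p <= `|d| `^ p +
    p * tau * (`|e| * `|d| `^ (p - 1) + tau `^ (p - 1) * (`|e| `^ p)).
Proof.
move=> p1 p2 dd' t0.
have p0 : 0 < p by rewrite (lt_trans _ p1).
have le1 : `|d' - tau * e| <= `|d| + tau * `|e|.
  by rewrite (le_trans (ler_normB _ _))// normrM (ger0_norm t0) lerD2r.
have ab0 : 0 <= `|d| + tau * `|e| by rewrite addr_ge0// mulr_ge0.
apply: (le_trans (le_powR (ltW p0) (normr_ge0 _) le1)).
have := powR_tangent_convex p1 ab0 (normr_ge0 d).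
have := @powRD_subadd (p - 1) `|d| (tau * `|e|).
rewrite subr_gt0 p1 normr_ge0 mulr_ge0//= => /(_ isT _ isT isT)/wrap[]; first lra.
have -> : (tau * `|e|) `^ (p - 1) = tau `^ (p - 1) * `|e| `^ (p - 1) by rewrite powRM.
have <- : `|e| * `|e| `^ (p - 1) = `|e| `^ p by rewrite mulr_powRB1.
set S := (_ + tau * _) `^ (p - 1) => H1 H2.
have : tau * `|e| * S <= tau * `|e| *
   (`|d| `^ (p - 1) + tau `^ (p - 1) * `|e| `^ (p - 1)).
  by rewrite ler_wpM2l// mulr_ge0.
have {H2} : (`|d| + tau * `|e|) `^ p <= `|d| `^ p + p * (tau * `|e| * S) by lra.
by move=> H2 /(ler_wpM2l (ltW p0)) H3; apply: (le_trans H2); rewrite lerD2l; lra.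
Qed.

End scalar.

(** * Absolutely continuous functions *)
Section abs_cont.
Context {R : realType}.
Implicit Types (a b c d e l r t : R) (f : R -> R).
Local Notation leb1 := (@lebesgue_measure R).

(** The compactness of [[a, b]], for a property of intervals that is additive and
    that holds for all sufficiently short intervals around each point. *)
Lemma cousin (P : R -> R -> Prop) a b : a <= b ->
  (forall l m r, l <= m -> m <= r -> P l m -> P m r -> P l r) ->
  (forall t, a <= t -> t <= b -> exists2 d, 0 < d &
    forall l r, a <= l -> l <= t -> t <= r -> r <= b -> r - l < d -> P l r) ->
  P a b.
Proof.
move=> ab Pcat Ploc.
pose S := [set x | [/\ a <= x, x <= b & P a x]].
have Sa : S a.
  have [d d0 H] := Ploc a (lexx _) ab; split => //.
  by apply: H => //; rewrite subrr.
have ubS : ubound S b by move=> x [].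
have hsS : has_sup S by split; [exists a|exists b].
set c := sup S.
have ac : a <= c by apply: ub_le_sup => //; exists b.
have cb : c <= b by apply: ge_sup => //; exists a.
have [d d0 H] := Ploc c ac cb.
have [x [ax xb Pax] cx] := sup_adherent (divr_gt0 d0 (ltr0n _ 2)) hsS.
rewrite -/c in cx.
have xc : x <= c by apply: ub_le_sup => //; exists b.
pose y := Num.min b (c + d / 2 / 2).
have cy : c <= y by rewrite le_min cb/=; lra.
have yb : y <= b by rewrite ge_min lexx.
have yc : y <= c + d / 2 / 2 by rewrite ge_min lexx orbT.
have Pay : P a y.
  by apply: (Pcat a x y) => //; [lra|apply: H => //; lra].
have : y <= c by apply: ub_le_sup; [exists b|split => //; lra].
rewrite ge_min => /orP[bc|]; last by lra.
by have -> : b = y by apply: le_anti; rewrite yb (le_trans bc).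
Qed.

Lemma is_deriveP (f : R -> R) t D : is_derive t (1 : R) f D <->
  forall e, 0 < e -> exists2 d, 0 < d &
    forall h, `|h| < d -> `|f (t + h) - f t - h * D| <= e * `|h|.
Proof.
split.
  move=> [df fD] e e0.
  have : (h^-1 *: (f (h *: (1 : R) + t) - f t)) @[h --> 0^'] --> D.
    by rewrite -fD; exact: df.
  move=> /cvgrPdist_lt /(_ _ e0)[d /= d0 H].
  exists d => // h hd; have [->|h0] := eqVneq h 0.
    by rewrite addr0 subrr mul0r subrr normr0 mulr0.
  have := H h; rewrite /= sub0r normrN => /(_ hd h0).
  rewrite scaler1 addrC /GRing.scale/= distrC => /ltW.
  rewrite addrC -(ler_pM2r (_ : 0 < `|h|)) ?normr_gt0// -normrM.
  by rewrite mulrBl mulrAC mulVf// mul1r (addrC h) (mulrC D).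
move=> H.
have fD : (h^-1 *: (f (h *: (1 : R) + t) - f t)) @[h --> 0^'] --> D.
  apply/cvgrPdist_le => e e0; have [d d0 Hd] := H e e0.
  exists d => //= h; rewrite /= sub0r normrN => hd h0.
  rewrite scaler1 /GRing.scale/= distrC.
  rewrite -(ler_pM2r (_ : 0 < `|h|)) ?normr_gt0// -normrM.
  rewrite mulrBl mulrAC mulVf// mul1r (addrC h) (mulrC D).
  exact: Hd.
by apply: DeriveDef; [apply/cvg_ex; exists D|exact: cvg_lim fD].
Qed.

Definition abs_cont a b f := forall e, 0 < e -> exists2 d, 0 < d &
  forall n (l r : 'I_n -> R),
    (forall i, a <= l i /\ l i <= r i /\ r i <= b) ->
    (forall i j, i != j -> r i <= l j \/ r j <= l i) ->
    \sum_i (r i - l i) < d -> \sum_i `|f (r i) - f (l i)| < e.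

Lemma abs_cont_seq a b f e : abs_cont a b f -> 0 < e ->
  exists2 d, 0 < d & forall s : seq (R * R),
    all (fun I => (a <= I.1) && (I.1 <= I.2) && (I.2 <= b)) s ->
    pairwise (fun I J => I.2 <= J.1) s ->
    \sum_(I <- s) (I.2 - I.1) < d -> \sum_(I <- s) `|f I.2 - f I.1| < e.
Proof.
move=> acf e0; have [d d0 H] := acf _ e0; exists d => // s sab.
move=> /(pairwiseP (0, 0)) spw.
rewrite [X in X < d]big_tnth [X in X < e]big_tnth; apply: H => [i|i j ij].
  by have /andP[/andP[]] := allP sab _ (mem_tnth i (in_tuple s)).
rewrite !(tnth_nth (0, 0))/=.
move: ij; rewrite neq_ltn => /orP[|] ij; [left|right];
  by apply: spw => //; rewrite inE.
Qed.

(** Cousin's lemma provides a partition of [[a, b]] into intervals that either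
    have a tag where the slope is controlled, or lie in an open set of small
    measure around the exceptional null set; absolute continuity bounds the
    contribution of the latter. *)
Lemma abs_cont_ler a b c f : a <= b -> 0 <= c -> abs_cont a b f ->
  {ae leb1, forall t, a <= t -> t <= b ->
     exists2 D, D <= c & is_derive t (1 : R) f D} ->
  f b - f a <= c * (b - a).
Proof.
move=> ab c0 acf aef.
have [Z [mZ Z0 QZ]] : exists Z : set R, [/\ measurable Z, leb1 Z = 0%E &
    ~` [set t | a <= t -> t <= b ->
          exists2 D, D <= c & is_derive t (1 : R) f D] `<=` Z].
  by have [Z [mZ Z0 QZ]] := aef; exists Z; split.
suff H e : 0 < e -> f b - f a <= (c + e) * (b - a) + e.
  apply/ler_addgt0Pr => e e0.
  have k0 : 0 < b - a + 1 by lra.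
  have := H (e / (b - a + 1)) (divr_gt0 e0 k0).
  have -> : (c + e / (b - a + 1)) * (b - a) + e / (b - a + 1) = c * (b - a) + e.
    by field; rewrite gt_eqF.
  by [].
move=> e0; have [d d0 Hd] := abs_cont_seq acf e0.
have Zoo : (leb1 Z < +oo)%E by rewrite Z0 ltry.
have [U [oU ZU UZd]] := lebesgue_regularity_outer mZ Zoo d0.
have mU : measurable U by exact: open_measurable.
have Ud : (leb1 U < d%:E)%E.
  apply: le_lt_trans UZd.
  have UE : U = (U `\` Z) `|` Z by rewrite setUC setDUK.
  have mUZ : measurable (U `\` Z) by exact: measurableD.
  have : (leb1 ((U `\` Z) `|` Z) <= leb1 (U `\` Z) + leb1 Z)%E.
    exact: measureU2.
  by rewrite -UE Z0 adde0.
pose P l r := a <= l -> r <= b -> exists s : seq (R * R),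
  [/\ all (fun I => (l <= I.1) && (I.1 <= I.2) && (I.2 <= r)) s,
      pairwise (fun I J => I.2 <= J.1) s,
      ((\sum_(I <- s) (I.2 - I.1))%:E <= leb1 (U `&` `]l, r]))%E &
      f r - f l <= (c + e) * (r - l) + \sum_(I <- s) `|f I.2 - f I.1|].
suff : P a b.
  case=> // s [sab spw slen fs].
  apply: (le_trans fs); rewrite lerD2l ltW//; apply: Hd => //.
  rewrite -lte_fin; apply: (le_lt_trans slen); apply: le_lt_trans Ud.
  by rewrite le_measure ?inE//; exact: measurableI.
apply: cousin => //.
- move=> l m r lm mr Plm Pmr al rb.
  have [s1 [h1 p1 e1 f1]] := Plm al (le_trans mr rb).
  have [s2 [h2 p2 e2 f2]] := Pmr (le_trans al lm) rb.
  exists (s1 ++ s2); rewrite all_cat pairwise_cat !big_cat/=; split.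
  + apply/andP; split.
      by apply: sub_all h1 => I /andP[-> /le_trans ->].
    by apply: sub_all h2 => I /andP[/andP[mI -> ->]]; rewrite (le_trans lm mI).
  + rewrite p1 p2/= andbT; apply/allrelP => I J Is Js.
    have /andP[_ I2] := allP h1 _ Is.
    have /andP[/andP[J1 _] _] := allP h2 _ Js.
    exact: le_trans J1.
  + rewrite EFinD; apply: (le_trans (leeD e1 e2)).
    rewrite -measureU//; [|exact: measurableI..|].
      rewrite -setIUr le_measure ?inE//; do ?exact: measurableI.
        by apply: measurableI => //; exact: measurableU.
      apply: setIS => x [|] /=; rewrite !in_itv/= => /andP[h3 h4].
        by rewrite h3 (le_trans h4).
      by rewrite h4 (le_lt_trans lm).
    rewrite setIACA setIid; apply/seteqP; split => // x [_ [/=]].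
    by rewrite !in_itv/= => /andP[_ h3] /andP[h4 _]; lra.
  + lra.
- move=> t ta tb; have [Zt|nZt] := pselect (Z t).
    have [d' /= d'0 tU] : nbhs t U by apply: open_nbhs_nbhs; split => //; exact: ZU.
    exists d' => // l r al lt tr rb lrd ? ?.
    have lrU : `]l, r] `<=` U.
      move=> x /=; rewrite in_itv/= => /andP[lx xr]; apply: tU => /=.
      by rewrite ltr_norml; lra.
    exists [:: (l, r)]; rewrite !big_seq1/= !lexx (le_trans lt)//=; split => //.
      rewrite setIidr// lebesgue_measure_itv/= lte_fin.
      by case: ltP => // rl; rewrite lee_fin; lra.
    rewrite (le_trans (ler_norm _))// lerDr mulr_ge0//; lra.
  have : a <= t -> t <= b -> exists2 D, D <= c & is_derive t (1 : R) f D.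
    by apply: contrapT => h; apply: nZt; exact: QZ.
  move=> /(_ ta tb)[D Dc /is_deriveP/(_ _ e0)[d' d'0 fD]].
  exists d' => // l r al lt tr rb lrd _ _; exists [::]; rewrite !big_nil; split => //.
  have := fD (r - t); have := fD (l - t); rewrite !subrKC.
  rewrite (ler0_norm (_ : l - t <= 0)) ?(ger0_norm (_ : 0 <= r - t)); try lra.
  move=> /(_ _)/wrap[]; first lra; move=> + /(_ _)/wrap[]; first lra.
  rewrite !ler_norml => /andP[h1 h2] /andP[h3 h4].
  have : D * (r - l) <= c * (r - l) by rewrite ler_wpM2r//; lra.
  by lra.
Qed.

End abs_cont.

(** * Comparison with solutions of [F' = A F^(p-1)] *)
Section ode.
Context {R : realType}.
Implicit Types (p A a b d e t x y : R) (F X : R -> R).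

Lemma ae_lebesgueS (P Q : R -> Prop) : (forall t, P t -> Q t) ->
  {ae (@lebesgue_measure R), forall t, P t} ->
  {ae (@lebesgue_measure R), forall t, Q t}.
Proof.
move=> PQ [Z [mZ Z0 subZ]]; exists Z; split => // t nQ.
by apply: subZ => Pt; exact/nQ/PQ.
Qed.

Lemma abs_cont_lipschitz_comp a b F (g : R -> R) L : 0 <= L ->
  (forall x y, a <= x -> x <= b -> a <= y -> y <= b ->
    `|g (F x) - g (F y)| <= L * `|F x - F y|) ->
  abs_cont a b F -> abs_cont a b (g \o F).
Proof.
move=> L0 gL acF e e0.
have L1 : 0 < L + 1 by lra.
have [d d0 H] := acF (e / (L + 1)) (divr_gt0 e0 L1); exists d => // n l r lr dj s.
have := H n l r lr dj s; rewrite ltr_pdivlMr// mulrC mulr_sumr.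
apply: le_lt_trans; apply: ler_sum => i _ /=.
have [al [lir rb]] := lr i.
apply: (@le_trans _ _ (L * `|F (r i) - F (l i)|)).
  by apply: gL => //; [exact: le_trans lir|exact: le_trans rb].
by rewrite ler_wpM2r// lerDl.
Qed.

Let powq_small p e : p < 2 -> 0 < e -> exists2 d, 0 < d & d `^ (2 - p) = e.
Proof.
move=> p2 e0; exists (e `^ (2 - p)^-1); first exact: powR_gt0.
have q0 : 0 < 2 - p by lra.
by rewrite -powRrM mulVf ?gt_eqF// powRr1// ltW.
Qed.

Let powq_lip p d x y : 1 < p -> p < 2 -> 0 < d -> 0 <= x -> 0 <= y ->
  `|(x + d) `^ (2 - p) - (y + d) `^ (2 - p)| <=
    (2 - p) * d `^ (1 - p) * `|x - y|.
Proof.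
move=> p1 p2 d0; have q0 : 0 < 2 - p by lra.
have q1 : 2 - p < 1 by lra.
wlog xy : x y / x <= y.
  move=> H x0 y0; have /orP[xy|yx] := le_total x y; first exact: H.
  by rewrite distrC [X in _ <= _ * X]distrC; exact: H.
move=> x0 y0; rewrite distrC ger0_norm; last first.
  by rewrite subr_ge0 le_powR ?(ltW q0)//; lra.
rewrite distrC ger0_norm ?subr_ge0//.
have xd0 : 0 < x + d by lra.
have yd0 : 0 <= y + d by lra.
have := powR_tangent_concave q0 q1 yd0 xd0.
have -> : 2 - p - 1 = - (p - 1) by ring.
have -> : 1 - p = - (p - 1) by ring.
have H : (x + d) `^ (- (p - 1)) <= d `^ (- (p - 1)).
  rewrite !powRN lef_pV2 ?posrE ?powR_gt0// le_powR//; lra.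
have : (2 - p) * (x + d) `^ (- (p - 1)) * (y - x) <=
       (2 - p) * d `^ (- (p - 1)) * (y - x).
  by rewrite ler_wpM2r ?subr_ge0// ler_wpM2l// ltW.
have -> : y + d - (x + d) = y - x by ring.
by lra.
Qed.

(** The shift of [F] by [d] keeps the power differentiable where [F] vanishes. *)
Lemma powR_growth p A a b F : 1 < p -> p < 2 -> 0 <= A -> a <= b -> (forall t, 0 <= F t) -> abs_cont a b F ->
  {ae (@lebesgue_measure R), forall t, a <= t -> t <= b ->
     exists2 D, D <= A * F t `^ (p - 1) & is_derive t (1 : R) F D} ->
  F b `^ (2 - p) <= F a `^ (2 - p) + (2 - p) * A * (b - a).
Proof.
move=> p1 p2 A0 ab F0 acF dF; apply/ler_addgt0Pr => e /(powq_small p2)[d d0 <-].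
have q0 : 0 < 2 - p by lra.
have q1 : 2 - p < 1 by lra.
set K := (2 - p) * A.
have K0 : 0 <= K by rewrite mulr_ge0// ltW.
pose g x := (x + d) `^ (2 - p).
have : g (F b) - g (F a) <= K * (b - a).
  apply: (@abs_cont_ler _ a b K (g \o F)) => //.
    apply: (@abs_cont_lipschitz_comp a b F g ((2 - p) * d `^ (1 - p))) => //.
      by rewrite mulr_ge0 ?powR_ge0// ltW.
    by move=> x y _ _ _ _; exact: powq_lip.
  apply: ae_lebesgueS dF => t H ta tb; have [D DF FD] := H ta tb.
  have Fd0 : 0 < F t + d by rewrite ltr_wpDl.
  exists ((2 - p) * (F t + d) `^ (1 - p) * D).
    have E : (F t + d) `^ (p - 1) * (F t + d) `^ (1 - p) = 1.
      by rewrite -powRD ?(gt_eqF Fd0) ?implybT// addrC subrKA subrr powRr0.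
    have : D <= A * (F t + d) `^ (p - 1).
      by apply: (le_trans DF); rewrite ler_wpM2l// le_powR//; lra.
    have c0 : 0 <= (2 - p) * (F t + d) `^ (1 - p) by rewrite mulr_ge0 ?powR_ge0// ltW.
    move=> /(ler_wpM2l c0); rewrite [leRHS](_ : _ = K *
      ((F t + d) `^ (p - 1) * (F t + d) `^ (1 - p))); last by rewrite /K; ring.
    by rewrite E mulr1.
  have gF : is_derive (F t + d) (1 : R) (@powR R ^~ (2 - p)) ((2 - p) * (F t + d) `^ (1 - p)).
    apply: DeriveDef; first by apply: derivable_powR; rewrite in_itv/= andbT.
    rewrite -derive1E powR_derive1 ?in_itv/= ?andbT//.
    by have -> : 2 - p - 1 = 1 - p by ring.
  have Fdd : is_derive t (1 : R) (fun x => F x + d) D.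
    by rewrite -[D]addr0; apply: is_deriveD.
  exact: (@is_derive1_comp R (@powR R ^~ (2 - p)) (fun x => F x + d) t _ _ gF Fdd).
rewrite /g => H.
have := @powRD_subadd _ (2 - p) (F a) d q0 (ltW q1) (F0 a) (ltW d0).
have : F b `^ (2 - p) <= (F b + d) `^ (2 - p) by rewrite le_powR ?(ltW q0)//; lra.
by lra.
Qed.

(** The given bound on the decrease involves the value at the left end of the interval,
    whereas the tangent to the concave power is taken at the right end. Once [X] is
    shifted by [d > 0], the two values are comparable on short intervals, and the
    constant is recovered by subdivision. *)
Lemma powR_decay p A a b X (K := (2 - p) * A) :
  1 < p -> p < 2 -> 0 <= A -> a <= b -> (forall t, 0 <= X t) ->
  (forall t t', a <= t -> t <= t' -> t' <= b ->
    X t' `^ (2 - p) <= X t `^ (2 - p) + K * (t' - t)) ->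
  (forall t t', a <= t -> t <= t' -> t' <= b ->
    X t - X t' <= (t' - t) * (A * (X t `^ (2 - p) + K * (t' - t)) `^
                                     ((p - 1) / (2 - p)))) ->
  X a `^ (2 - p) - X b `^ (2 - p) <= K * (b - a).
Proof.
move=> p1 p2 A0 ab X0 up down.
have q0 : 0 < 2 - p by lra.
have q1 : 2 - p < 1 by lra.
have K0 : 0 <= K by rewrite mulr_ge0// ltW.
pose be := (p - 1) / (2 - p).
have be0 : 0 < be by rewrite divr_gt0//; lra.
suff H d e : 0 < d -> 0 < e ->
    (X a + d) `^ (2 - p) - (X b + d) `^ (2 - p) <= K * (1 + e) * (b - a).
  apply/ler_addgt0Pr => e e0.
  have [d d0 dE] := powq_small p2 (divr_gt0 e0 (ltr0n _ 2)).
  have k0 : 0 < 2 * (K * (b - a) + 1).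
    by rewrite mulr_gt0// ltr_wpDl// mulr_ge0// subr_ge0.
  have := H d (e / (2 * (K * (b - a) + 1))) d0 (divr_gt0 e0 k0).
  have := @powRD_subadd _ (2 - p) (X b) d q0 (ltW q1) (X0 b) (ltW d0).
  rewrite dE.
  have : X a `^ (2 - p) <= (X a + d) `^ (2 - p) by rewrite le_powR ?(ltW q0)//; lra.
  have : K * (b - a) * (e / (2 * (K * (b - a) + 1))) <= e / 2.
    rewrite mulrCA ler_wpM2l ?(ltW e0)// invfM mulrCA -[leRHS]mulr1 ler_wpM2l//.
    by rewrite ler_pdivrMr ?mul1r; lra.
  by lra.
move=> d0 e0.
pose Y t := X t + d.
have Y0 t : 0 < Y t by rewrite /Y ltr_wpDl.
(* the slack absorbed in the exponent [be] *)
pose e' := (1 + e) `^ be^-1 - 1.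
have e'0 : 0 < e'.
  rewrite subr_gt0; apply: (@le_lt_trans _ _ (1 `^ be^-1)); first by rewrite powR1.
  by apply: gt0_ltr_powR; rewrite ?invr_gt0 ?nnegrE//; lra.
have e'E : (1 + e') `^ be = 1 + e.
  by rewrite /e' subrKC -powRrM mulVf ?gt_eqF// powRr1//; lra.
pose A' := A * (X a `^ (2 - p) + K * (b - a) + K * (b - a)) `^ be.
have A'0 : 0 <= A' by rewrite mulr_ge0 ?powR_ge0.
pose h0 := Num.min (d / (A' + 1)) (e' * d `^ (2 - p) / (K + 1)).
have h00 : 0 < h0.
  by rewrite lt_min !divr_gt0// ?mulr_gt0 ?powR_gt0//; lra.
pose P l r := Y l `^ (2 - p) - Y r `^ (2 - p) <= K * (1 + e) * (r - l).
suff : P a b by [].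
apply: (@cousin _ P a b) => //; first by move=> l m r _ _; rewrite /P; lra.
move=> t at_ tb; exists h0 => // l r al lt tr rb.
have lr : l <= r by lra.
rewrite lt_min !ltr_pdivlMr; [|lra..] => /andP[hA hK].
have rl0 : 0 <= r - l by lra.
have hKA x : 0 <= x -> (r - l) * x <= (r - l) * (x + 1) by move=> ?; rewrite ler_wpM2l//; lra.
have {hA}: X l - X r <= d.
  apply: (le_trans (down l r al lr rb)); apply/ltW; apply: le_lt_trans hA.
  apply: (le_trans _ (hKA _ A'0)); rewrite ler_wpM2l// ler_wpM2l//.
  have le_K x y : a <= x -> x <= y -> y <= b -> K * (y - x) <= K * (b - a).
    by move=> ? ? ?; rewrite ler_wpM2l//; lra.
  rewrite le_powR ?(ltW be0)//.
    by rewrite addr_ge0 ?powR_ge0// mulr_ge0.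
  by apply: lerD; rewrite ?le_K// (le_trans (up a l _ _ _)) ?lerD2l ?le_K//; lra.
move=> XlY.
have {}hK : K * (r - l) <= e' * Y r `^ (2 - p).
  rewrite mulrC; apply: (le_trans (hKA _ K0)); apply: (le_trans (ltW hK)).
  by rewrite ler_wpM2l ?(ltW e'0)// le_powR ?(ltW q0) ?(ltW d0)// /Y lerDr.
have key : X l - X r <= (r - l) * (A * ((1 + e) * Y r `^ (p - 1))).
  apply: (le_trans (down l r al lr rb)); rewrite ler_wpM2l// ler_wpM2l//.
  rewrite -/be -e'E (_ : Y r `^ (p - 1) = (Y r `^ (2 - p)) `^ be); last first.
    by rewrite -powRrM /be mulrCA divff ?gt_eqF// mulr1.
  rewrite -powRM ?powR_ge0//; last lra.
  rewrite le_powR ?(ltW be0) ?addr_ge0 ?powR_ge0 ?(mulr_ge0 K0)//.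
  rewrite mulrDl mul1r lerD// le_powR ?(ltW q0)// /Y; lra.
have := powR_tangent_concave q0 q1 (ltW (Y0 l)) (Y0 r).
have c0 : 0 <= (2 - p) * Y r `^ (2 - p - 1) by rewrite mulr_ge0 ?powR_ge0// ltW.
have E : Y r `^ (p - 1) * Y r `^ (2 - p - 1) = 1.
  rewrite -powRD ?(gt_eqF (Y0 r)) ?implybT//.
  by have -> : p - 1 + (2 - p - 1) = 0 by [ring]; rewrite powRr0.
have -> : Y l - Y r = X l - X r by rewrite /Y; ring.
have := ler_wpM2l c0 key.
rewrite [leRHS](_ : _ = K * (1 + e) * (r - l) * (Y r `^ (p - 1) * Y r `^ (2 - p - 1)));
  last by rewrite /K; ring.
by rewrite E mulr1 /P; lra.
Qed.

End ode.

(** * A smoothed truncation *)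
Section truncation.
Context {R : realType}.
Implicit Types (a b c d e r w z p : R).

(** [softpos e] is a convex function with Lipschitz derivative [softpos' e] that lies
    between [w - e] and [w] on the positive half-line. Composed with [excess e] and
    symmetrized, it gives an approximation [soft_abs e] of the absolute value that
    vanishes near 0, and its derivative [soft_sgn e]. *)
Definition excess e r := Num.max (r - e) 0.
Definition softpos e w := w ^+ 2 / (w + e).
Definition softpos' e w := 1 - (e / (w + e)) ^+ 2.
Definition soft_abs e r := softpos e (excess e r) + softpos e (excess e (- r)).
Definition soft_sgn e r := softpos' e (excess e r) - softpos' e (excess e (- r)).

Lemma excess_ge0 e r : 0 <= excess e r. Proof. by rewrite le_max lexx orbT. Qed.

Lemma excess_le e r : r - e <= excess e r. Proof. by rewrite le_max lexx. Qed.

Lemma excess_homo e a b : a <= b -> excess e a <= excess e b.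
Proof. by move=> ab; rewrite ge_max excess_ge0 andbT (le_trans _ (excess_le _ _))// lerD2r. Qed.

Lemma excess_sub e a b : a <= b -> excess e b - excess e a <= b - a.
Proof.
move=> ab; have := excess_le e a; have := excess_ge0 e a.
by rewrite {3}/excess /Num.max; case: ifPn => _; lra.
Qed.

Lemma excess_eq0 e r : r <= e -> excess e r = 0.
Proof. by move=> re; apply/max_idPr; rewrite subr_le0. Qed.

Section eps.
Variable e : R.
Hypothesis e0 : 0 < e.

Let z w := e / (w + e).

Let z_itv w : 0 <= w -> 0 < z w /\ z w <= 1.
Proof.
move=> w0; have we : 0 < w + e by rewrite ltr_wpDl.
by rewrite /z divr_gt0// ler_pdivrMr// mul1r lerDr.
Qed.

Let zE w : 0 <= w -> w = e * (z w)^-1 - e.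
Proof.
by move=> w0; rewrite /z invf_div mulrCA divff ?gt_eqF// mulr1 addrK.
Qed.

Let softposE w : 0 <= w -> softpos e w = w - e + e * z w.
Proof.
move=> w0; have we : 0 < w + e by rewrite ltr_wpDl.
by rewrite /softpos /z; field; rewrite gt_eqF.
Qed.

Lemma softpos_ge0 w : 0 <= w -> 0 <= softpos e w.
Proof. by move=> w0; rewrite /softpos divr_ge0 ?sqr_ge0 ?addr_ge0// ltW. Qed.

Lemma softpos_le w : 0 <= w -> softpos e w <= w.
Proof.
by move=> w0; rewrite softposE//; have [] := z_itv w0; have := e0; nra.
Qed.

Lemma softpos_ge w : 0 <= w -> w - e <= softpos e w.
Proof.
by move=> w0; rewrite softposE//; have [] := z_itv w0; have := e0; nra.
Qed.

Lemma softpos'_itv w : 0 <= w -> 0 <= softpos' e w /\ softpos' e w <= 1.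
Proof.
by move=> w0; rewrite /softpos' -/(z w); have [] := z_itv w0; move: (z w) => z'; nra.
Qed.

Lemma softpos'_homo w w' : 0 <= w -> w <= w' -> softpos' e w <= softpos' e w'.
Proof.
move=> w0 ww'; have w'0 := le_trans w0 ww'.
have [a1 a2] := z_itv w0; have [b1 b2] := z_itv w'0.
rewrite /softpos' -/(z w) -/(z w') lerD2l lerN2.
rewrite ler_sqr ?nnegrE ?(ltW a1) ?(ltW b1)//.
by rewrite /z ler_pM2l// lef_pV2 ?posrE ?lerD2r// ltr_wpDl.
Qed.

Lemma softpos'_lip w w' : 0 <= w -> w <= w' -> softpos' e w' - softpos' e w <= 2 / e * (w' - w).
Proof.
move=> w0 ww'; have w'0 := le_trans w0 ww'.
have [a1 a2] := z_itv w0; have [b1 b2] := z_itv w'0.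
have we : 0 < w + e by rewrite ltr_wpDl.
have we' : 0 < w' + e by rewrite ltr_wpDl.
have -> : softpos' e w' - softpos' e w = (z w - z w') * (z w + z w').
  by rewrite /softpos' -/(z w) -/(z w'); ring.
have -> : z w - z w' = z w * z w' * ((w' - w) / e).
  by rewrite /z; field; rewrite !gt_eqF.
have -> : 2 / e * (w' - w) = 2 * ((w' - w) / e) by ring.
have : 0 <= (w' - w) / e by rewrite divr_ge0 ?subr_ge0// ltW.
move: (_ / e) => q q0.
rewrite mulrAC ler_wpM2r//.
have : z w * z w' <= 1 by rewrite mulr_ile1// ltW.
have : 0 <= z w * z w' by rewrite mulr_ge0// ltW.
nra.
Qed.

Lemma softpos_convex w w' : 0 <= w -> 0 <= w' ->
  softpos' e w * (w' - w) <= softpos e w' - softpos e w.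
Proof.
move=> w0 w'0; rewrite !softposE// /softpos' -/(z w).
have [a1 _] := z_itv w0; have [b1 _] := z_itv w'0.
suff : 0 <= e * (z w' - z w) + z w ^+ 2 * (w' - w) by lra.
have -> : w' - w = e * (z w')^-1 - e * (z w)^-1.
  by rewrite {1}(zE w'0) {1}(zE w0); ring.
have -> : e * (z w' - z w) + z w ^+ 2 * (e * (z w')^-1 - e * (z w)^-1) =
    e * (z w' - z w) ^+ 2 / z w'.
  by field; rewrite !gt_eqF.
by apply: divr_ge0; [apply: mulr_ge0; [exact: ltW|exact: sqr_ge0]|exact: ltW].
Qed.

Let pos_convex a b : softpos' e (excess e a) * (b - a) <= softpos e (excess e b) - softpos e (excess e a).
Proof.
apply: le_trans (softpos_convex (excess_ge0 e a) (excess_ge0 e b)).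
have [h0 _] := softpos'_itv (excess_ge0 e a).
have [ae|ea] := leP a e.
  rewrite (excess_eq0 ae) /softpos' add0r divff ?gt_eqF// expr1n subrr !mul0r.
  by [].
rewrite ler_wpM2l//.
have -> : excess e a = a - e by apply/max_idPl; rewrite subr_ge0 ltW.
by have := excess_le e b; lra.
Qed.

Lemma soft_abs_ge0 r : 0 <= soft_abs e r.
Proof. by rewrite /soft_abs addr_ge0 ?softpos_ge0 ?excess_ge0. Qed.

Lemma soft_abs_le r : soft_abs e r <= excess e `|r|.
Proof.
have [r0|r0] := leP 0 r.
  rewrite ger0_norm// /soft_abs (excess_eq0 (_ : - r <= e)); last by move: e0; lra.
  by rewrite /softpos expr0n/= mul0r addr0 softpos_le ?excess_ge0.
rewrite ltr0_norm// /soft_abs (excess_eq0 (_ : r <= e)); last by move: e0; lra.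
by rewrite {1}/softpos expr0n/= mul0r add0r softpos_le ?excess_ge0.
Qed.

Lemma le_soft_abs r : `|r| <= soft_abs e r + 2 * e.
Proof.
have h1 := softpos_ge (excess_ge0 e r); have h2 := softpos_ge (excess_ge0 e (- r)).
have h3 := softpos_ge0 (excess_ge0 e r); have h4 := softpos_ge0 (excess_ge0 e (- r)).
have h5 := excess_le e r; have h6 := excess_le e (- r).
by rewrite /soft_abs ler_norml; lra.
Qed.

Lemma soft_abs_convex a b : soft_sgn e a * (b - a) <= soft_abs e b - soft_abs e a.
Proof.
by have := pos_convex a b; have := pos_convex (- a) (- b); rewrite /soft_sgn /soft_abs; lra.
Qed.

Lemma soft_sgn_homo a b : a <= b -> soft_sgn e a <= soft_sgn e b.
Proof.
move=> ab; have ba : - b <= - a by rewrite lerN2.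
have := softpos'_homo (excess_ge0 e a) (excess_homo e ab).
have := softpos'_homo (excess_ge0 e (- b)) (excess_homo e ba).
by rewrite /soft_sgn; lra.
Qed.

Lemma soft_sgn_norm r : `|soft_sgn e r| <= 1.
Proof.
have [h1 h2] := softpos'_itv (excess_ge0 e r).
have [h3 h4] := softpos'_itv (excess_ge0 e (- r)).
by rewrite /soft_sgn ler_norml; lra.
Qed.

Lemma soft_sgn_lip a b : a <= b -> soft_sgn e b - soft_sgn e a <= 4 / e * (b - a).
Proof.
move=> ab; have ba : - b <= - a by rewrite lerN2.
have h1 := softpos'_lip (excess_ge0 e a) (excess_homo e ab).
have h2 := softpos'_lip (excess_ge0 e (- b)) (excess_homo e ba).
have E0 : 0 <= 2 / e by rewrite divr_ge0// ltW.
have h3 := ler_wpM2l E0 (excess_sub e ab).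
have h4 := ler_wpM2l E0 (excess_sub e ba).
rewrite (_ : 4 / e * (b - a) = 2 / e * (b - a) + 2 / e * (- a - - b)); last by ring.
by rewrite /soft_sgn; lra.
Qed.

Lemma soft_sgn_eq0 r : `|r| <= e -> soft_sgn e r = 0.
Proof.
by rewrite ler_norml => /andP[h1 h2]; rewrite /soft_sgn !excess_eq0 ?subrr//; lra.
Qed.

Lemma soft_sgn0 : soft_sgn e 0 = 0. Proof. by rewrite soft_sgn_eq0// normr0 ltW. Qed.

Lemma soft_sgn_ge0 r : 0 <= r -> 0 <= soft_sgn e r.
Proof. by move=> /soft_sgn_homo; rewrite soft_sgn0. Qed.

Lemma soft_sgn_le0 r : r <= 0 -> soft_sgn e r <= 0.
Proof. by move=> /soft_sgn_homo; rewrite soft_sgn0. Qed.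

(** The perturbation [g(u) phi] of [u]: its increment splits into a part of the
    sign of the increment of [u], which only contracts it, and [g] at the value of
    smaller modulus times the increment of [phi]. The convexity of [G] bounds
    the product of this value of [g] with the increment of [u]. *)
Lemma trunc_perturb p (B tau a b f1 f2 : R) : 1 < p -> p < 2 ->
  0 <= f1 -> f1 <= B -> 0 <= f2 -> f2 <= B -> 0 <= tau -> tau * (4 / e * B) <= 1 ->
  `|a - b - tau * (soft_sgn e a * f1 - soft_sgn e b * f2)| `^ p <= `|a - b| `^ p +
    p * tau * ((soft_abs e a `^ (p - 1) + soft_abs e b `^ (p - 1)) * `|f1 - f2| +
       tau `^ (p - 1) * ((B `^ (p - 1) * `|soft_sgn e a| + B `^ (p - 1) * `|soft_sgn e b|)
                         * `|f1 - f2|)).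
Proof.
move=> p1 p2.
wlog ba : a b f1 f2 / b <= a.
  move=> H f10 f1B f20 f2B t0 tB.
  have /orP[ba|ab] := le_total b a; first exact: H.
  have := H b a f2 f1 ab f20 f2B f10 f1B t0 tB.
  have -> : `|b - a - tau * (soft_sgn e b * f2 - soft_sgn e a * f1)| =
            `|a - b - tau * (soft_sgn e a * f1 - soft_sgn e b * f2)|.
    by rewrite -normrN; congr (`|_|); ring.
  rewrite (distrC b) (distrC f2).
  by rewrite (addrC (soft_abs e b `^ _)) (addrC (_ * `|soft_sgn e b|)).
move=> f10 f1B f20 f2B t0 tB.
have B0 : 0 <= B by exact: le_trans f1B.
have gab := soft_sgn_homo ba; have gl := soft_sgn_lip ba.
(* [c] is the value of smaller modulus, or 0 if the signs differ, and [o] the other *)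
have step c o e1 e2 : soft_sgn e a * f1 - soft_sgn e b * f2 = e1 + e2 ->
    0 <= e1 -> e1 <= (soft_sgn e a - soft_sgn e b) * B ->
    `|e2| <= `|soft_sgn e c| * `|f1 - f2| ->
    `|soft_sgn e c| * (a - b) <= soft_abs e o ->
    soft_abs e o `^ (p - 1) <= soft_abs e a `^ (p - 1) + soft_abs e b `^ (p - 1) ->
    `|soft_sgn e c| <= `|soft_sgn e a| + `|soft_sgn e b| ->
  `|a - b - tau * (soft_sgn e a * f1 - soft_sgn e b * f2)| `^ p <= `|a - b| `^ p +
    p * tau * ((soft_abs e a `^ (p - 1) + soft_abs e b `^ (p - 1)) * `|f1 - f2| +
       tau `^ (p - 1) * ((B `^ (p - 1) * `|soft_sgn e a| + B `^ (p - 1) * `|soft_sgn e b|)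
                         * `|f1 - f2|)).
  move=> -> e10 e1B e2c goc Go gc.
  have te1 : tau * e1 <= a - b.
    apply: (@le_trans _ _ (tau * (4 / e * B) * (a - b))); last first.
      by rewrite ler_piMl// subr_ge0.
    rewrite -mulrA ler_wpM2l//; apply: (le_trans e1B).
    by rewrite mulrAC ler_wpM2r.
  have te10 : 0 <= tau * e1 by rewrite mulr_ge0.
  have ab0 : 0 <= a - b by rewrite subr_ge0.
  have -> : a - b - tau * (e1 + e2) = (a - b - tau * e1) - tau * e2 by ring.
  apply: (le_trans (@powR_perturb _ p (a - b) _ e2 tau p1 p2 _ t0)).
    by rewrite !ger0_norm//; lra.
  rewrite lerD2l ler_wpM2l ?mulr_ge0//; first by lra.
  have p10 : 0 <= p - 1 by lra.
  have g1 := soft_sgn_norm c.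
  have gp : `|soft_sgn e c| <= `|soft_sgn e c| `^ (p - 1).
    have [->|gc0] := eqVneq `|soft_sgn e c| 0; first exact: powR_ge0.
    have gc1 : 0 < `|soft_sgn e c| by rewrite lt_neqAle eq_sym gc0 normr_ge0.
    by rewrite ger1_powR ?gc1//; lra.
  have gdp : `|soft_sgn e c| * `|a - b| `^ (p - 1) <= soft_abs e o `^ (p - 1).
    apply: (le_trans (ler_wpM2r (powR_ge0 _ _) gp)).
    by rewrite -powRM// le_powR ?mulr_ge0// (ger0_norm ab0).
  apply: lerD.
    apply: (le_trans (ler_wpM2r (powR_ge0 _ _) e2c)).
    by rewrite mulrAC ler_wpM2r// (le_trans gdp).
  rewrite ler_wpM2l ?powR_ge0//.
  have p0 : 0 <= p by lra.
  apply: (le_trans (le_powR p0 (normr_ge0 _) e2c)); rewrite powRM//.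
  have fB : `|f1 - f2| <= B by rewrite ler_norml; lra.
  have -> : `|f1 - f2| `^ p = `|f1 - f2| * `|f1 - f2| `^ (p - 1).
    by rewrite mulr_powRB1//; lra.
  rewrite mulrCA mulrC ler_wpM2r// -mulrDr mulrC ler_pM ?powR_ge0 ?le_powR//.
  apply: le_trans gc; have [->|gc0] := eqVneq `|soft_sgn e c| 0; first by rewrite powR0//; lra.
  have gc1 : 0 < `|soft_sgn e c| by rewrite lt_neqAle eq_sym gc0 normr_ge0.
  by rewrite ge1r_powR ?gc1//; lra.
have G0 r : 0 <= soft_abs e r `^ (p - 1) by exact: powR_ge0.
have [b0|b0] := leP 0 b; [|have [a0|a0] := leP a 0].
- apply: (step b a ((soft_sgn e a - soft_sgn e b) * f1) (soft_sgn e b * (f1 - f2))); first by ring.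
  + by rewrite mulr_ge0// subr_ge0.
  + by rewrite ler_wpM2l// subr_ge0.
  + by rewrite normrM.
  + rewrite ger0_norm ?soft_sgn_ge0// (le_trans (soft_abs_convex _ _))// gerBl.
    exact: soft_abs_ge0.
  + by rewrite lerDl.
  + by rewrite lerDr.
- apply: (step a b ((soft_sgn e a - soft_sgn e b) * f2) (soft_sgn e a * (f1 - f2))); first by ring.
  + by rewrite mulr_ge0// subr_ge0.
  + by rewrite ler_wpM2l// subr_ge0.
  + by rewrite normrM.
  + rewrite ler0_norm ?soft_sgn_le0//.
    rewrite mulNr -mulrN opprB (le_trans (soft_abs_convex _ _))// gerBl.
    exact: soft_abs_ge0.
  + by rewrite lerDr.
  + by rewrite lerDl.
- have ga := soft_sgn_ge0 (ltW a0); have gb := soft_sgn_le0 (ltW b0).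
  have e1ge0 : 0 <= soft_sgn e a * f1 - soft_sgn e b * f2.
    by rewrite subr_ge0 (@le_trans _ _ 0)// ?mulr_ge0// mulr_le0_ge0.
  have e1le : soft_sgn e a * f1 - soft_sgn e b * f2 <= (soft_sgn e a - soft_sgn e b) * B.
    rewrite (mulrBl B (soft_sgn e a) (soft_sgn e b)); apply: lerD; first by rewrite ler_wpM2l.
    by rewrite lerN2 ler_wnM2l.
  apply: (step 0 a (soft_sgn e a * f1 - soft_sgn e b * f2) 0); rewrite ?soft_sgn0 ?normr0 ?mul0r ?soft_abs_ge0//.
  + by rewrite addr0.
  + by rewrite lerDl.
Qed.

End eps.
End truncation.

(** * Lebesgue measure on [R^n] *)
Section lebesgue_rV_facts.
Context {R : realType} {N : nat}.
Local Notation E := 'rV[R]_N.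
Local Notation mu := (@leb R N).

Lemma measurable_rV_forall (A : 'I_N -> set R) : (forall i, measurable (A i)) ->
  measurable [set x : E | forall i, A i (x ord0 i)].
Proof.
move=> mA; rewrite (_ : [set _ | _] = \bigcap_(i in [set: 'I_N])
    (rV_coord i @^-1` A i)); last first.
  by apply/seteqP; split => [x Ax i _|x Ax i]; apply: Ax.
apply: fin_bigcap_measurable => // i _; rewrite -[X in measurable X]setTI.
exact: measurable_rV_coord.
Qed.

Definition cube (k : R) : set E := [set x | forall i, `[- k, k]%classic (x ord0 i)].

Lemma measurable_cube k : measurable (cube k).
Proof. by apply: (@measurable_rV_forall (fun=> _)) => i; exact: measurable_itv. Qed.

Lemma leb_cube k : (mu (cube k) < +oo)%E.
Proof.
have -> : mu (cube k) = (\prod_(i < N) lebesgue_measure `[(- k)%R, k]%classic)%E.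
  by rewrite -(leb_box (A := fun=> _))// => i; exact: measurable_itv.
suff H : (\prod_(i < N) lebesgue_measure `[(- k)%R, k]%classic)%E \is a fin_num.
  by rewrite ltey_eq H.
elim/big_ind : _ => // [x y|i _]; first exact: fin_numM.
by rewrite lebesgue_measure_itv/=; case: ifP => _.
Qed.

Lemma cube_cover : [set: E] = \bigcup_k cube k%:R.
Proof.
apply/esym/seteqP; split => // x _.
pose m := \sum_i `|x ord0 i|.
have [n mn] : exists n : nat, m <= n%:R.
  exists (Num.bound m); rewrite ltW//; apply: archi_boundP.
  by rewrite sumr_ge0.
exists n => // i; rewrite /= in_itv/= -ler_norml (le_trans _ mn)//.
by rewrite /m (bigD1 i)//= lerDl sumr_ge0.
Qed.

Lemma leb_sigma_finite : sigma_finite setT mu.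
Proof.
exists (fun k => cube k%:R); first exact: cube_cover.
by move=> k; split; [exact: measurable_cube|exact: leb_cube].
Qed.

(** A copy of [leb] to carry the sigma-finite structure that Tonelli's theorem needs. *)
Definition leb_sf : set E -> \bar R := mu.
HB.instance Definition _ := Measure.copy leb_sf mu.
HB.instance Definition _ := Measure_isSigmaFinite.Build _ _ _ leb_sf leb_sigma_finite.

Local Open Scope ereal_scope.
Lemma leb_tonelli (f : E * E -> \bar R) : measurable_fun setT f ->
  (forall z, 0 <= f z) ->
  \int[mu]_x \int[mu]_y f (x, y) = \int[mu]_y \int[mu]_x f (x, y).
Proof.
move=> mf f0.
exact: (@fubini_tonelli _ _ _ _ R leb_sf leb_sf f mf f0).
Qed.

Lemma measurable_leb_int (f : E * E -> \bar R) : measurable_fun setT f ->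
  (forall z, 0 <= f z) -> measurable_fun setT (fun x => \int[mu]_y f (x, y)).
Proof.
move=> mf f0.
exact: (@measurable_fun_fubini_tonelli_F _ _ _ _ R leb_sf f mf f0).
Qed.

Lemma leb_setT : (0 < N)%N -> mu setT = +oo.
Proof.
have -> : mu setT = \prod_(i < N) lebesgue_measure [set: R].
  rewrite -(leb_box (A := fun=> _))//; congr (mu _).
  by apply/esym/seteqP.
have -> : lebesgue_measure [set: R] = +oo.
  by rewrite -set_itvNyy lebesgue_measure_itv.
elim: N => // n IHn _; rewrite big_ord_recl; case: n IHn => [|n] IHn.
  by rewrite big_ord0 mule1.
by rewrite IHn// mulyy.
Qed.

Local Close Scope ereal_scope.

(** The sigma-algebra is generated by the coordinates: an open set has to be written as
    a countable union of rational boxes. *)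
Lemma open_measurable_rV (U : set E) : open U -> measurable U.
Proof.
move=> oU.
pose B (qm : 'rV[rat]_N * nat) : set E :=
  [set x | forall i, `]ratr (qm.1 ord0 i) - qm.2.+1%:R^-1,
                       ratr (qm.1 ord0 i) + qm.2.+1%:R^-1[%classic (x ord0 i)].
have -> : U = \bigcup_qm (if `[< B qm `<=` U >] then B qm else set0).
  apply/seteqP; split => [x Ux|x [qm _]]; last first.
    by case: asboolP => [H Bx|//]; exact: H.
  have /nbhs_ballP[e /= e0 eU] : nbhs x U by apply: open_nbhs_nbhs.
  pose m := Num.bound (2 / e).
  have me : 2 / m.+1%:R < e.
    rewrite ltr_pdivrMr// mulrC -ltr_pdivrMr// (lt_trans (archi_boundP _))//.
      by rewrite divr_ge0// ltW.
    by rewrite ltr_nat.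
  have m0 : 0 < m.+1%:R^-1 :> R by rewrite invr_gt0.
  have /choice[q qx] : forall i, exists q : rat,
      x ord0 i - m.+1%:R^-1 < ratr q < x ord0 i + m.+1%:R^-1.
    move=> i; have /rat_in_itvoo[q] : x ord0 i - m.+1%:R^-1 < x ord0 i + m.+1%:R^-1.
      by move: (_^-1) m0 => d m0; lra.
    by rewrite in_itv/= => ?; exists q.
  exists (\row_i q i, m) => //.
  case: asboolP => [_ i|[]].
    rewrite /= mxE in_itv/=; have := qx i.
    by move: (_^-1) => d; lra.
  move=> y By; apply: eU; split => // i j; rewrite ord1.
  have := By j; have := qx j; rewrite /= mxE in_itv/=.
  rewrite /ball/= ltr_norml; move: me m0; move: (_^-1) => d; lra.
apply: countable_bigcupT_measurable => // qm.
case: ifP => // _; apply: (@measurable_rV_forall (fun i => `]ratr (qm.1 ord0 i) - qm.2.+1%:R^-1,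
  ratr (qm.1 ord0 i) + qm.2.+1%:R^-1[%classic)) => i; exact: measurable_itv.
Qed.

Lemma continuous_measurable_rV (f : E -> R) : continuous f -> measurable_fun setT f.
Proof.
move=> cf; apply: (measurability _ (RGenOInfty.measurableE R)) => //.
move=> _ [_ [a ->] <-]; rewrite setTI; apply: open_measurable_rV.
by apply: open_comp => // x _; exact: cf.
Qed.

Lemma measurable_enorm : measurable_fun setT (@enorm R N).
Proof.
apply: measurableT_comp.
  exact: (continuous_measurable_fun (@sqrt_continuous R)).
apply: measurable_sum => i; apply: measurable_funX.
exact: (@measurable_rV_coord R N i).
Qed.

Lemma measurable_rV_sub : measurable_fun setT (fun z : E * E => z.1 - z.2).
Proof.
apply: measurable_fun_rVP => i.
rewrite (_ : _ \o _ = (@rV_coord R N i \o fst) \- (@rV_coord R N i \o snd)).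
  by apply: measurable_funB; apply: measurableT_comp => //; exact: measurable_rV_coord.
by apply/funext => z; rewrite /= /rV_coord !mxE.
Qed.

Lemma le_enorm (x : E) i : `|x ord0 i| <= enorm x.
Proof.
rewrite -sqrtr_sqr ler_wsqrtr// (bigD1 i)//= lerDl sumr_ge0// => j _.
exact: sqr_ge0.
Qed.

Lemma enorm_cube (r : R) : [set x : E | enorm x <= r] `<=` cube r.
Proof.
by move=> x xr i; rewrite /= in_itv/= -ler_norml (le_trans (le_enorm x i)).
Qed.

Lemma leb_enorm (r : R) : (mu [set x : E | enorm x <= r]%R < +oo)%E.
Proof.
apply: le_lt_trans (leb_cube r); apply: le_measure; rewrite ?inE//.
- rewrite -[X in measurable X]setTI.
  rewrite (_ : _ `&` _ = [set: E] `&` (@enorm R N @^-1` `]-oo, r])).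
    exact: measurable_enorm.
  by congr (_ `&` _); apply/seteqP; split => x /=; rewrite in_itv.
- exact: measurable_cube.
- exact: enorm_cube.
Qed.

Lemma bounded_vanishing (phi : E -> R) : continuous phi ->
  vanishes_at_infinity phi -> exists2 B, 0 < B & forall x, phi x <= B.
Proof.
move=> cphi /(_ 1 ltr01)[r Hr].
have cK : compact (cube r).
  by apply: (@rV_compact _ N (fun=> `[- r, r]%classic)) => i; exact: segment_compact.
have [[x0 Kx0]|K0] := pselect (cube r !=set0).
  have [||c _ Hc] := @EVT_max_rV R N phi (cube r) _ cK.
  - by exists x0.
  - by apply: continuous_subspaceT => x; exact: cphi.
  exists (Num.max 1 (phi c)); first by rewrite lt_max ltr01.
  move=> x; have [xr|rx] := leP (enorm x) r.
    by rewrite le_max (Hc x) ?orbT// inE; exact: enorm_cube.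
  by rewrite le_max (le_trans (ler_norm _))// ltW// Hr.
exists 1 => // x; have [xr|rx] := leP (enorm x) r.
  by exfalso; apply: K0; exists x; exact: enorm_cube.
by rewrite (le_trans (ler_norm _))// ltW// Hr.
Qed.

End lebesgue_rV_facts.

(** * Integrals of nonnegative real functions *)
Section nonneg_integral.
Context d (T : measurableType d) (R : realType) (mu : {measure set T -> \bar R}).
Implicit Types f g : T -> R.
Local Open Scope ereal_scope.

Lemma le_intR f g : measurable_fun setT f -> measurable_fun setT g ->
  (forall x, (0 <= f x)%R) -> (forall x, (f x <= g x)%R) ->
  \int[mu]_x (f x)%:E <= \int[mu]_x (g x)%:E.
Proof.
move=> mf mg f0 fg; apply: ge0_le_integral => //; try exact/measurable_EFinP.
- by move=> x _; rewrite lee_fin.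
- by move=> x _; rewrite lee_fin.
Qed.

Lemma intR_ge0 f : (forall x, (0 <= f x)%R) -> 0 <= \int[mu]_x (f x)%:E.
Proof. by move=> f0; apply: integral_ge0 => x _; rewrite lee_fin. Qed.

Lemma intRD f g : measurable_fun setT f -> measurable_fun setT g ->
  (forall x, (0 <= f x)%R) -> (forall x, (0 <= g x)%R) ->
  \int[mu]_x (f x + g x)%:E = \int[mu]_x (f x)%:E + \int[mu]_x (g x)%:E.
Proof.
move=> mf mg f0 g0; under eq_integral do rewrite EFinD.
by apply: ge0_integralD => //; try exact/measurable_EFinP; move=> x _; rewrite lee_fin.
Qed.

Lemma intRZ (c : R) f : measurable_fun setT f ->
  (forall x, (0 <= f x)%R) -> (0 <= c)%R ->
  \int[mu]_x (c * f x)%:E = c%:E * \int[mu]_x (f x)%:E.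
Proof.
move=> mf f0 c0; under eq_integral do rewrite EFinM.
by apply: ge0_integralZl => //; [exact/measurable_EFinP|move=> x _; rewrite lee_fin].
Qed.

Lemma measurable_powRl f (r : R) : measurable_fun setT f ->
  measurable_fun setT (fun x => f x `^ r)%R.
Proof. exact: (@measurableT_comp _ _ _ _ _ _ (@powR R ^~ r)). Qed.

Lemma measurable_absR f : measurable_fun setT f ->
  measurable_fun setT (fun x => `|f x|)%R.
Proof. exact: (@measurableT_comp _ _ _ _ _ _ (@Num.norm _ R)). Qed.

End nonneg_integral.


(** * The kernel and the operator [M] *)
Section operator.
Context {R : realType} {N : nat}.
Variables (s p : R).
Local Notation E := 'rV[R]_N.
Local Notation mu := (@leb R N).
Implicit Types (phi psi : E -> R).

Definition knl (x y : E) : R := (enorm (x - y) `^ (N%:R + s * p))^-1.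

Lemma knl_ge0 x y : 0 <= knl x y. Proof. by rewrite invr_ge0 powR_ge0. Qed.

Lemma knlC x y : knl x y = knl y x.
Proof.
rewrite /knl; congr ((_ `^ _)^-1); congr Num.sqrt; apply: eq_bigr => i _.
by rewrite !mxE -[LHS]sqrrN opprB.
Qed.

Lemma measurable_knl : measurable_fun setT (fun z : E * E => knl z.1 z.2).
Proof.
rewrite /knl; under eq_fun do rewrite -powRN.
apply: measurable_powRl; apply: measurableT_comp; first exact: measurable_enorm.
exact: measurable_rV_sub.
Qed.

Lemma measurable_fst (f : E -> R) : measurable_fun setT f ->
  measurable_fun setT (fun z : E * E => f z.1).
Proof. by move=> mf; apply: measurableT_comp. Qed.

Lemma measurable_snd (f : E -> R) : measurable_fun setT f ->
  measurable_fun setT (fun z : E * E => f z.2).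
Proof. by move=> mf; apply: measurableT_comp. Qed.

Lemma measurable_diff phi : measurable_fun setT phi ->
  measurable_fun setT (fun z : E * E => `|phi z.1 - phi z.2|).
Proof.
move=> mphi; apply: measurable_absR.
by apply: measurable_funB; [exact: measurable_fst|exact: measurable_snd].
Qed.

Lemma measurable_ptl (f : E * E -> R) x : measurable_fun setT f ->
  measurable_fun setT (fun y => f (x, y)).
Proof.
by move=> mf; apply: (measurableT_comp mf); exact: measurable_pair1.
Qed.

Local Open Scope ereal_scope.

Definition Mop phi (x : E) : \bar R :=
  \int[mu]_y (`|phi x - phi y| * knl x y)%:E.

Lemma Mop_ge0 phi x : 0 <= Mop phi x.
Proof. by apply: intR_ge0 => y; rewrite mulr_ge0// knl_ge0. Qed.

Lemma measurable_Mop phi : measurable_fun setT phi ->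
  measurable_fun setT (Mop phi).
Proof.
move=> mphi; apply: (measurable_leb_int
  (f := fun z => (`|phi z.1 - phi z.2| * knl z.1 z.2)%:E)).
  apply/measurable_EFinP; apply: measurable_funM; first exact: measurable_diff.
  exact: measurable_knl.
by move=> z; rewrite lee_fin mulr_ge0// knl_ge0.
Qed.

(** The truncated integrals increase as the excised ball shrinks, and the
    integrand vanishes on the diagonal: the principal value is an integral. *)
Lemma MspE phi x : measurable_fun setT phi -> Msp s p phi x = Mop phi x.
Proof.
move=> mphi; rewrite /Msp /pv_integral.
set k := fun y => (`|phi x - phi y| / _)%:E.
have k0 y : 0 <= k y by rewrite lee_fin mulr_ge0// invr_ge0 powR_ge0.
have mk : measurable_fun setT k.
  apply/measurable_EFinP.
  apply: (@measurable_ptl (fun z => `|phi z.1 - phi z.2| * knl z.1 z.2)%R x).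
  apply: measurable_funM; first exact: measurable_diff.
  exact: measurable_knl.
pose S e := [set y : E | (e < enorm (x - y))%R].
have mS e : measurable (S e).
  rewrite (_ : S e = setT `&` ((fun y => enorm (x - y)) @^-1` `]e, +oo[)).
    apply: (@measurable_ptl (fun z => enorm (z.1 - z.2)) x) => //.
    by apply: measurableT_comp; [exact: measurable_enorm|exact: measurable_rV_sub].
  by apply/seteqP; split => y /=; rewrite in_itv/= andbT => // -[].
have Smono e e' : (e <= e')%R -> S e' `<=` S e.
  by move=> ee' y; exact: le_lt_trans.
have SU : \bigcup_n S (n.+1%:R^-1)%R = [set y | enorm (x - y) != 0%R].
  apply/seteqP; split => [y [n _ /=]|y /= y0].
    by move=> h; rewrite gt_eqF// (lt_trans _ h)// invr_gt0.
  have {}y0 : (0 < enorm (x - y))%R by rewrite lt_neqAle eq_sym y0 sqrtr_ge0.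
  exists (Num.bound (enorm (x - y))^-1) => //.
  rewrite /S/= invf_plt ?posrE// (lt_trans (archi_boundP _)) ?invr_ge0 ?(ltW y0)//.
  by rewrite ltr_nat.
have kU : \int[mu]_(y in \bigcup_n S (n.+1%:R^-1)%R) k y = Mop phi x.
  rewrite SU integral_mkcond; apply: eq_integral => y _.
  rewrite patchE; case: ifPn => //; rewrite notin_setE/= => /negP/negPn/eqP.
  rewrite /k => xy0; suff -> : y = x by rewrite subrr normr0 mul0r.
  apply/rowP => i; apply/eqP; rewrite eq_sym -subr_eq0 -normr_le0 -xy0.
  by have := le_enorm (x - y) i; rewrite !mxE.
pose g e := \int[mu]_(y in S e) k y.
have g_le e : g e <= Mop phi x.
  exact: (@ge0_subset_integral _ _ _ mu (S e) setT).
have g_mono : {in `]0%R, +oo[ &, nonincreasing_fun g}.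
  move=> e e' _ _ ee'; apply: ge0_subset_integral => //.
  - exact: measurable_funTS.
  - exact: Smono.
have := @nonincreasing_at_right_cvge R g 0%R (BInfty _ false) isT g_mono.
move=> /cvg_lim -> //; apply/eqP; rewrite eq_le; apply/andP; split.
  by apply: ge_ereal_sup => _ [e _ <-]; exact: g_le.
rewrite -kU; have gU : g (n.+1%:R^-1)%R @[n --> \oo] --> \int[mu]_(y in \bigcup_n S (n.+1%:R^-1)%R) k y.
  apply: ge0_nondecreasing_set_cvg_integral => //.
  - move=> m n mn; apply/subsetPset; apply: Smono.
    by rewrite lef_pV2 ?posrE// ler_nat.
  by move=> n; exact: measurable_funTS.
rewrite -(cvg_lim _ gU)//; apply: lime_le; first by apply/cvg_ex; eexists; exact: gU.
apply: nearW => n; apply: ereal_sup_ubound; exists (n.+1%:R^-1)%R => //.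
by rewrite /= in_itv/= andbT invr_gt0.
Qed.

End operator.

(** * Weights *)
Section weights.
Context {R : realType} {N : nat}.
Variables (s p : R).
Local Notation E := 'rV[R]_N.
Local Notation mu := (@leb R N).
Local Notation knl := (@knl R N s p).
Local Notation Mop := (@Mop R N s p).
Implicit Types (phi psi m : E -> R).
Local Open Scope ereal_scope.

(** The consequences of membership in the class [C(s, p)] from which the estimates
    follow: [m] is [M phi], [B] bounds [phi] and [C] is [C(phi)]. *)
Record regular_weight phi m (B C : R) : Prop := RegularWeight {
  rw_meas : measurable_fun setT phi ;
  rw_gt0 : forall x, (0 < phi x)%R ;
  rw_le : forall x, (phi x <= B)%R ;
  rw_vanish : forall e, (0 < e)%R -> mu [set x | (e < phi x)%R] < +oo ;
  rw_measM : measurable_fun setT m ;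
  rw_M : forall x, Mop phi x = (m x)%:E ;
  rw_C : \int[mu]_x (m x `^ (2 - p)^-1 * (phi x `^ ((p - 1) / (2 - p)))^-1)%:E
         = C%:E }.

(** Tonelli's theorem and the symmetry of the kernel. *)
Lemma int_int_sym (P psi : E -> R) : measurable_fun setT P ->
  measurable_fun setT psi -> (forall x, (0 <= P x)%R) ->
  \int[mu]_x \int[mu]_y ((P x + P y) * (`|psi x - psi y| * knl x y))%:E =
  2%:E * \int[mu]_x ((P x)%:E * Mop psi x).
Proof.
move=> mP mpsi P0.
pose f (z : E * E) : R := (P z.1 * (`|psi z.1 - psi z.2| * knl z.1 z.2))%R.
have mk : measurable_fun setT (fun z : E * E => `|psi z.1 - psi z.2| * knl z.1 z.2)%R.
  by apply: measurable_funM; [exact: measurable_diff|exact: measurable_knl].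
have mf : measurable_fun setT f.
  by apply: measurable_funM => //; exact: measurable_fst.
have k0 x y : (0 <= `|psi x - psi y| * knl x y)%R by rewrite mulr_ge0// knl_ge0.
have f0 z : 0 <= (f z)%:E by rewrite lee_fin mulr_ge0.
have mF : measurable_fun setT (fun z => (f z)%:E) by exact/measurable_EFinP.
have fE : \int[mu]_x \int[mu]_y (f (x, y))%:E = \int[mu]_x ((P x)%:E * Mop psi x).
  apply: eq_integral => x _; rewrite /f/= intRZ//.
  exact: (measurable_ptl _ mk).
have mfs : measurable_fun setT (fun z : E * E => (f (z.2, z.1))%:E).
  apply/measurable_EFinP; apply: (measurableT_comp mf).
  exact: measurable_swap.
transitivity (\int[mu]_x (\int[mu]_y (f (x, y))%:E + \int[mu]_y (f (y, x))%:E)).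
  apply: eq_integral => x _.
  have := @intRD _ _ _ mu (fun y => f (x, y)) (fun y => f (y, x)) => <-.
  - apply: eq_integral => y _; congr EFin; rewrite /f/=.
    by rewrite (knlC _ _ y x) (distrC (psi y)); ring.
  - exact: measurable_ptl.
  - by apply: (@measurable_ptl _ _ (fun z => f (z.2, z.1)) x); exact/measurable_EFinP.
  - by move=> y; have := f0 (x, y); rewrite lee_fin.
  - by move=> y; have := f0 (y, x); rewrite lee_fin.
have Isym : \int[mu]_x \int[mu]_y (f (y, x))%:E = \int[mu]_x ((P x)%:E * Mop psi x).
  by rewrite -fE; exact/esym/(leb_tonelli mF f0).
transitivity (\int[mu]_x \int[mu]_y (f (x, y))%:E + \int[mu]_x \int[mu]_y (f (y, x))%:E).
  apply: ge0_integralD => //.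
  - by move=> x _; apply: integral_ge0.
  - refine (measurable_leb_int (f := fun z => (f z)%:E) mF f0).
  - by move=> x _; apply: integral_ge0.
  - refine (measurable_leb_int (f := fun z => (f (z.2, z.1))%:E) mfs _).
    by move=> z; exact: f0.
refine (etrans (f_equal2 _ fE Isym) _).
by rewrite -mule2n mule_natl.
Qed.

Section regular.
Variables (phi m : E -> R) (B C : R).
Hypothesis W : regular_weight phi m B C.

Lemma rw_m0 x : (0 <= m x)%R.
Proof. by rewrite -lee_fin -(rw_M W) Mop_ge0. Qed.

Lemma rw_C0 : (0 <= C)%R.
Proof.
rewrite -lee_fin -(rw_C W); apply: intR_ge0 => x.
by rewrite mulr_ge0 ?invr_ge0 ?powR_ge0.
Qed.

Let mwc : measurable_fun setT
  (fun x => m x `^ (2 - p)^-1 * (phi x `^ ((p - 1) / (2 - p)))^-1)%R.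
Proof.
apply: measurable_funM; first by apply: measurable_powRl; exact: (rw_measM W).
under eq_fun do rewrite -powRN.
by apply: measurable_powRl; exact: (rw_meas W).
Qed.

(** Hoelder's inequality with the exponents [1/(p-1)] and [1/(2-p)], for the product
    of [(w phi)^(p-1)] and [m phi^(-(p-1))]. *)
Lemma weight_hoelder (w : E -> R) (X : R) : (1 < p)%R -> (p < 2)%R ->
  measurable_fun setT w -> (forall x, (0 <= w x)%R) ->
  \int[mu]_x (w x * phi x)%:E = X%:E ->
  \int[mu]_x (w x `^ (p - 1) * m x)%:E <= (C `^ (2 - p) * X `^ (p - 1))%:E.
Proof.
move=> p1 p2 mw w0 wX.
have p10 : (0 < p - 1)%R by lra.
have q0 : (0 < 2 - p)%R by lra.
have phi0 x : (0 < phi x)%R := rw_gt0 W x.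
pose f x := ((w x * phi x) `^ (p - 1))%R.
pose g x := (m x * phi x `^ (- (p - 1)))%R.
have mf : measurable_fun setT f.
  by apply: measurable_powRl; apply: measurable_funM => //; exact: (rw_meas W).
have mg : measurable_fun setT g.
  apply: measurable_funM; first exact: (rw_measM W).
  by apply: measurable_powRl; exact: (rw_meas W).
have := @hoelder _ _ _ mu f g (p - 1)^-1 (2 - p)^-1 mf mg.
rewrite !invr_gt0 !invrK => /(_ p10 q0)/(_ _)/wrap[]; first by ring.
rewrite Lnorm1.
have -> : \int[mu]_x `|(EFin \o (f \* g)%R) x| = \int[mu]_x (w x `^ (p - 1) * m x)%:E.
  apply: eq_integral => x _; rewrite /= ger0_norm; last first.
    by rewrite /f /g !mulr_ge0 ?powR_ge0// rw_m0.
  congr EFin; rewrite /f /g powRM//; last exact: ltW.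
  have E1 : (phi x `^ (p - 1) * phi x `^ (- (p - 1)) = 1)%R.
    by rewrite powRN divff// gt_eqF// powR_gt0.
  transitivity (w x `^ (p - 1) * m x *
    (phi x `^ (p - 1) * phi x `^ (- (p - 1))))%R; first by ring.
  by rewrite E1 mulr1.
have -> : 'N[mu]_((p - 1)^-1%:E)[EFin \o f] = (X `^ (p - 1))%:E.
  rewrite unlock /Lnorm invrK; under eq_integral => x _.
    rewrite /f /= ger0_norm ?powR_ge0// -powRrM mulfV ?gt_eqF// powRr1; last first.
      by rewrite mulr_ge0// ltW.
    over.
  by rewrite wX.
have -> : 'N[mu]_((2 - p)^-1%:E)[EFin \o g] = (C `^ (2 - p))%:E.
  rewrite unlock /Lnorm invrK -[in RHS]poweR_EFin -(rw_C W); congr (_ `^ _).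
  apply: eq_integral => x _; rewrite /g /= ger0_norm; last first.
    by rewrite mulr_ge0 ?powR_ge0// rw_m0.
  rewrite powRM ?powR_ge0 ?rw_m0// -!powRrM -powRN; congr (_ * _ `^ _)%:E.
  by rewrite mulNr.
by rewrite -EFinM mulrC.
Qed.

(** As [phi] is bounded, the integrand of [C(phi)] controls [m^(1/(2-p))], which
    controls [m] where [m >= 1]. *)
Lemma weight_int (h : E -> R) : (1 < p)%R -> (p < 2)%R -> measurable_fun setT h ->
  (forall x, (0 <= h x)%R) -> (forall x, (h x <= 1)%R) ->
  \int[mu]_x (h x)%:E < +oo -> \int[mu]_x (h x * m x)%:E < +oo.
Proof.
move=> p1 p2 mh h0 h1 hoo.
have q0 : (0 < 2 - p)%R by lra.
pose r := ((p - 1) / (2 - p))%R.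
have r0 : (0 <= r)%R by rewrite divr_ge0//; lra.
pose wc x := (m x `^ (2 - p)^-1 * (phi x `^ r)^-1)%R.
have wc0 x : (0 <= wc x)%R by rewrite mulr_ge0 ?invr_ge0 ?powR_ge0.
have phi0 x : (0 < phi x)%R := rw_gt0 W x.
have B0 : (0 <= B `^ r)%R by exact: powR_ge0.
apply: (@le_lt_trans _ _ (\int[mu]_x (h x + B `^ r * wc x)%:E)).
  apply: le_intR.
  - by apply: measurable_funM => //; exact: (rw_measM W).
  - by apply: measurable_funD => //; apply: measurable_funM.
  - by move=> x; rewrite mulr_ge0// rw_m0.
  move=> x; have mx : (m x <= 1 + m x `^ (2 - p)^-1)%R.
    have [m1|m1] := leP (m x) 1%R; first by have := powR_ge0 (m x) (2 - p)^-1; lra.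
    have q1 : (1 <= (2 - p)^-1)%R by rewrite invf_ge1//; lra.
    by have := @le1r_powR _ (m x) (2 - p)^-1 (ltW m1) q1; lra.
  apply: (@le_trans _ _ (h x * (1 + m x `^ (2 - p)^-1))%R); first by rewrite ler_wpM2l.
  rewrite mulrDr mulr1 lerD2l.
  apply: (@le_trans _ _ (m x `^ (2 - p)^-1)%R); first by rewrite ler_piMl ?powR_ge0.
  rewrite /wc mulrCA ler_peMr ?powR_ge0// ler_pdivlMr ?powR_gt0// mul1r.
  by rewrite le_powR ?(ltW (phi0 x))// (rw_le W).
rewrite intRD//; last 2 first.
- by apply: measurable_funM.
- by move=> x; rewrite mulr_ge0.
by rewrite intRZ// (rw_C W) lte_add_pinfty// -EFinM ltry.
Qed.

Lemma measurable_excess e (f : E -> R) : measurable_fun setT f ->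
  measurable_fun setT (fun x => excess e (f x)).
Proof.
by move=> mf; apply: measurable_maxr => //; apply: measurable_funB.
Qed.

Lemma excess_dist e (a b : R) : (`|excess e a - excess e b| <= `|a - b|)%R.
Proof.
wlog ab : a b / (b <= a)%R.
  move=> H; have /orP[|] := le_total b a; first exact: H.
  by rewrite distrC (distrC a); exact: H.
by rewrite !ger0_norm ?subr_ge0 ?excess_homo// excess_sub.
Qed.

Lemma Mop_excess_le e x : Mop (fun x => excess e (phi x)) x <= (m x)%:E.
Proof.
rewrite -(rw_M W); apply: le_intR.
- apply: (@measurable_ptl _ _ (fun z => `|excess e (phi z.1) - excess e (phi z.2)| * knl z.1 z.2)%R x).
  apply: measurable_funM; last exact: measurable_knl.
  apply: (@measurable_diff _ _ (fun x => excess e (phi x))).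
  by apply: (@measurable_excess e phi); exact: (rw_meas W).
- apply: (@measurable_ptl _ _ (fun z => `|phi z.1 - phi z.2| * knl z.1 z.2)%R x).
  apply: measurable_funM; last exact: measurable_knl.
  by apply: measurable_diff; exact: (rw_meas W).
- by move=> y; rewrite mulr_ge0// knl_ge0.
- by move=> y; rewrite ler_wpM2r ?knl_ge0// excess_dist.
Qed.

(** The increments of the truncated weight vanish unless one of the two points lies
    in the set of finite measure where it is positive; by symmetry this point can
    be taken as the outer variable of the double integral. *)
Lemma Mop_excess_int e : (1 < p)%R -> (p < 2)%R -> (0 < e)%R ->
  \int[mu]_x Mop (fun x => excess e (phi x)) x < +oo.
Proof.
move=> p1 p2 e0.
pose S := [set x | (e < phi x)%R].
have mS : measurable S.
  rewrite (_ : S = setT `&` (phi @^-1` `]e, +oo[)); first exact: (rw_meas W).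
  by apply/seteqP; split => y /=; rewrite in_itv/= andbT => // -[].
pose P x : R := \1_S x.
have mP : measurable_fun setT P by exact: measurable_indic.
have P0 x : (0 <= P x)%R by rewrite /P indicE.
have P1 x : (P x <= 1)%R by rewrite /P indicE; case: (_ \in _).
have Poo : \int[mu]_x (P x)%:E < +oo by rewrite integral_indic// setIT; exact: (rw_vanish W).
apply: (@le_lt_trans _ _ (\int[mu]_x \int[mu]_y
    ((P x + P y) * (`|phi x - phi y| * knl x y))%:E)); last first.
  rewrite int_int_sym//; last exact: (rw_meas W).
  under eq_integral do rewrite (rw_M W) -EFinM.
  by rewrite lte_mul_pinfty// weight_int.
apply: ge0_le_integral => //.
- by move=> x _; exact: Mop_ge0.
- by apply: measurable_Mop; apply: (@measurable_excess e phi); exact: (rw_meas W).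
- apply: (measurable_leb_int (f := fun z => ((P z.1 + P z.2) * (`|phi z.1 - phi z.2| * knl z.1 z.2))%:E)).
    apply/measurable_EFinP; apply: measurable_funM.
      by apply: measurable_funD; [exact: measurable_fst|exact: measurable_snd].
    apply: measurable_funM; [by apply: measurable_diff; exact: (rw_meas W)|exact: measurable_knl].
  by move=> z; rewrite lee_fin mulr_ge0 ?addr_ge0// mulr_ge0// knl_ge0.
move=> x _; apply: le_intR.
- apply: (@measurable_ptl _ _ (fun z => `|excess e (phi z.1) - excess e (phi z.2)| * knl z.1 z.2)%R x).
  apply: measurable_funM; last exact: measurable_knl.
  apply: (@measurable_diff _ _ (fun x => excess e (phi x))).
  by apply: (@measurable_excess e phi); exact: (rw_meas W).
- apply: measurable_funM; first exact: measurable_funD.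
  apply: (@measurable_ptl _ _ (fun z => `|phi z.1 - phi z.2| * knl z.1 z.2)%R x).
  apply: measurable_funM; [by apply: measurable_diff; exact: (rw_meas W)|exact: measurable_knl].
- by move=> y; rewrite mulr_ge0// knl_ge0.
move=> y; rewrite mulrA ler_wpM2r ?knl_ge0//.
have PE z : P z = (if (e < phi z)%R then 1 else 0)%R.
  rewrite /P indicE; case: ifPn => h; first by rewrite mem_set.
  by rewrite memNset//=; exact/negP.
have [ex|ex] := ltP e (phi x).
  apply: (le_trans (excess_dist _ _ _)); rewrite ler_peMl// PE ex; have := P0 y; lra.
have [ey|ey] := ltP e (phi y).
  apply: (le_trans (excess_dist _ _ _)); rewrite ler_peMl// (PE y) ey; have := P0 x; lra.
by rewrite !excess_eq0// subrr normr0 mulr_ge0// addr_ge0.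
Qed.

End regular.

Lemma intR_eq0 (f : E -> R) : measurable_fun setT f -> (forall x, (0 <= f x)%R) ->
  \int[mu]_x (f x)%:E = 0 ->
  exists Z, [/\ measurable Z, mu Z = 0 & forall x, ~ Z x -> f x = 0%R].
Proof.
move=> mf f0 If0; have mF : measurable_fun setT (EFin \o f) by exact/measurable_EFinP.
have [] := ae_eq_integral_abs mu measurableT mF.
move=> + _; case.
  by rewrite -[RHS]If0; apply: eq_integral => x _; rewrite /= ger0_norm.
move=> Z [mZ Z0 subZ]; exists Z; split => // x nZx.
by apply: contrapT => fx0; apply: nZx; apply: subZ => /= /(_ I)[].
Qed.

(** If the constant vanished, [phi] would be almost everywhere equal to a positive
    constant, on a space of infinite measure. *)
Lemma weight_const_gt0 phi m (B C : R) : (0 < N)%N -> (p < 2)%R ->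
  regular_weight phi m B C -> (0 < C)%R.
Proof.
move=> N0 p2 W; rewrite lt_neqAle (rw_C0 W) andbT; apply/negP => /eqP C0.
have phi0 x : (0 < phi x)%R := rw_gt0 W x.
pose wc x := (m x `^ (2 - p)^-1 * (phi x `^ ((p - 1) / (2 - p)))^-1)%R.
have mwc : measurable_fun setT wc.
  apply: measurable_funM; first by apply: measurable_powRl; exact: (rw_measM W).
  by under eq_fun do rewrite -powRN; apply: measurable_powRl; exact: (rw_meas W).
have wc0 x : (0 <= wc x)%R by rewrite mulr_ge0 ?invr_ge0 ?powR_ge0.
have [Z [mZ Z0 HZ]] := intR_eq0 mwc wc0 (etrans (rw_C W) (congr1 EFin (esym C0))).
have [x nZx] : exists x, ~ Z x.
  apply: contrapT => /forallNP H; have ZT : Z = setT.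
    by apply/seteqP; split => // x _; apply: contrapT; exact: H.
  by have := leb_setT (R := R) N0; rewrite -ZT Z0.
have mx0 : m x = 0%R.
  have /eqP := HZ x nZx; rewrite /wc mulf_eq0 invr_eq0 !powR_eq0 (gt_eqF (phi0 x))/= orbF.
  by move=> /andP[/eqP].
have mk : measurable_fun setT (fun y => `|phi x - phi y| * knl x y)%R.
  apply: (@measurable_ptl _ _ (fun z => `|phi z.1 - phi z.2| * knl z.1 z.2)%R x).
  apply: measurable_funM; last exact: measurable_knl.
  by apply: measurable_diff; exact: (rw_meas W).
have k0 y : (0 <= `|phi x - phi y| * knl x y)%R by rewrite mulr_ge0// knl_ge0.
have [Z' [mZ' Z'0 HZ']] := intR_eq0 mk k0 (etrans (rw_M W x) (congr1 EFin mx0)).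
have phiE y : ~ Z' y -> phi y = phi x.
  move=> /HZ'/eqP; rewrite mulf_eq0 invr_eq0 powR_eq0 => /orP[|/andP[/eqP xy0 _]].
    by rewrite normr_eq0 subr_eq0 => /eqP.
  congr phi; apply/rowP => i; apply/eqP; rewrite eq_sym -subr_eq0 -normr_le0 -xy0.
  by have := le_enorm (x - y) i; rewrite !mxE.
have c0 : (0 < phi x / 2)%R by rewrite divr_gt0.
have := rw_vanish W c0; set S := [set _ | _] => Soo.
have mS : measurable S.
  rewrite (_ : S = setT `&` (phi @^-1` `](phi x / 2)%R, +oo[)); first exact: (rw_meas W).
  by apply/seteqP; split => y /=; rewrite in_itv/= andbT => // -[].
have : mu setT < +oo.
  have ST : [set: E] = S `|` Z'.
    apply/seteqP; split => // y _; have [|/phiE yE] := pselect (Z' y); first by right.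
    by left; rewrite /S/= yE; have := phi0 x; lra.
  have SZ : mu (S `|` Z') <= mu S + mu Z' by exact: measureU2.
  by rewrite ST (le_lt_trans SZ)// Z'0 adde0.
by rewrite leb_setT.
Qed.

Lemma weight_classP phi : (0 < N)%N -> (1 < p)%R -> (p < 2)%R ->
  weight_class s p phi -> exists m B,
  [/\ regular_weight phi m B (fine (weight_const s p phi)),
     (0 < B)%R & (0 < fine (weight_const s p phi))%R].
Proof.
move=> N0 p1 p2 [sphi phi0 vphi lphi Coo].
have cphi : continuous phi by move=> x; exact/differentiable_continuous/(sphi [::] x).
have mphi := continuous_measurable_rV cphi.
have [B B0 phiB] := bounded_vanishing cphi vphi.
have Mfin x : Mop phi x \is a fin_num.
  rewrite ge0_fin_numE ?Mop_ge0// -(MspE _ _ _ mphi).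
  have [b Hb] := lphi x; have := nbhs_singleton Hb.
  by move=> h; apply: le_lt_trans (ltry b); exact: le_trans (lee_abs _) h.
pose m x := fine (Mop phi x).
have mE x : Mop phi x = (m x)%:E by rewrite /m fineK.
have m0 x : (0 <= m x)%R by rewrite -lee_fin -mE Mop_ge0.
have wcE : weight_const s p phi =
    \int[mu]_x (m x `^ (2 - p)^-1 * (phi x `^ ((p - 1) / (2 - p)))^-1)%:E.
  apply: eq_integral => x _.
  by rewrite (MspE _ _ _ mphi) mE gee0_abs ?lee_fin// poweR_EFin -EFinM.
have mm : measurable_fun setT m.
  by apply: measurableT_comp => //; exact: measurable_Mop.
suff W : regular_weight phi m B (fine (weight_const s p phi)).
  by exists m, B; split => //; exact: weight_const_gt0 W.
split => //.
- move=> e e0; have [r Hr] := vphi e e0.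
  apply: le_lt_trans (leb_enorm (N := N) r); apply: le_measure; rewrite ?inE.
  + rewrite (_ : [set x | _] = setT `&` (phi @^-1` `]e, +oo[)); first exact: mphi.
    by apply/seteqP; split => y /=; rewrite in_itv/= andbT => // -[].
  + rewrite (_ : [set x | _] = setT `&` (@enorm R N @^-1` `]-oo, r])).
      exact: measurable_enorm.
    by apply/seteqP; split => y /=; rewrite in_itv/= => // -[].
  + move=> x /= ex; rewrite leNgt; apply/negP => /Hr.
    by rewrite ger0_norm ?(ltW (phi0 x))// => /(lt_trans ex); rewrite ltxx.
- rewrite -wcE fineK// ge0_fin_numE// wcE.
  by apply: intR_ge0 => x; rewrite mulr_ge0 ?invr_ge0 ?powR_ge0.
Qed.

End weights.

(** * The subdifferential of the energy *)
Section dissipation.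
Context {R : realType} {N : nat}.
Variables (s p : R).
Local Notation E := 'rV[R]_N.
Local Notation mu := (@leb R N).
Local Notation knl := (@knl R N s p).
Local Notation Mop := (@Mop R N s p).
Local Open Scope ereal_scope.

Section double_integral.
Implicit Types F G : E * E -> R.

Let int2 F := \int[mu]_x \int[mu]_y (F (x, y))%:E.

Lemma measurable_int_snd F : measurable_fun setT F -> (forall z, (0 <= F z)%R) ->
  measurable_fun setT (fun x => \int[mu]_y (F (x, y))%:E).
Proof.
move=> mF F0; refine (measurable_leb_int (f := fun z => (F z)%:E) _ _).
  exact/measurable_EFinP.
by move=> z; rewrite lee_fin.
Qed.

Lemma int2D F G : measurable_fun setT F -> measurable_fun setT G ->
  (forall z, (0 <= F z)%R) -> (forall z, (0 <= G z)%R) ->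
  \int[mu]_x \int[mu]_y (F (x, y) + G (x, y))%:E = int2 F + int2 G.
Proof.
move=> mF mG F0 G0.
transitivity (\int[mu]_x (\int[mu]_y (F (x, y))%:E + \int[mu]_y (G (x, y))%:E)).
  apply: eq_integral => x _.
  by apply: (@intRD _ _ _ mu (fun y => F (x, y)) (fun y => G (x, y)));
    [exact: measurable_ptl|exact: measurable_ptl|move=> y|move=> y].
apply: ge0_integralD => //.
- by move=> x _; apply: intR_ge0.
- refine (measurable_int_snd mF F0).
- by move=> x _; apply: intR_ge0.
- refine (measurable_int_snd mG G0).
Qed.

Lemma int2Z (c : R) F : measurable_fun setT F -> (forall z, (0 <= F z)%R) ->
  (0 <= c)%R -> \int[mu]_x \int[mu]_y (c * F (x, y))%:E = c%:E * int2 F.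
Proof.
move=> mF F0 c0.
transitivity (\int[mu]_x (c%:E * \int[mu]_y (F (x, y))%:E)).
  apply: eq_integral => x _.
  by apply: (@intRZ _ _ _ mu c (fun y => F (x, y))); [exact: measurable_ptl|move=> y|].
apply: ge0_integralZl => //.
- refine (measurable_int_snd mF F0).
- by move=> x _; apply: intR_ge0.
Qed.

Lemma le_int2 F G : measurable_fun setT F -> measurable_fun setT G ->
  (forall z, (0 <= F z)%R) -> (forall z, (F z <= G z)%R) -> int2 F <= int2 G.
Proof.
move=> mF mG F0 FG.
have G0 z : (0 <= G z)%R by exact: le_trans (FG z).
apply: ge0_le_integral => //.
- by move=> x _; apply: intR_ge0.
- refine (measurable_int_snd mF F0).
- refine (measurable_int_snd mG G0).
- move=> x _; apply: (@le_intR _ _ _ mu (fun y => F (x, y)) (fun y => G (x, y))).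
  + exact: measurable_ptl.
  + exact: measurable_ptl.
  + by move=> y.
  + by move=> y.
Qed.

End double_integral.

Lemma Lfun_measurable d (T : measurableType d) (nu : {measure set T -> \bar R})
  (q : \bar R) (f : T -> R) : f \in Lfun nu q -> measurable_fun setT f.
Proof. by rewrite inE => /andP[] /[!inE]/=. Qed.

(** The subdifferential inequality tested with [v - tau h], divided by [tau]; the
    remainder vanishes with [tau], so that no limit is taken under the integral. *)
Lemma energy_dissipation (v xi h P Q psi : E -> R) (tau0 : R) :
  (1 < p)%R -> (p < 2)%R -> (0 < tau0)%R ->
  subdifferential (energy s p) v xi -> h \in Lfun mu 2%:E ->
  measurable_fun setT psi -> measurable_fun setT P -> measurable_fun setT Q ->
  (forall x, (0 <= P x)%R) -> (forall x, (0 <= Q x)%R) ->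
  (forall (tau : R) x y, (0 <= tau)%R -> (tau <= tau0)%R ->
    (`|v x - v y - tau * (h x - h y)| `^ p <= `|v x - v y| `^ p +
      p * tau * ((P x + P y) * `|psi x - psi y| +
                 tau `^ (p - 1) * ((Q x + Q y) * `|psi x - psi y|)))%R) ->
  \int[mu]_x ((Q x)%:E * Mop psi x) < +oo ->
  - (\int[mu]_x (xi x * h x)%:E) <= \int[mu]_x ((P x)%:E * Mop psi x).
Proof.
move=> p1 p2 t0 [v2 xi2 Jv sub] h2 mpsi mP mQ P0 Q0 pert IQoo.
have [->|IPoo] := eqVneq (\int[mu]_x ((P x)%:E * Mop psi x)) +oo; first exact: leey.
have IP0 : 0 <= \int[mu]_x ((P x)%:E * Mop psi x).
  by apply: integral_ge0 => x _; rewrite mule_ge0 ?lee_fin ?Mop_ge0.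
have IQ0 : 0 <= \int[mu]_x ((Q x)%:E * Mop psi x).
  by apply: integral_ge0 => x _; rewrite mule_ge0 ?lee_fin ?Mop_ge0.
have mv := Lfun_measurable v2; have mh := Lfun_measurable h2.
have p0 : (0 < p)%R by lra.
have p10 : (0 < p - 1)%R by lra.
have ih : mu.-integrable setT (EFin \o (xi \* h)%R).
  exact/Lfun1_integrable/Lfun2_mul_Lfun1.
have [D DE] : exists D : R, \int[mu]_x (xi x * h x)%:E = D%:E.
  have := integrable_fin_num measurableT ih.
  by exists (fine (\int[mu]_x (xi x * h x)%:E)); rewrite fineK.
have J0 f : 0 <= energy s p f.
  apply: mule_ge0; first by rewrite lee_fin invr_ge0; lra.
  apply: integral_ge0 => x _; apply: intR_ge0 => y.
  by rewrite mulr_ge0 ?invr_ge0 ?powR_ge0.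
have [j jE] : exists j : R, energy s p v = j%:E.
  by exists (fine (energy s p v)); rewrite fineK// ge0_fin_numE.
pose ip := fine (\int[mu]_x ((P x)%:E * Mop psi x)).
pose iq := fine (\int[mu]_x ((Q x)%:E * Mop psi x)).
have ipE : \int[mu]_x ((P x)%:E * Mop psi x) = ip%:E.
  by rewrite /ip fineK// ge0_fin_numE// ltey.
have iqE : \int[mu]_x ((Q x)%:E * Mop psi x) = iq%:E.
  by rewrite /iq fineK// ge0_fin_numE.
have iq0 : (0 <= iq)%R by rewrite -lee_fin -iqE.
have key (tau : R) : (0 < tau)%R -> (tau <= tau0)%R -> (- D <= ip + tau `^ (p - 1) * iq)%R.
  move=> tau_gt0 tau_le.
  pose w x := (- tau * h x + v x)%R.
  have w2 : w \in Lfun mu 2%:E.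
    exact: ((Lfun_submod_closed mu (lee1n 2)).2 (- tau)%R h v h2 v2).
  have := sub w w2.
  have -> : \int[mu]_x (xi x * (w x - v x))%:E = (- tau * D)%:E.
    transitivity (\int[mu]_x ((- tau)%:E * (xi x * h x)%:E)).
      by apply: eq_integral => x _; rewrite -EFinM; congr EFin; rewrite /w; ring.
    by rewrite (integralZl measurableT ih) DE.
  rewrite jE -EFinD => jw.
  have mv1 := measurable_fst mv; have mv2 := measurable_snd mv.
  have mk := @measurable_knl R N s p.
  pose F1 (z : E * E) := (`|v z.1 - v z.2| `^ p * knl z.1 z.2)%R.
  pose F2 (z : E * E) := ((P z.1 + P z.2) * (`|psi z.1 - psi z.2| * knl z.1 z.2))%R.
  pose F3 (z : E * E) := ((Q z.1 + Q z.2) * (`|psi z.1 - psi z.2| * knl z.1 z.2))%R.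
  have mF1 : measurable_fun setT F1.
    by apply: measurable_funM => //; apply: measurable_powRl; exact: measurable_diff.
  have mdk : measurable_fun setT (fun z : E * E => `|psi z.1 - psi z.2| * knl z.1 z.2)%R.
    by apply: measurable_funM => //; exact: measurable_diff.
  have mF2 : measurable_fun setT F2.
    by apply: measurable_funM => //; apply: measurable_funD;
      [exact: measurable_fst|exact: measurable_snd].
  have mF3 : measurable_fun setT F3.
    by apply: measurable_funM => //; apply: measurable_funD;
      [exact: measurable_fst|exact: measurable_snd].
  have F10 z : (0 <= F1 z)%R by rewrite mulr_ge0 ?powR_ge0 ?knl_ge0.
  have F20 z : (0 <= F2 z)%R by rewrite mulr_ge0 ?addr_ge0// mulr_ge0 ?knl_ge0.
  have F30 z : (0 <= F3 z)%R by rewrite mulr_ge0 ?addr_ge0// mulr_ge0 ?knl_ge0.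
  pose c2 := (p * tau)%R; pose c3 := (p * tau * tau `^ (p - 1))%R.
  have c20 : (0 <= c2)%R by rewrite mulr_ge0// ltW.
  have c30 : (0 <= c3)%R by rewrite mulr_ge0 ?powR_ge0.
  pose G z := (F1 z + (c2 * F2 z + c3 * F3 z))%R.
  have mw : measurable_fun setT w := Lfun_measurable w2.
  have Jw : energy s p w <= (2 * p)^-1%:E * \int[mu]_x \int[mu]_y (G (x, y))%:E.
    apply: lee_wpmul2l; first by rewrite lee_fin invr_ge0; lra.
    apply: (@le_int2 (fun z => `|w z.1 - w z.2| `^ p * knl z.1 z.2)%R G).
    - by apply: measurable_funM => //; apply: measurable_powRl; exact: measurable_diff.
    - by apply: measurable_funD => //; apply: measurable_funD; apply: measurable_funM.
    - by move=> z; rewrite mulr_ge0 ?powR_ge0 ?knl_ge0.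
    move=> [x y]; rewrite /G /F1 /F2 /F3/=.
    rewrite (_ : w x - w y = v x - v y - tau * (h x - h y))%R; last by rewrite /w; ring.
    have := ler_wpM2r (knl_ge0 s p x y) (pert tau x y (ltW tau_gt0) tau_le).
    by move=> /le_trans; apply; rewrite /c2 /c3 le_eqVlt; apply/orP; left; apply/eqP; ring.
  have GE : \int[mu]_x \int[mu]_y (G (x, y))%:E =
      \int[mu]_x \int[mu]_y (F1 (x, y))%:E + (c2 * (2 * ip) + c3 * (2 * iq))%:E.
    have m2 : measurable_fun setT (fun z => c2 * F2 z)%R by apply: measurable_funM.
    have m3 : measurable_fun setT (fun z => c3 * F3 z)%R by apply: measurable_funM.
    refine (etrans (@int2D F1 (fun z => c2 * F2 z + c3 * F3 z)%R mF1 _ F10 _) _).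
    - exact: measurable_funD.
    - by move=> z; rewrite addr_ge0// mulr_ge0.
    refine (f_equal2 _ erefl _).
    refine (etrans (@int2D (fun z => c2 * F2 z)%R (fun z => c3 * F3 z)%R m2 m3 _ _) _).
    - by move=> z; rewrite mulr_ge0.
    - by move=> z; rewrite mulr_ge0.
    rewrite EFinD; refine (f_equal2 _ _ _).
      transitivity (c2%:E * (2%:E * ip%:E)); last by rewrite -!EFinM.
      refine (etrans (int2Z mF2 F20 c20) _); refine (f_equal2 _ erefl _).
      by refine (etrans (int_int_sym s p mP mpsi P0) _); rewrite ipE.
    transitivity (c3%:E * (2%:E * iq%:E)); last by rewrite -!EFinM.
    refine (etrans (int2Z mF3 F30 c30) _); refine (f_equal2 _ erefl _).
    by refine (etrans (int_int_sym s p mQ mpsi Q0) _); rewrite iqE.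
  have [I1 I1E] : exists I1 : R, \int[mu]_x \int[mu]_y (F1 (x, y))%:E = (2 * p * I1)%:E.
    have p20 : (0 < 2 * p)%R by lra.
    exists j; rewrite EFinM -jE /energy muleA -EFinM divff ?gt_eqF// mul1e.
    by [].
  have jI1 : j = I1.
    apply: EFin_inj; rewrite -jE /energy.
    refine (etrans (f_equal2 _ erefl I1E) _).
    by rewrite -EFinM mulrA mulVf ?mul1r// gt_eqF//; lra.
  rewrite GE I1E -EFinD -EFinM in Jw.
  have := le_trans jw Jw; rewrite lee_fin -jI1.
  have -> : ((2 * p)^-1 * (2 * p * j + (c2 * (2 * ip) + c3 * (2 * iq))) =
     j + tau * (ip + tau `^ (p - 1) * iq))%R.
    by rewrite /c2 /c3; field; rewrite gt_eqF.
  by rewrite lerD2l mulNr -mulrN ler_pM2l.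
rewrite DE ipE -EFinN lee_fin; apply/ler_addgt0Pr => e e0.
pose b := (e / (iq + 1))%R.
have b0 : (0 < b)%R by rewrite divr_gt0//; lra.
pose tau := Num.min tau0 (b `^ (p - 1)^-1)%R.
have tau_gt0 : (0 < tau)%R by rewrite lt_min t0 powR_gt0.
have taub : (tau `^ (p - 1) <= b)%R.
  apply: (@le_trans _ _ ((b `^ (p - 1)^-1) `^ (p - 1))%R).
    by rewrite le_powR ?(ltW p10) ?(ltW tau_gt0)// ge_min lexx orbT.
  by rewrite -powRrM mulVf ?gt_eqF// powRr1// ltW.
have tau0' : (tau <= tau0)%R by rewrite ge_min lexx.
apply: (le_trans (key _ tau_gt0 tau0')); rewrite lerD2l.
apply: (le_trans (ler_wpM2r iq0 taub)).
by rewrite /b mulrAC ler_pdivrMr; [rewrite ler_pM2l//; lra|lra].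
Qed.

End dissipation.

Section Lfun_facts.
Context d (T : measurableType d) (R : realType) (mu : {measure set T -> \bar R}).
Implicit Types (f g : T -> R) (q : R).
Local Open Scope ereal_scope.

Lemma LfunE q f : (0 < q)%R -> (f \in Lfun mu q%:E) <->
  measurable_fun setT f /\ \int[mu]_x (`|f x| `^ q)%:E < +oo.
Proof.
move=> q0.
have NE : 'N[mu]_q%:E[EFin \o f] = (\int[mu]_x (`|f x| `^ q)%:E) `^ q^-1.
  by rewrite unlock.
split.
  rewrite inE => /andP[] /[!inE]/= mf; rewrite /finite_norm NE => foo; split => //.
  by apply: lty_poweRy foo; rewrite invr_neq0// gt_eqF.
move=> [mf foo]; rewrite inE; apply/andP; split; rewrite inE//=.
by rewrite /finite_norm NE poweR_lty.
Qed.

Lemma Lfun_dom q f g (c : R) : (0 < q)%R -> (0 <= c)%R -> measurable_fun setT f ->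
  (forall x, (`|f x| <= c * `|g x|)%R) -> g \in Lfun mu q%:E -> f \in Lfun mu q%:E.
Proof.
move=> q0 c0 mf fg gL; have [mg goo] := (LfunE g q0).1 gL.
apply: (iffRL (LfunE f q0)); split; first exact: mf.
apply: (@le_lt_trans _ _ (\int[mu]_x (c `^ q * `|g x| `^ q)%:E)).
  apply: le_intR.
  - by apply: measurable_powRl; exact: measurable_absR.
  - by apply: measurable_funM => //; apply: measurable_powRl; exact: measurable_absR.
  - by move=> x; exact: powR_ge0.
  - by move=> x; rewrite -powRM// le_powR// ltW.
rewrite (@intRZ _ _ _ mu (c `^ q) (fun x => `|g x| `^ q)%R).
- by rewrite lte_mul_pinfty// lee_fin powR_ge0.
- by apply: measurable_powRl; exact: measurable_absR.
- by move=> x; exact: powR_ge0.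
- exact: powR_ge0.
Qed.

Lemma Lfun_bounded q f (B : R) (S : set T) : (0 < q)%R -> (0 <= B)%R ->
  measurable_fun setT f -> measurable S -> mu S < +oo ->
  (forall x, (`|f x| <= B)%R) -> (forall x, ~ S x -> f x = 0%R) ->
  f \in Lfun mu q%:E.
Proof.
move=> q0 B0 mf mS Soo fB fS; apply: (iffRL (LfunE f q0)); split; first exact: mf.
apply: (@le_lt_trans _ _ (\int[mu]_x (B `^ q * \1_S x)%:E)).
  apply: le_intR.
  - by apply: measurable_powRl; exact: measurable_absR.
  - by apply: measurable_funM => //; exact: measurable_indic.
  - by move=> x; exact: powR_ge0.
  move=> x; rewrite indicE; have [xS|xS] := pselect (S x).
    by rewrite mem_set// mulr1 le_powR// ltW.
  by rewrite memNset// mulr0 fS// normr0 powR0// gt_eqF.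
rewrite (@intRZ _ _ _ mu (B `^ q) (\1_S : T -> R)).
- by rewrite integral_indic// setIT lte_mul_pinfty// lee_fin powR_ge0.
- exact: measurable_indic.
- by move=> x; rewrite indicE.
- exact: powR_ge0.
Qed.

Lemma Lfun2_sqr f : f \in Lfun mu 2%:E -> \int[mu]_x (f x ^+ 2)%:E < +oo.
Proof.
move=> f2; have [_] := (LfunE f (ltr0n R 2)).1 f2; under eq_integral => x _.
  rewrite powR_mulrn// -normrX ger0_norm ?sqr_ge0//; over.
by [].
Qed.

End Lfun_facts.

Section instances.
Context {R : realType} {N : nat}.
Variables (s p : R).
Local Notation E := 'rV[R]_N.
Local Notation mu := (@leb R N).
Local Notation Mop := (@Mop R N s p).
Local Open Scope ereal_scope.
Variables (phi m : E -> R) (B C : R).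
Hypothesis W : regular_weight s p phi m B C.

Let measurable_excessV e (f : E -> R) : (0 < e)%R -> measurable_fun setT f ->
  measurable_fun setT (fun x => (excess e (f x) + e)^-1)%R.
Proof.
move=> e0 mf.
rewrite (_ : (fun x => _) = fun x => ((excess e (f x) + e) `^ (- 1))%R); last first.
  by apply/funext => x; rewrite powR_inv1// addr_ge0 ?excess_ge0// ltW.
apply: measurable_powRl; apply: measurable_funD => //.
exact: (@measurable_excess _ _ e f).
Qed.

Lemma measurable_soft_sgn e (f : E -> R) : (0 < e)%R -> measurable_fun setT f ->
  measurable_fun setT (fun x => soft_sgn e (f x)).
Proof.
move=> e0 mf.
have H (g : E -> R) : measurable_fun setT g ->
    measurable_fun setT (fun x => softpos' e (excess e (g x))).
  move=> mg; apply: measurable_funB => //.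
  by apply: measurable_funX; apply: measurable_funM => //; exact: measurable_excessV.
by apply: measurable_funB; apply: H => //; apply: measurableT_comp.
Qed.

Lemma measurable_soft_abs e (f : E -> R) : (0 < e)%R -> measurable_fun setT f ->
  measurable_fun setT (fun x => soft_abs e (f x)).
Proof.
move=> e0 mf.
have H (g : E -> R) : measurable_fun setT g ->
    measurable_fun setT (fun x => softpos e (excess e (g x))).
  move=> mg; apply: measurable_funM; last exact: measurable_excessV.
  by apply: measurable_funX; exact: (@measurable_excess _ _ e g).
by apply: measurable_funD; apply: H => //; apply: measurableT_comp.
Qed.

Lemma soft_sgn_le_abs e (r : R) : (0 < e)%R -> (`|soft_sgn e r| <= e^-1 * `|r|)%R.
Proof.
move=> e0; have [re|re] := leP `|r|%R e.
  by rewrite soft_sgn_eq0// normr0 mulr_ge0// invr_ge0 ltW.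
by rewrite (le_trans (soft_sgn_norm e0 r))// mulrC ler_pdivlMr// mul1r ltW.
Qed.

Lemma trunc_Lfun2 e (v : E -> R) : (0 < e)%R -> v \in Lfun mu 2%:E ->
  (fun x => soft_sgn e (v x) * phi x)%R \in Lfun mu 2%:E.
Proof.
move=> e0 v2; have mv := Lfun_measurable v2.
have B0 : (0 <= B)%R := le_trans (ltW (rw_gt0 W 0)) (rw_le W 0).
apply: (@Lfun_dom _ _ _ _ _ _ v (e^-1 * B)%R) => //.
- by rewrite mulr_ge0// invr_ge0 ltW.
- by apply: measurable_funM; [exact: measurable_soft_sgn|exact: (rw_meas W)].
move=> x; rewrite normrM mulrAC ler_pM ?soft_sgn_le_abs//.
by rewrite (ger0_norm (ltW (rw_gt0 W x))) (rw_le W).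
Qed.

(** In the remainder, [g(v)] vanishes where [v] is small, and is therefore dominated by
    the integrable function [v^2 / e^2]. *)
Lemma dissipation_trunc e (v xi : E -> R) : (1 < p)%R -> (p < 2)%R -> (0 < e)%R ->
  subdifferential (energy s p) v xi ->
  - (\int[mu]_x (xi x * (soft_sgn e (v x) * phi x))%:E) <=
  \int[mu]_x (soft_abs e (v x) `^ (p - 1) * m x)%:E.
Proof.
move=> p1 p2 e0 sub; have [v2 _ _ _] := sub; have mv := Lfun_measurable v2.
have B0 : (0 <= B)%R := le_trans (ltW (rw_gt0 W 0)) (rw_le W 0).
pose P x := (soft_abs e (v x) `^ (p - 1))%R.
pose Q x := (B `^ (p - 1) * `|soft_sgn e (v x)|)%R.
have mg := measurable_soft_sgn e0 mv.
have mP : measurable_fun setT P by apply: measurable_powRl; exact: measurable_soft_abs.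
have mQ : measurable_fun setT Q by apply: measurable_funM => //; exact: measurable_absR.
have Q0 x : (0 <= Q x)%R by rewrite mulr_ge0 ?powR_ge0.
have k0 : (0 < 4 / e * B + 1)%R by rewrite ltr_wpDl// mulr_ge0// divr_ge0// ltW.
have -> : \int[mu]_x (soft_abs e (v x) `^ (p - 1) * m x)%:E = \int[mu]_x ((P x)%:E * Mop phi x).
  by apply: eq_integral => x _; rewrite (rw_M W) EFinM.
apply: (@energy_dissipation _ _ s p v xi (fun x => soft_sgn e (v x) * phi x)%R P Q phi
  ((4 / e * B + 1)^-1)%R) => //.
- by rewrite invr_gt0.
- exact: trunc_Lfun2.
- exact: (rw_meas W).
- by move=> x; exact: powR_ge0.
- move=> tau x y t0 tB; apply: trunc_perturb => //.
  + exact: ltW (rw_gt0 W _).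
  + exact: (rw_le W).
  + exact: ltW (rw_gt0 W _).
  + exact: (rw_le W).
  + have k1 : (0 <= 4 / e * B)%R by rewrite mulr_ge0// divr_ge0// ltW.
    apply: (le_trans (ler_wpM2r k1 tB)).
    by rewrite mulrC ler_pdivrMr// mul1r lerDl.
have -> : \int[mu]_x ((Q x)%:E * Mop phi x) =
    \int[mu]_x ((B `^ (p - 1))%:E * (`|soft_sgn e (v x)| * m x)%:E).
  by apply: eq_integral => x _; rewrite (rw_M W) -!EFinM mulrA.
rewrite ge0_integralZl//; last 3 first.
- apply/measurable_EFinP; apply: measurable_funM; last exact: (rw_measM W).
  exact: measurable_absR.
- by move=> x _; rewrite lee_fin mulr_ge0// (rw_m0 W).
- by rewrite lee_fin powR_ge0.
rewrite lte_mul_pinfty// ?lee_fin ?powR_ge0//.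
apply: (weight_int W p1 p2 (h := fun x => `|soft_sgn e (v x)|%R)) => //.
- exact: measurable_absR.
- by move=> x; exact: soft_sgn_norm.
apply: (@le_lt_trans _ _ (\int[mu]_x ((e^-1) ^+ 2 * v x ^+ 2)%:E)).
  apply: le_intR => //.
  - exact: measurable_absR.
  - by apply: measurable_funM => //; exact: measurable_funX.
  move=> x; have g1 := soft_sgn_norm e0 (v x); have g2 := soft_sgn_le_abs (v x) e0.
  have [ve|ev] := leP `|v x|%R e.
    by rewrite soft_sgn_eq0// normr0 mulr_ge0 ?sqr_ge0.
  apply: (le_trans g1); rewrite -exprMn -[((_ * _) ^+ 2)%R]real_normK ?num_real//.
  by rewrite expr_ge1// normrM ger0_norm ?invr_ge0 ?(ltW e0)// mulrC ler_pdivlMr// mul1r ltW.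
rewrite (@intRZ _ _ _ mu ((e^-1) ^+ 2)%R (fun x => v x ^+ 2)%R).
- by rewrite lte_mul_pinfty// ?lee_fin ?sqr_ge0// Lfun2_sqr.
- exact: measurable_funX.
- by move=> x; exact: sqr_ge0.
- exact: sqr_ge0.
Qed.

Lemma excess_phi_Lfun (q e : R) : (0 < q)%R -> (0 < e)%R ->
  (fun x => excess e (phi x)) \in Lfun mu q%:E.
Proof.
move=> q0 e0; have B0 : (0 <= B)%R := le_trans (ltW (rw_gt0 W 0)) (rw_le W 0).
apply: (@Lfun_bounded _ _ _ _ _ _ B [set x | (e < phi x)%R]) => //.
- by apply: (@measurable_excess _ _ e phi); exact: (rw_meas W).
- rewrite (_ : [set x | _] = setT `&` (phi @^-1` `]e, +oo[)); first exact: (rw_meas W).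
  by apply/seteqP; split => y /=; rewrite in_itv/= andbT => // -[].
- exact: (rw_vanish W).
- move=> x; rewrite ger0_norm ?excess_ge0// ge_max B0 andbT.
  by rewrite (le_trans _ (rw_le W x))// gerBl ltW.
- by move=> x /negP; rewrite -leNgt => ?; rewrite excess_eq0.
Qed.

Lemma dissipation_lin e (v xi : E -> R) : (1 < p)%R -> (p < 2)%R -> (0 < e)%R ->
  subdifferential (energy s p) v xi ->
  \int[mu]_x (xi x * excess e (phi x))%:E <=
  \int[mu]_x ((`|v x| `^ (p - 1))%:E * Mop (fun x => excess e (phi x)) x).
Proof.
move=> p1 p2 e0 sub; have [v2 xi2 _ _] := sub; have mv := Lfun_measurable v2.
have B0 : (0 <= B)%R := le_trans (ltW (rw_gt0 W 0)) (rw_le W 0).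
pose psi x := excess e (phi x).
have psi2 : psi \in Lfun mu 2%:E by exact: excess_phi_Lfun.
have mpsi := Lfun_measurable psi2.
have psi0 x : (0 <= psi x)%R by exact: excess_ge0.
have psiB x : (psi x <= B)%R.
  by rewrite ge_max B0 andbT (le_trans _ (rw_le W x))// gerBl ltW.
have ih : mu.-integrable setT (EFin \o (xi \* psi)%R).
  exact/Lfun1_integrable/Lfun2_mul_Lfun1.
have -> : \int[mu]_x (xi x * psi x)%:E = - (\int[mu]_x (xi x * - psi x)%:E).
  transitivity (- ((- 1)%:E * \int[mu]_x (xi x * psi x)%:E)).
    by rewrite EFinN mulN1e oppeK.
  rewrite -(integralZl measurableT ih); congr (- _).
  by apply: eq_integral => x _; rewrite -EFinM; congr EFin => /=; ring.
apply: (@energy_dissipation _ _ s p v xi (fun x => - psi x)%R (fun x => `|v x| `^ (p - 1))%R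
   (fun=> B `^ (p - 1))%R psi 1%R) => //.
- by have := (Lfun_submod_closed mu (lee1n 2)).2 (- 1)%R psi _ psi2 (Lfun_submod_closed mu (lee1n 2)).1; rewrite addr0 scaleN1r.
- by apply: measurable_powRl; exact: measurable_absR.
- by move=> x; exact: powR_ge0.
- move=> tau x y t0 _; rewrite (_ : - psi x - - psi y = - (psi x - psi y))%R; last by ring.
  apply: (le_trans (powR_perturb _ p1 p2 (lexx _) t0)).
  rewrite lerD2l ler_wpM2l//; first by rewrite mulr_ge0//; lra.
  rewrite normrN; set D := `|psi x - psi y|%R.
  have DB : (D <= B)%R by rewrite ler_norml; have := psi0 x; have := psi0 y; have := psiB x; have := psiB y; lra.
  have D0 : (0 <= D)%R by exact: normr_ge0.
  apply: lerD.
    rewrite mulrC ler_wpM2r//; apply: le_trans (powRD_subadd _ _ _ _) => //; try lra.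
    by rewrite le_powR//; [lra|exact: ler_normB].
  rewrite ler_wpM2l ?powR_ge0//.
  rewrite -(mulr_powRB1 D0); last lra.
  rewrite mulrC ler_wpM2r//; apply: (@le_trans _ _ (B `^ (p - 1))%R).
    by rewrite le_powR//; lra.
  by rewrite lerDl powR_ge0.
rewrite (_ : \int[mu]_x _ = (B `^ (p - 1))%:E * \int[mu]_x Mop psi x).
  by rewrite lte_mul_pinfty ?lee_fin ?powR_ge0//; exact: (Mop_excess_int W).
rewrite -ge0_integralZl//.
- exact: measurable_Mop.
- by move=> x _; exact: Mop_ge0.
- by rewrite lee_fin powR_ge0.
Qed.

End instances.

(** * The scalar product of [L^2] *)
Section L2.
Context d (T : measurableType d) (R : realType) (mu : {measure set T -> \bar R}).
Implicit Types (f g h : T -> R).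
Local Notation L2 := (Lfun mu 2%:E).

Definition L2norm f : R := Num.sqrt (fine (\int[mu]_x (f x ^+ 2)%:E)%E).

Lemma L2norm_ge0 f : 0 <= L2norm f. Proof. exact: sqrtr_ge0. Qed.

Lemma Lfun2_int f : f \in L2 -> mu.-integrable setT (fun x => (f x ^+ 2)%:E).
Proof. exact: Lfun2_integrable_sqr. Qed.

Lemma Lnorm2E f : f \in L2 -> ('N[mu]_2%:E[EFin \o f] = (L2norm f)%:E)%E.
Proof.
move=> f2.
have I : (\int[mu]_x (`|f x| `^ 2)%:E = \int[mu]_x (f x ^+ 2)%:E)%E.
  by apply: eq_integral => x _; rewrite powR_mulrn// -normrX ger0_norm ?sqr_ge0.
have F : (\int[mu]_x (f x ^+ 2)%:E)%E \is a fin_num.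
  exact: (integrable_fin_num measurableT (Lfun2_int f2)).
transitivity ((\int[mu]_x (`|f x| `^ 2)%:E) `^ 2^-1)%E; first by rewrite unlock.
rewrite I -(fineK F) poweR_EFin powR12_sqrt//.
by apply: fine_ge0; apply: integral_ge0 => x _; rewrite lee_fin sqr_ge0.
Qed.

Lemma L2norm_sqr f : f \in L2 -> fine (\int[mu]_x (f x ^+ 2)%:E)%E = L2norm f ^+ 2.
Proof.
move=> f2; rewrite sqr_sqrtr//.
by apply: fine_ge0; apply: integral_ge0 => x _; rewrite lee_fin sqr_ge0.
Qed.

Lemma L2_comb (a : R) f g : f \in L2 -> g \in L2 -> (fun x => a * f x + g x) \in L2.
Proof. by move=> f2 g2; exact: ((Lfun_submod_closed mu (lee1n 2)).2 a f g f2 g2). Qed.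

Lemma L2_scale (a : R) f : f \in L2 -> (fun x => a * f x) \in L2.
Proof.
move=> f2; rewrite (_ : (fun x => _) = fun x => a * f x + (0 : T -> R) x); last first.
  by apply/funext => x; rewrite addr0.
exact: (L2_comb a f2 (Lfun_submod_closed mu (lee1n 2)).1).
Qed.

Lemma L2_sub f g : f \in L2 -> g \in L2 -> (fun x => f x - g x) \in L2.
Proof.
move=> f2 g2; rewrite (_ : (fun x => _) = fun x => - 1 * g x + f x).
  exact: L2_comb.
by apply/funext => x; rewrite mulN1r addrC.
Qed.

Lemma L2_add f g : f \in L2 -> g \in L2 -> (fun x => f x + g x) \in L2.
Proof.
move=> f2 g2; rewrite (_ : (fun x => _) = fun x => 1 * f x + g x).
  exact: L2_comb.
by apply/funext => x; rewrite mul1r.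
Qed.

Lemma L2normD f g : f \in L2 -> g \in L2 -> L2norm (fun x => f x + g x) <= L2norm f + L2norm g.
Proof.
move=> f2 g2; rewrite -lee_fin EFinD -!Lnorm2E//; last exact: L2_add.
apply: (minkowski_EFin mu (Lfun_measurable f2) (Lfun_measurable g2)).
by rewrite ler1n.
Qed.

Lemma L2normZ (a : R) f : f \in L2 -> L2norm (fun x => a * f x) = `|a| * L2norm f.
Proof.
move=> f2; rewrite /L2norm.
have -> : (\int[mu]_x ((a * f x) ^+ 2)%:E = (a ^+ 2)%:E * \int[mu]_x (f x ^+ 2)%:E)%E.
  rewrite -(integralZl measurableT (Lfun2_int f2)).
  by apply: eq_integral => x _; rewrite exprMn EFinM.
rewrite fineM//; last exact: (integrable_fin_num measurableT (Lfun2_int f2)).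
by rewrite sqrtrM ?sqr_ge0// sqrtr_sqr.
Qed.

Lemma L2_int f g : f \in L2 -> g \in L2 ->
  mu.-integrable setT (fun x => (f x * g x)%:E).
Proof. by move=> f2 g2; exact/Lfun1_integrable/Lfun2_mul_Lfun1. Qed.

Definition L2dot f g : R := fine (\int[mu]_x (f x * g x)%:E)%E.

Lemma L2dotE f g : f \in L2 -> g \in L2 ->
  (\int[mu]_x (f x * g x)%:E)%E = (L2dot f g)%:E.
Proof.
move=> f2 g2; rewrite /L2dot fineK//.
exact: (integrable_fin_num measurableT (L2_int f2 g2)).
Qed.

Lemma cauchy_schwarz f g : f \in L2 -> g \in L2 -> `|L2dot f g| <= L2norm f * L2norm g.
Proof.
move=> f2 g2.
have two : 2^-1 + 2^-1 = 1 :> R by rewrite [RHS]splitr mul1r.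
have := hoelder mu (Lfun_measurable f2) (Lfun_measurable g2) (ltr0n R 2) (ltr0n R 2) two.
rewrite Lnorm1 !Lnorm2E// -EFinM.
move=> /(le_trans (le_abse_integral mu measurableT (measurable_int _ (L2_int f2 g2)))).
by rewrite L2dotE// lee_fin.
Qed.

Lemma L2dotC f g : L2dot f g = L2dot g f.
Proof. by congr fine; apply: eq_integral => x _; rewrite mulrC. Qed.

Lemma L2dotZ (a : R) f h : f \in L2 -> h \in L2 ->
  L2dot (fun x => a * f x) h = a * L2dot f h.
Proof.
move=> f2 h2; apply: EFin_inj; rewrite -L2dotE//; last exact: L2_scale.
rewrite EFinM -!L2dotE// -(integralZl measurableT (L2_int f2 h2)).
by apply: eq_integral => x _; rewrite -EFinM; congr EFin; ring.
Qed.

Lemma L2dot_comb (a : R) f g h : f \in L2 -> g \in L2 -> h \in L2 ->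
  L2dot (fun x => a * f x + g x) h = a * L2dot f h + L2dot g h.
Proof.
move=> f2 g2 h2; apply: EFin_inj; rewrite -L2dotE//; last exact: L2_comb.
rewrite EFinD EFinM -!L2dotE// -(integralZl measurableT (L2_int f2 h2)).
rewrite -(integralD measurableT)//.
- by apply: eq_integral => x _; rewrite -EFinM -EFinD; congr EFin; ring.
- apply: (eq_integrable measurableT (fun x => (a * f x * h x)%:E)).
    by move=> x _; rewrite -EFinM mulrA.
  by apply: L2_int => //; exact: L2_scale.
- exact: L2_int.
Qed.

End L2.

(** * The chain rule for integral functionals *)
Section chain_rule.
Context d (T : measurableType d) (R : realType) (mu : {measure set T -> \bar R}).
Local Notation L2 := (Lfun mu 2%:E).
Local Notation L2norm := (L2norm mu).
Local Notation L2dot := (L2dot mu).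
Implicit Types (f g : T -> R).

(** A density [Gam] with derivative [gam] whose Taylor remainder is quadratic: the
    functional it defines is then differentiable on [L^2], with gradient
    [gam x (f x)], and Lipschitz on bounded sets. *)
Record C11_density (Gam gam : T -> R -> R) (L k c : R) : Prop := C11Density {
  cd_L0 : 0 <= L ; cd_c0 : 0 <= c ;
  cd_int : forall f, f \in L2 -> mu.-integrable setT (fun x => (Gam x (f x))%:E) ;
  cd_L2 : forall f, f \in L2 -> (fun x => gam x (f x)) \in L2 ;
  cd_norm : forall f, f \in L2 -> L2norm (fun x => gam x (f x)) <= k + c * L2norm f ;
  cd_taylor : forall x a b,
    `|Gam x b - Gam x a - gam x a * (b - a)| <= L * (b - a) ^+ 2 }.

Definition functional (Gam : T -> R -> R) f : R :=
  fine (\int[mu]_x (Gam x (f x))%:E)%E.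

Section density.
Variables (Gam gam : T -> R -> R) (L k c : R).
Hypothesis D : C11_density Gam gam L k c.
Local Notation Phi := (functional Gam).
Local Notation dPhi f := (fun x => gam x (f x)).

Lemma functionalE f : f \in L2 -> (\int[mu]_x (Gam x (f x))%:E)%E = (Phi f)%:E.
Proof.
move=> f2; rewrite fineK//.
exact: (integrable_fin_num measurableT (cd_int D f2)).
Qed.

Lemma functional_taylor f g : f \in L2 -> g \in L2 ->
  `|Phi g - Phi f - L2dot (dPhi f) (fun x => g x - f x)| <=
    L * L2norm (fun x => g x - f x) ^+ 2.
Proof.
move=> f2 g2; have gf2 := L2_sub g2 f2.
have I1 := cd_int D g2; have I2 := cd_int D f2.
have I3 := L2_int (cd_L2 D f2) gf2.
have I4 := Lfun2_int gf2.
pose r x := Gam x (g x) - Gam x (f x) - gam x (f x) * (g x - f x).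
have I12 : mu.-integrable setT (fun x => (Gam x (g x) - Gam x (f x))%:E).
  apply: (eq_integrable measurableT (fun x => (Gam x (g x))%:E - (Gam x (f x))%:E)%E).
    by move=> x _; rewrite EFinB.
  exact: integrableB.
have Ir : mu.-integrable setT (fun x => (r x)%:E).
  apply: (eq_integrable measurableT (fun x => (Gam x (g x) - Gam x (f x))%:E
       - (gam x (f x) * (g x - f x))%:E)%E).
    by move=> x _; rewrite -EFinB.
  exact: integrableB.
have E : (\int[mu]_x (r x)%:E =
    (Phi g - Phi f - L2dot (dPhi f) (fun x => g x - f x))%:E)%E.
  rewrite !EFinB -!functionalE// -L2dotE//; last exact: (cd_L2 D).
  rewrite -(integralB measurableT I1 I2) -(integralB measurableT _ I3)//.
have IL : mu.-integrable setT (fun x => (L * (g x - f x) ^+ 2)%:E).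
  apply: (eq_integrable measurableT (fun x => L%:E * ((g x - f x) ^+ 2)%:E)%E).
    by move=> x _; rewrite EFinM.
  exact: integrableZl.
rewrite -lee_fin EFinM -L2norm_sqr// fineK; last first.
  exact: (integrable_fin_num measurableT I4).
rewrite -(integralZl measurableT I4) -abse_EFin -E.
apply: (le_trans (le_abse_integral mu measurableT (measurable_int _ Ir))).
apply: ge0_le_integral => //.
- by apply: measurableT_comp => //; exact: measurable_int Ir.
- exact: measurable_int IL.
- by move=> x _; rewrite -EFinM lee_fin; exact: (cd_taylor D).
Qed.

Lemma functional_lip f g : f \in L2 -> g \in L2 ->
  `|Phi g - Phi f| <= (k + c * L2norm f + L * L2norm (fun x => g x - f x)) *
                      L2norm (fun x => g x - f x).
Proof.
move=> f2 g2; have gf2 := L2_sub g2 f2.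
have h1 := functional_taylor f2 g2.
have h2 := cauchy_schwarz (cd_L2 D f2) gf2.
have h3 := ler_wpM2r (L2norm_ge0 mu (fun x => g x - f x)) (cd_norm D f2).
have h4 := ler_normD (Phi g - Phi f - L2dot (dPhi f) (fun x => g x - f x))
                     (L2dot (dPhi f) (fun x => g x - f x)).
rewrite subrK in h4; apply: (le_trans h4).
by rewrite expr2 in h1; lra.
Qed.

(** The quadratic remainder of the density makes [Phi] differentiable along any
    curve that is differentiable in [L^2]. *)
Lemma functional_derive (v : R -> T -> R) t xi : 0 < t ->
  (forall t', 0 <= t' -> v t' \in L2) -> xi \in L2 ->
  (forall e, 0 < e -> exists2 d, 0 < d & forall h, `|h| < d -> h != 0 ->
     L2norm (fun x => h^-1 * (v (t + h) x - v t x) + xi x) <= e) ->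
  is_derive t (1 : R) (fun t' => Phi (v t')) (- L2dot xi (dPhi (v t))).
Proof.
move=> t0 v2 xi2 dv; apply/is_deriveP => e e0.
have vt2 := v2 t (ltW t0); have g2 := cd_L2 D vt2.
pose ng := L2norm (dPhi (v t)); pose nx := L2norm xi.
have ng0 : 0 <= ng by exact: L2norm_ge0.
have nx0 : 0 <= nx by exact: L2norm_ge0.
have L0 := cd_L0 D.
pose eta := Num.min 1 (e / (2 * (ng + 1))).
have eta0 : 0 < eta by rewrite lt_min ltr01 divr_gt0// mulr_gt0//; lra.
have eta1 : eta <= 1 by rewrite ge_min lexx.
have eta2 : ng * eta <= e / 2.
  have : eta <= e / (2 * (ng + 1)) by rewrite ge_min lexx orbT.
  move=> /(ler_wpM2l ng0) /le_trans; apply.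
  by rewrite mulrA ler_pdivrMr; lra.
have [d1 d10 H] := dv eta eta0.
pose K := L * (nx + 1) ^+ 2.
have K0 : 0 <= K by rewrite mulr_ge0 ?sqr_ge0.
pose d2 := Num.min t (Num.min d1 (e / (2 * (K + 1)))).
have d20 : 0 < d2 by rewrite !lt_min t0 d10 divr_gt0// mulr_gt0//; lra.
exists d2 => // h; rewrite !lt_min => /and3P[ht hd1 hK].
have [->|h0] := eqVneq h 0.
  by rewrite addr0 subrr mul0r subrr !normr0 mulr0.
have th0 : 0 <= t + h by move: ht; rewrite ltr_norml; lra.
have vh2 := v2 _ th0.
have vv2 := L2_sub vh2 vt2.
pose q x := h^-1 * (v (t + h) x - v t x) + xi x.
have q2 : q \in L2 by exact: L2_comb.
have nq : L2norm q <= eta by exact: H.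
have nq0 : 0 <= L2norm q by exact: L2norm_ge0.
have xq2 : (fun x => - 1 * xi x + q x) \in L2 by exact: L2_comb.
have vE : (fun x => v (t + h) x - v t x) = (fun x => h * (- 1 * xi x + q x)).
  by apply/funext => x; rewrite /q; field.
have nv : L2norm (fun x => v (t + h) x - v t x) <= `|h| * (nx + eta).
  rewrite vE L2normZ// ler_wpM2l//.
  apply: (le_trans (L2normD (L2_scale (- 1) xi2) q2)).
  by rewrite L2normZ// normrN normr1 mul1r lerD2l.
have ipv : L2dot (dPhi (v t)) (fun x => v (t + h) x - v t x) =
    h * (- L2dot xi (dPhi (v t)) + L2dot q (dPhi (v t))).
  by rewrite L2dotC vE L2dotZ// L2dot_comb// mulN1r.
have TY := functional_taylor vt2 vh2.
have CS := cauchy_schwarz q2 g2.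
rewrite ipv in TY.
set A := Phi (v (t + h)) - Phi (v t) in TY *.
have h1 : 0 < `|h| by rewrite normr_gt0.
have b1 : L * L2norm (fun x => v (t + h) x - v t x) ^+ 2 <= `|h| * (e / 2).
  have K1 : 0 < 2 * (K + 1) by lra.
  have hK' : `|h| * K <= e / 2.
    have : `|h| * (2 * (K + 1)) < e by rewrite -ltr_pdivlMr.
    by have := ltW h1; nra.
  apply: (@le_trans _ _ (`|h| * (`|h| * K))); last by rewrite ler_wpM2l.
  rewrite [leRHS](_ : _ = L * (`|h| * (nx + 1)) ^+ 2); last by rewrite /K; ring.
  rewrite ler_wpM2l//.
  rewrite ler_sqr ?nnegrE ?L2norm_ge0//; last by rewrite mulr_ge0//; lra.
  by apply: (le_trans nv); rewrite ler_wpM2l// lerD2l.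
have b2 : `|h * L2dot q (dPhi (v t))| <= `|h| * (e / 2).
  rewrite normrM ler_wpM2l//; apply: (le_trans CS); apply: le_trans eta2.
  by rewrite mulrC ler_wpM2l.
have -> : A - h * - L2dot xi (dPhi (v t)) =
   (A - h * (- L2dot xi (dPhi (v t)) + L2dot q (dPhi (v t)))) + h * L2dot q (dPhi (v t)) by ring.
apply: (le_trans (ler_normD _ _)); lra.
Qed.

End density.
End chain_rule.

(** * Orbits of the semigroup in [L^2] *)
Section orbits.
Context {R : realType} {N : nat}.
Variables (s p : R).
Local Notation E := 'rV[R]_N.
Local Notation mu := (@leb R N).
Local Notation L2 := (Lfun mu 2%:E).
Local Notation L2norm := (L2norm mu).
Local Notation L2dot := (L2dot mu).
Implicit Types (f g : E -> R) (v : R -> E -> R).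

Lemma cvge0_lt (I : Type) (F : set_system I) (FF : Filter F) (f : I -> \bar R) (e : R) :
  0 < e -> f x @[x --> F] --> 0%E -> \forall x \near F, (f x < e%:E)%E.
Proof.
move=> e0 fF; have /fF : nbhs (0%E : \bar R) [set y : \bar R | (y < e%:E)%E].
  apply: open_nbhs_nbhs; split => /=; first exact: (@open_ereal_lt_ereal R e%:E).
  by rewrite lte_fin.
by [].
Qed.

Lemma dist_L2E f g : f \in L2 -> g \in L2 ->
  dist_Lp 2 f g = (L2norm (fun x => f x - g x))%:E.
Proof. by move=> f2 g2; apply: (Lnorm2E (L2_sub f2 g2)). Qed.

Section orbit.
Variable v : R -> E -> R.
Hypothesis V : L2_semigroup_orbit s p v.

Lemma orbit_L2 t : 0 <= t -> v t \in L2. Proof. by case: V => + _ _ _; exact. Qed.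

Lemma orbit_continuous t0 e : 0 <= t0 -> 0 < e -> exists2 d, 0 < d &
  forall t, 0 <= t -> `|t - t0| < d -> L2norm (fun x => v t x - v t0 x) < e.
Proof.
move=> t00 e0; case: V => _ /(_ _ t00) vc _ _.
have [d /= d0 H] := cvge0_lt _ e0 vc.
exists d => // t t_ge0 td; rewrite -lte_fin -dist_L2E; do ?exact: orbit_L2.
by apply: H => //=; rewrite distrC.
Qed.

Lemma orbit_abs_cont a b e : 0 < a -> a <= b -> 0 < e -> exists2 d, 0 < d &
  forall n (l r : 'I_n -> R),
    (forall i, a <= l i /\ l i <= r i /\ r i <= b) ->
    (forall i j, i != j -> r i <= l j \/ r j <= l i) ->
    \sum_i (r i - l i) < d ->
    \sum_i L2norm (fun x => v (r i) x - v (l i) x) < e.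
Proof.
move=> a0 ab e0; case: V => _ _ /(_ a b a0 ab e e0)[d d0 H] _; exists d => // n l r lr dj sd.
rewrite -lte_fin -sumEFin; apply: le_lt_trans (H n l r lr dj sd).
rewrite le_eqVlt; apply/orP; left; apply/eqP; apply: eq_bigr => i _.
have [al [lir rb]] := lr i.
by rewrite dist_L2E//; apply: orbit_L2; lra.
Qed.

Lemma orbit_derive : {ae (@lebesgue_measure R), forall t, 0 < t ->
  exists2 xi, subdifferential (energy s p) (v t) xi &
    forall e, 0 < e -> exists2 d, 0 < d & forall h, `|h| < d -> h != 0 ->
     L2norm (fun x => h^-1 * (v (t + h) x - v t x) + xi x) <= e}.
Proof.
case: V => _ _ _ aev; apply: ae_lebesgueS aev => t H t0.
have [xi sub dv] := H t0; exists xi => // e e0.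
have [_ xi2 _ _] := sub.
have [d /= d0 Hd] := cvge0_lt _ e0 dv.
exists (Num.min d t); first by rewrite lt_min d0.
move=> h; rewrite lt_min => /andP[hd ht] h0.
have := Hd h; rewrite /= sub0r normrN => /(_ hd h0) => Hh.
have th0 : 0 <= t + h by move: ht; rewrite ltr_norml; lra.
rewrite ltW// -lte_fin; apply: le_lt_trans Hh.
have q2 : (fun x => h^-1 * (v (t + h) x - v t x)) \in L2.
  by apply: L2_scale; apply: L2_sub; apply: orbit_L2 => //; exact: ltW.
have Nxi2 : (\- xi)%R \in L2.
  rewrite (_ : (\- xi)%R = fun x => - 1 * xi x); first exact: L2_scale.
  by apply/funext => x; rewrite mulN1r.
rewrite (dist_L2E q2 Nxi2) lee_fin.
rewrite (_ : (fun x => h^-1 * (v (t + h) x - v t x) + xi x) =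
  (fun x => h^-1 * (v (t + h) x - v t x) - (\- xi)%R x))//.
by apply/funext => x; rewrite /= opprK.
Qed.

Lemma orbit_bounded a b : 0 <= a -> a <= b ->
  exists M, forall t, a <= t -> t <= b -> L2norm (v t) <= M.
Proof.
move=> a0 ab.
apply: (@cousin R (fun l r => exists M, forall t, l <= t -> t <= r -> L2norm (v t) <= M)) => //.
- move=> l m r _ _ [M1 H1] [M2 H2]; exists (Num.max M1 M2) => t lt tr.
  have /orP[tm|mt] := le_total t m; first by rewrite le_max H1.
  by rewrite le_max H2// orbT.
- move=> t0 at0 t0b; have t00 : 0 <= t0 by exact: le_trans at0.
  have [d d0 H] := orbit_continuous t00 ltr01.
  exists d => // l r al lt0 t0r rb rl; exists (1 + L2norm (v t0)) => t lt tr.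
  have tge0 : 0 <= t by lra.
  have td : `|t - t0| < d by rewrite ltr_norml; lra.
  have := L2normD (L2_sub (orbit_L2 tge0) (orbit_L2 t00)) (orbit_L2 t00).
  rewrite (_ : (fun x => _) = v t); last by apply/funext => x; rewrite subrK.
  by move=> /le_trans; apply; rewrite lerD2r ltW// H.
Qed.

Section functional.
Variables (Gam gam : E -> R -> R) (L k c : R).
Hypothesis D : C11_density mu Gam gam L k c.
Local Notation Phi := (functional mu Gam).

Lemma orbit_functional_lip a b : 0 <= a -> a <= b -> exists2 K, 0 <= K &
  forall t t', a <= t -> t <= b -> a <= t' -> t' <= b ->
    `|Phi (v t') - Phi (v t)| <= K * L2norm (fun x => v t' x - v t x).
Proof.
move=> a0 ab; have [M HM] := orbit_bounded a0 ab.
have M0 : 0 <= M by apply: le_trans (HM a (lexx _) ab); exact: L2norm_ge0.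
have c0 := cd_c0 D; have L0 := cd_L0 D.
exists (`|k| + c * M + L * (M + M)).
  by rewrite !addr_ge0// ?mulr_ge0// addr_ge0.
move=> t t' at_ tb at' t'b.
have v2 := orbit_L2 (le_trans a0 at_); have v2' := orbit_L2 (le_trans a0 at').
apply: (le_trans (functional_lip D v2 v2')); rewrite ler_wpM2r ?L2norm_ge0//.
have h1 := ler_wpM2l c0 (HM t at_ tb).
have h2 : L2norm (fun x => v t' x - v t x) <= M + M.
  rewrite (_ : (fun x => _) = fun x => v t' x + (- 1 * v t x)); last first.
    by apply/funext => x; rewrite mulN1r.
  apply: (le_trans (L2normD v2' (L2_scale (- 1) v2))).
  by rewrite L2normZ// normrN normr1 mul1r lerD// HM.
have h3 := ler_wpM2l L0 h2; have h4 := ler_norm k; lra.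
Qed.

Lemma orbit_functional_abs_cont a b : 0 < a -> a <= b ->
  abs_cont a b (fun t => Phi (v t)).
Proof.
move=> a0 ab e e0; have [K K0 HK] := orbit_functional_lip (ltW a0) ab.
have K1 : 0 < K + 1 by lra.
have [d d0 H] := orbit_abs_cont a0 ab (divr_gt0 e0 K1).
exists d => // n l r lr dj sd; have := H n l r lr dj sd.
rewrite ltr_pdivlMr// mulrC mulr_sumr; apply: le_lt_trans.
apply: ler_sum => i _; have [al [lir rb]] := lr i.
apply: (@le_trans _ _ (K * L2norm (fun x => v (r i) x - v (l i) x))).
  by apply: HK => //; [exact: le_trans rb|exact: le_trans lir].
by rewrite ler_wpM2r ?L2norm_ge0// lerDl.
Qed.

Lemma orbit_functional_derive : {ae (@lebesgue_measure R), forall t, 0 < t ->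
  exists2 xi, subdifferential (energy s p) (v t) xi &
    is_derive t (1 : R) (fun t' => Phi (v t'))
      (- L2dot xi (fun x => gam x (v t x)))}.
Proof.
apply: ae_lebesgueS orbit_derive => t H t0; have [xi sub dv] := H t0.
exists xi => //; have [_ xi2 _ _] := sub.
by apply: (functional_derive D t0 orbit_L2 xi2 dv).
Qed.

Lemma orbit_functional_continuous t0 e : 0 <= t0 -> 0 < e ->
  exists2 d, 0 < d & forall t, t0 <= t -> t < t0 + d ->
    `|Phi (v t) - Phi (v t0)| <= e.
Proof.
move=> t00 e0; have t01 : t0 <= t0 + 1 by lra.
have [K K0 HK] := orbit_functional_lip t00 t01.
have K1 : 0 < K + 1 by lra.
have [d d0 H] := orbit_continuous t00 (divr_gt0 e0 K1).
exists (Num.min 1 d); first by rewrite lt_min ltr01.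
move=> t t0t; rewrite -ltrBlDl lt_min => /andP[t1 td].
apply: (le_trans (HK t0 t _ _ _ _)); rewrite ?lexx//; first lra.
have : L2norm (fun x => v t x - v t0 x) < e / (K + 1).
  by apply: H; [exact: le_trans t0t|rewrite ger0_norm ?subr_ge0].
rewrite ltr_pdivlMr// => /ltW; have := L2norm_ge0 mu (fun x => v t x - v t0 x); nra.
Qed.

End functional.
End orbit.
End orbits.

(** * Weighted masses along an orbit *)
Section estimates.
Context {R : realType} {N : nat}.
Variables (s p : R).
Local Notation E := 'rV[R]_N.
Local Notation mu := (@leb R N).
Local Notation L2 := (Lfun mu 2%:E).
Local Notation L2norm := (L2norm mu).
Local Notation L2dot := (L2dot mu).
Local Notation Mop := (@Mop R N s p).
Implicit Types (f g : E -> R) (v : R -> E -> R).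

Lemma L2norm_dom f g (c : R) : 0 <= c -> f \in L2 -> g \in L2 ->
  (forall x, `|f x| <= c * `|g x|) -> L2norm f <= c * L2norm g.
Proof.
move=> c0 f2 g2 fg.
rewrite -(ger0_norm c0) -L2normZ//; apply: ler_wsqrtr; apply: fine_le.
- exact: (integrable_fin_num measurableT (Lfun2_int f2)).
- exact: (integrable_fin_num measurableT (Lfun2_int (L2_scale c g2))).
apply: le_intR.
- by apply: measurable_funX; exact: (Lfun_measurable f2).
- by apply: measurable_funX; exact: (Lfun_measurable (L2_scale c g2)).
- by move=> x; exact: sqr_ge0.
- move=> x; rewrite -[leLHS]real_normK ?num_real// -[leRHS]real_normK ?num_real//.
  by rewrite ler_sqr ?nnegrE// normrM (ger0_norm c0).
Qed.

Lemma le_abs_integrable f g : measurable_fun setT f -> (forall x, `|f x| <= g x) ->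
  measurable_fun setT g -> (\int[mu]_x (g x)%:E < +oo)%E ->
  mu.-integrable setT (fun x => (f x)%:E).
Proof.
move=> mf fg mg goo; apply/integrableP; split; first exact/measurable_EFinP.
apply: le_lt_trans goo.
apply: (@le_intR _ _ _ mu (fun x => `|f x|) g) => //.
exact: measurable_absR.
Qed.

Variables (phi m : E -> R) (B C : R).
Hypothesis W : regular_weight s p phi m B C.

Let B0 : 0 <= B. Proof. exact: le_trans (ltW (rw_gt0 W 0)) (rw_le W 0). Qed.

Lemma soft_abs_le_sqr (e r : R) : 0 < e -> soft_abs e r <= e^-1 * r ^+ 2.
Proof.
move=> e0; apply: (le_trans (soft_abs_le e0 r)); have [re|re] := leP `|r| e.
  by rewrite excess_eq0// mulr_ge0 ?sqr_ge0// invr_ge0 ltW.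
rewrite /excess ge_max; apply/andP; split; last by rewrite mulr_ge0 ?sqr_ge0// invr_ge0 ltW.
apply: (@le_trans _ _ `|r|); first by rewrite gerBl ltW.
by rewrite mulrC ler_pdivlMr// -real_normK ?num_real// expr2 ler_wpM2l// ltW.
Qed.

Lemma trunc_density e : 0 < e -> C11_density mu
  (fun x r => soft_abs e r * phi x) (fun x r => soft_sgn e r * phi x) (4 / e * B) 0 (e^-1 * B).
Proof.
move=> e0; have e10 : 0 <= e^-1 by rewrite invr_ge0 ltW.
have phi0 x : 0 <= phi x := ltW (rw_gt0 W x).
split.
- by rewrite mulr_ge0// mulr_ge0.
- by rewrite mulr_ge0.
- move=> f f2; have mf := Lfun_measurable f2.
  have f2oo := Lfun2_sqr f2.
  apply: (@le_abs_integrable _ (fun x => (e^-1 * B) * f x ^+ 2)).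
  + by apply: measurable_funM; [exact: measurable_soft_abs|exact: (rw_meas W)].
  + move=> x; rewrite ger0_norm; last by rewrite mulr_ge0// soft_abs_ge0.
    by rewrite mulrAC ler_pM ?soft_abs_ge0 ?soft_abs_le_sqr ?(rw_le W).
  + by apply: measurable_funM => //; exact: measurable_funX.
  + rewrite (@intRZ _ _ _ mu (e^-1 * B) (fun x => f x ^+ 2)).
    * by rewrite lte_mul_pinfty// lee_fin mulr_ge0.
    * exact: measurable_funX.
    * by move=> x; exact: sqr_ge0.
    * by rewrite mulr_ge0.
- by move=> f f2; exact: (trunc_Lfun2 W e0 f2).
- move=> f f2; rewrite add0r; apply: L2norm_dom => //; first by rewrite mulr_ge0.
    exact: (trunc_Lfun2 W e0 f2).
  move=> x; rewrite normrM mulrAC ler_pM ?soft_sgn_le_abs//.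
  by rewrite ger0_norm// (rw_le W).
- move=> x a b.
  have h1 := soft_abs_convex e0 a b; have h2 := soft_abs_convex e0 b a.
  have h3 : (soft_sgn e b - soft_sgn e a) * (b - a) <= 4 / e * (b - a) ^+ 2.
    have /orP[ab|ba] := le_total a b.
      by rewrite expr2 mulrA ler_wpM2r ?subr_ge0// soft_sgn_lip.
    rewrite (_ : (soft_sgn e b - soft_sgn e a) * (b - a) = (soft_sgn e a - soft_sgn e b) * (a - b)); last by ring.
    rewrite (_ : (b - a) ^+ 2 = (a - b) * (a - b)); last by ring.
    by rewrite mulrA ler_wpM2r ?subr_ge0// soft_sgn_lip.
  have r0 : 0 <= soft_abs e b - soft_abs e a - soft_sgn e a * (b - a) by lra.
  have r1 : soft_abs e b - soft_abs e a - soft_sgn e a * (b - a) <= 4 / e * (b - a) ^+ 2 by lra.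
  rewrite (_ : _ - _ - _ = (soft_abs e b - soft_abs e a - soft_sgn e a * (b - a)) * phi x); last by ring.
  by rewrite normrM !ger0_norm// mulrAC ler_pM// (rw_le W).
Qed.

Definition trunc_mass e f : R := functional mu (fun x r => soft_abs e r * phi x) f.

Lemma trunc_mass_ge0 e f : 0 < e -> 0 <= trunc_mass e f.
Proof.
move=> e0; apply: fine_ge0; apply: integral_ge0 => x _.
by rewrite lee_fin mulr_ge0 ?soft_abs_ge0// ltW// (rw_gt0 W).
Qed.

Let psi e x := excess e (phi x).

Lemma linear_density e : 0 < e -> C11_density mu
  (fun x r => - psi e x * r) (fun x _ => - psi e x) 0 (L2norm (fun x => - psi e x)) 0.
Proof.
move=> e0.
have psi2 : (fun x => - psi e x) \in L2.
  rewrite (_ : (fun x => _) = fun x => - 1 * psi e x).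
    by apply: L2_scale; exact: (excess_phi_Lfun W).
  by apply/funext => x; rewrite mulN1r.
split => //.
- by move=> f f2; exact: L2_int.
- by move=> f f2; rewrite mul0r addr0.
- move=> x a b; rewrite mul0r (_ : _ - _ - _ = 0) ?normr0//; ring.
Qed.

Hypotheses (p1 : 1 < p) (p2 : p < 2).
Let A := C `^ (2 - p).
Let K := (2 - p) * A.
Let A0 : 0 <= A. Proof. exact: powR_ge0. Qed.
Let K0 : 0 <= K. Proof. by rewrite mulr_ge0// subr_ge0 ltW. Qed.

Section orbit.
Variable v : R -> E -> R.
Hypothesis V : L2_semigroup_orbit s p v.

Lemma trunc_hoelder e f : 0 < e -> f \in L2 ->
  (\int[mu]_x (soft_abs e (f x) `^ (p - 1) * m x)%:E <=
     (A * trunc_mass e f `^ (p - 1))%:E)%E.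
Proof.
move=> e0 f2; have D := trunc_density e0.
apply: (@weight_hoelder _ _ _ _ _ _ _ _ W (fun x => soft_abs e (f x)) _ p1 p2).
- by apply: measurable_soft_abs => //; exact: (Lfun_measurable f2).
- by move=> x; exact: soft_abs_ge0.
- exact: (functionalE D f2).
Qed.

Let growth_pos e a b : 0 < e -> 0 < a -> a <= b ->
  trunc_mass e (v b) `^ (2 - p) <= trunc_mass e (v a) `^ (2 - p) + K * (b - a).
Proof.
move=> e0 a0 ab; have D := trunc_density e0.
apply: (@powR_growth _ p A a b (fun t => trunc_mass e (v t))) => //.
- by move=> t; exact: trunc_mass_ge0.
- exact: (orbit_functional_abs_cont V D).
apply: ae_lebesgueS (orbit_functional_derive V D) => t H at_ tb.
have t0 : 0 < t by exact: lt_le_trans at_.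
have [xi sub dF] := H t0; have [v2 xi2 _ _] := sub.
exists (- L2dot xi (fun x => soft_sgn e (v t x) * phi x)) => //.
rewrite -lee_fin EFinN -L2dotE//; last exact: (trunc_Lfun2 W e0 v2).
apply: (le_trans (dissipation_trunc W p1 p2 e0 sub)).
exact: trunc_hoelder.
Qed.

(** An orbit is known to be absolutely continuous on [[a, b]] only for [a > 0]; the case
    [a = 0] follows by continuity. *)
Lemma trunc_mass_growth e a b : 0 < e -> 0 <= a -> a <= b ->
  trunc_mass e (v b) `^ (2 - p) <= trunc_mass e (v a) `^ (2 - p) + K * (b - a).
Proof.
move=> e0 a0; rewrite le_eqVlt => /predU1P[<-|ab].
  by rewrite subrr mulr0 addr0.
have D := trunc_density e0.
have q0 : 0 < 2 - p by rewrite subr_gt0.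
have q1 : 2 - p <= 1 by move: p1 => ?; lra.
apply/ler_addgt0Pr => eta eta0.
pose h := eta `^ (2 - p)^-1.
have h0 : 0 < h by exact: powR_gt0.
have hE : h `^ (2 - p) = eta by rewrite -powRrM mulVf ?gt_eqF// powRr1// ltW.
have [d d0 Hd] := orbit_functional_continuous V D a0 h0.
pose a' := Num.min b (a + d / 2).
have aa' : a < a' by rewrite lt_min ab ltrDl divr_gt0.
have a'b : a' <= b by rewrite ge_min lexx.
have a'd : a' < a + d.
  by apply: (@le_lt_trans _ _ (a + d / 2)); [rewrite ge_min lexx orbT|lra].
have G := growth_pos e0 (le_lt_trans a0 aa') a'b.
have Fa' : trunc_mass e (v a') <= trunc_mass e (v a) + h.
  rewrite -lerBlDl; apply: (le_trans (ler_norm _)).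
  exact: (Hd a' (ltW aa') a'd).
have F0 := @trunc_mass_ge0 e (v a) e0.
rewrite [leRHS]addrAC; apply: (le_trans G); apply: lerD.
  apply: (le_trans (le_powR (ltW q0) (trunc_mass_ge0 _ e0) Fa')).
  by rewrite -hE; apply: powRD_subadd => //; exact: ltW.
by rewrite ler_wpM2l// lerD2l lerN2 ltW.
Qed.

(** [|v|^(p-1)] is at most [G(v)^(p-1) + (2 e)^(p-1)]. The first term is paired with
    [M phi] and, by the growth estimate, bounded on [[a, b]] in terms of the value at
    [a]; the second is paired with [M] of the truncated weight, which is integrable. *)
Lemma linear_mass_decay e e' a b : 0 < e -> 0 < e' -> 0 <= a -> a <= b ->
  L2dot (psi e') (v a) - L2dot (psi e') (v b) <= (b - a) *
  (A * (trunc_mass e (v a) `^ (2 - p) + K * (b - a)) `^ ((p - 1) / (2 - p)) +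
   (2 * e) `^ (p - 1) * fine (\int[mu]_x Mop (psi e') x)%E).
Proof.
move=> e0 e'0 a0; rewrite le_eqVlt => /predU1P[<-|ab].
  by rewrite !subrr mul0r.
have D := linear_density e'0.
have psi2 : psi e' \in L2 by exact: (excess_phi_Lfun W).
set c := _ + _ * fine _.
have q0 : 0 < 2 - p by rewrite subr_gt0.
have p10 : 0 < p - 1 by rewrite subr_gt0.
have Moo : (\int[mu]_x Mop (psi e') x < +oo)%E by exact: (Mop_excess_int W).
have M0 : (0 <= \int[mu]_x Mop (psi e') x)%E.
  by apply: integral_ge0 => x _; exact: Mop_ge0.
have ME : (\int[mu]_x Mop (psi e') x)%E = (fine (\int[mu]_x Mop (psi e') x)%E)%:E.
  by rewrite fineK// ge0_fin_numE.
have c0 : 0 <= c.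
  by rewrite addr_ge0// mulr_ge0 ?powR_ge0// fine_ge0.
pose F t := functional mu (fun x r => - psi e' x * r) (v t).
have FE t : 0 <= t -> F t = - L2dot (psi e') (v t).
  move=> t0; have v2 := orbit_L2 V t0.
  apply: EFin_inj; rewrite -(functionalE D v2) EFinN -L2dotE//.
  transitivity ((- 1)%:E * \int[mu]_x (psi e' x * v t x)%:E)%E; last first.
    by rewrite EFinN mulN1e.
  rewrite -(integralZl measurableT (L2_int psi2 v2)).
  by apply: eq_integral => x _; rewrite -EFinM; congr EFin; ring.
rewrite [leRHS]mulrC.
have pos a' : a < a' -> a' <= b -> F b - F a' <= c * (b - a').
  move=> aa' a'b; have a'0 : 0 < a' by exact: le_lt_trans aa'.
  apply: abs_cont_ler => //; first exact: (orbit_functional_abs_cont V D).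
  apply: ae_lebesgueS (orbit_functional_derive V D) => t H at_ tb.
  have t0 : 0 < t by exact: lt_le_trans at_.
  have [xi sub dF] := H t0; have [v2 xi2 _ _] := sub.
  exists (- L2dot xi (fun x => - psi e' x)) => //.
  have -> : - L2dot xi (fun x => - psi e' x) = L2dot xi (psi e').
    rewrite L2dotC (_ : (fun x => - psi e' x) = fun x => - 1 * psi e' x).
      by rewrite L2dotZ// mulN1r opprK L2dotC.
    by apply/funext => x; rewrite mulN1r.
  rewrite -lee_fin -L2dotE//.
  apply: (le_trans (dissipation_lin W p1 p2 e'0 sub)).
  have mv := Lfun_measurable v2.
  have mpsi := Lfun_measurable psi2.
  have mM : measurable_fun setT (Mop (psi e')) by exact: measurable_Mop.
  have mG : measurable_fun setT (fun x => soft_abs e (v t x) `^ (p - 1)).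
    by apply: measurable_powRl; exact: measurable_soft_abs.
  pose up x := ((soft_abs e (v t x) `^ (p - 1) * m x)%:E +
       ((2 * e) `^ (p - 1))%:E * Mop (psi e') x)%E.
  apply: (@le_trans _ _ (\int[mu]_x up x)%E).
    apply: ge0_le_integral => //.
    - by move=> x _; rewrite mule_ge0 ?Mop_ge0// lee_fin powR_ge0.
    - apply: emeasurable_funM => //; apply/measurable_EFinP.
      by apply: measurable_powRl; exact: measurable_absR.
    - rewrite /up; apply: emeasurable_funD; last exact: emeasurable_funM.
      by apply/measurable_EFinP; apply: measurable_funM => //; exact: (rw_measM W).
    move=> x _.
    have vx : `|v t x| `^ (p - 1) <= soft_abs e (v t x) `^ (p - 1) + (2 * e) `^ (p - 1).
      apply: (@le_trans _ _ ((soft_abs e (v t x) + 2 * e) `^ (p - 1))).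
        by rewrite le_powR ?(ltW p10) ?le_soft_abs.
      apply: powRD_subadd => //; rewrite ?soft_abs_ge0 ?mulr_ge0 ?(ltW e0)//.
      by move: p2 => ?; lra.
    apply: (@le_trans _ _ ((soft_abs e (v t x) `^ (p - 1) + (2 * e) `^ (p - 1))%:E * Mop (psi e') x)%E).
      by apply: lee_wpmul2r; [exact: Mop_ge0|rewrite lee_fin].
    rewrite /up EFinD ge0_muleDl ?lee_fin ?powR_ge0//; apply: leeD2r.
    rewrite EFinM; apply: lee_wpmul2l; first by rewrite lee_fin powR_ge0.
    exact: (Mop_excess_le W).
  rewrite /up ge0_integralD//; last 4 first.
  - by move=> x _; rewrite lee_fin mulr_ge0 ?powR_ge0// (rw_m0 W).
  - by apply/measurable_EFinP; apply: measurable_funM => //; exact: (rw_measM W).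
  - by move=> x _; rewrite mule_ge0 ?Mop_ge0// lee_fin powR_ge0.
  - exact: emeasurable_funM.
  rewrite /c EFinD; apply: leeD.
    apply: (le_trans (trunc_hoelder e0 v2)); rewrite lee_fin ler_wpM2l//.
    rewrite (_ : trunc_mass e (v t) `^ (p - 1) =
        (trunc_mass e (v t) `^ (2 - p)) `^ ((p - 1) / (2 - p))); last first.
      by rewrite -powRrM mulrCA divff ?mulr1// gt_eqF.
    rewrite le_powR ?powR_ge0//; first by rewrite divr_ge0// ltW.
    have at' : a <= t by exact: le_trans (ltW aa') at_.
    apply: (le_trans (trunc_mass_growth e0 a0 at')).
    by rewrite lerD2l ler_wpM2l// lerD2r.
  rewrite ge0_integralZl//; last 2 first.
  - by move=> x _; exact: Mop_ge0.
  - by rewrite lee_fin powR_ge0.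
  by rewrite ME.
apply/ler_addgt0Pr => eta eta0.
have [d d0 Hd] := orbit_functional_continuous V D a0 eta0.
pose a' := Num.min b (a + d / 2).
have aa' : a < a' by rewrite lt_min ab ltrDl divr_gt0.
have a'b : a' <= b by rewrite ge_min lexx.
have a'd : a' < a + d.
  by apply: (@le_lt_trans _ _ (a + d / 2)); [rewrite ge_min lexx orbT|lra].
have h1 := pos a' aa' a'b.
have h2 : F a' - F a <= eta.
  by apply: (le_trans (ler_norm _)); exact: (Hd a' (ltW aa') a'd).
have h3 : c * (b - a') <= c * (b - a) by rewrite ler_wpM2l// lerD2l lerN2 ltW.
have -> : L2dot (psi e') (v a) = - F a by rewrite FE// opprK.
have -> : L2dot (psi e') (v b) = - F b by rewrite FE ?opprK// (le_trans a0 (ltW ab)).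
rewrite opprK [leLHS](_ : _ = (F b - F a') + (F a' - F a)).
  by apply: lerD => //; exact: le_trans h3.
by move: (F a) (F b) (F a') => x y z; ring.
Qed.

End orbit.
End estimates.

(** * Passage to the limit *)
Section limits.
Context {R : realType} {N : nat}.
Local Notation E := 'rV[R]_N.
Local Notation mu := (@leb R N).
Local Open Scope ereal_scope.

Lemma powR_right_continuous (b Y eps : R) : (0 < b)%R -> (0 <= Y)%R -> (0 < eps)%R ->
  exists2 s : R, (0 < s)%R & ((Y + s) `^ b <= Y `^ b + eps)%R.
Proof.
move=> b0 Y0 e0; have [b1|b1] := leP b 1%R.
  have sE : ((eps `^ b^-1) `^ b = eps)%R.
    by rewrite -powRrM mulVf ?gt_eqF// powRr1// ltW.
  exists (eps `^ b^-1)%R; first exact: powR_gt0.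
  by rewrite -[in leRHS]sE; apply: powRD_subadd => //; exact: powR_ge0.
pose k := (b * (Y + 1) `^ (b - 1))%R.
have k0 : (0 <= k)%R by rewrite mulr_ge0 ?powR_ge0// ltW.
have k1 : (0 < k + 1)%R by lra.
pose s := Num.min 1%R (eps / (k + 1))%R.
have s0 : (0 < s)%R by rewrite lt_min ltr01 divr_gt0.
have s1 : (s <= 1)%R by rewrite ge_min lexx.
have sk : (s * (k + 1) <= eps)%R by rewrite -ler_pdivlMr// ge_min lexx orbT.
exists s => //.
have Ys : (0 <= Y + s)%R by lra.
have h1 := powR_tangent_convex b1 Ys Y0.
have b10 : (0 <= b - 1)%R by lra.
have Ys1 : (Y + s <= Y + 1)%R by lra.
have h2 : (b * (Y + s) `^ (b - 1) <= k)%R by rewrite ler_pM2l// le_powR.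
have h3 := ler_wpM2r (ltW s0) h2.
by rewrite (_ : Y - (Y + s) = - s)%R in h1; [lra|ring].
Qed.

Lemma excess_sup (a b : E -> R) (c : \bar R) : measurable_fun setT a ->
  measurable_fun setT b -> (forall x, (0 <= a x)%R) -> (forall x, (0 <= b x)%R) ->
  (forall e, (0 < e)%R -> \int[mu]_x (excess e (a x) * b x)%:E <= c) ->
  \int[mu]_x (a x * b x)%:E <= c.
Proof.
move=> ma mb a0 b0 H.
pose en (n : nat) : R := (n.+1%:R^-1)%R.
have en0 n : (0 < en n)%R by rewrite invr_gt0.
pose g n x := (excess (en n) (a x) * b x)%:E.
have gcvg x : g n x @[n --> \oo] --> (a x * b x)%:E.
  apply: cvg_EFin; first by apply: nearW.
  apply: cvgMl; apply: (@squeeze_cvgr _ _ _ _ (fun n => a x - en n)%R (fun=> a x)).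
  - apply: nearW => n; rewrite excess_le/= ge_max a0 andbT gerBl; exact: ltW.
  - rewrite -[X in _ --> X]subr0; apply: cvgB; first exact: cvg_cst.
    exact: cvg_harmonic.
  - exact: cvg_cst.
have gE : \int[mu]_x (a x * b x)%:E = limn (fun n => \int[mu]_x g n x).
  rewrite -monotone_convergence//.
  - by apply: eq_integral => x _; apply/esym/cvg_lim => //; exact: gcvg.
  - move=> n; apply/measurable_EFinP; apply: measurable_funM => //.
    exact: (@measurable_excess _ _ (en n) a).
  - by move=> n x _; rewrite lee_fin mulr_ge0// excess_ge0.
  move=> x _ i j ij; rewrite lee_fin ler_wpM2r//.
  have eij : (en j <= en i)%R by rewrite /en lef_pV2 ?posrE// ler_nat.
  by rewrite /excess ge_max excess_ge0 andbT (le_trans _ (excess_le _ _))// lerD2l lerN2.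
rewrite gE; apply: lime_le; last by apply: nearW => n; exact: H.
apply: ereal_nondecreasing_is_cvgn => i j ij; apply: le_intR.
- by apply: measurable_funM => //; exact: (@measurable_excess _ _ (en i) a).
- by apply: measurable_funM => //; exact: (@measurable_excess _ _ (en j) a).
- by move=> x; rewrite mulr_ge0// excess_ge0.
move=> x; rewrite ler_wpM2r//.
have eij : (en j <= en i)%R by rewrite /en lef_pV2 ?posrE// ler_nat.
by rewrite /excess ge_max excess_ge0 andbT (le_trans _ (excess_le _ _))// lerD2l lerN2.
Qed.

(** Away from zero, convergence in [L^q] controls convergence in [L^1]. *)
Lemma excess_powR (q e r : R) : (1 <= q)%R -> (0 < e)%R ->
  (excess e `|r| <= e `^ (1 - q) * `|r| `^ q)%R.
Proof.
move=> q1 e0; have [re|re] := leP `|r|%R e.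
  by rewrite excess_eq0// mulr_ge0 ?powR_ge0.
have r0 : (0 < `|r|)%R by exact: lt_trans re.
rewrite /excess ge_max mulr_ge0 ?powR_ge0// andbT.
apply: (@le_trans _ _ `|r|%R); first by rewrite gerBl ltW.
have -> : (e `^ (1 - q) = (e `^ (q - 1))^-1)%R by rewrite -powRN opprB.
rewrite mulrC ler_pdivlMr ?powR_gt0// -[leRHS](mulr_powRB1 (ltW r0)); last lra.
by rewrite ler_wpM2l ?(ltW r0)// le_powR ?(ltW e0) ?(ltW re)//; lra.
Qed.

End limits.

Section approximation.
Context {R : realType} {N : nat}.
Local Notation E := 'rV[R]_N.
Local Notation mu := (@leb R N).
Local Notation L2 := (Lfun mu 2%:E).
Variables (s p : R) (phi m : E -> R) (B C : R).
Hypothesis W : regular_weight s p phi m B C.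
Hypotheses (p1 : 1 < p) (p2 : p < 2).
Variables (v : nat -> R -> E -> R) (T q : R) (u : R -> E -> R).
Hypothesis V : forall n, L2_semigroup_orbit s p (v n).
Hypothesis q1 : 1 <= q.
Hypothesis u0 : forall t x, 0 <= u t x.
Hypothesis mu_ : forall t, 0 <= t -> t < T -> measurable_fun setT (u t).
Hypothesis conv : forall t eta, 0 <= t -> t < T -> 0 < eta -> exists n0, forall n,
  (n0 <= n)%N -> (\int[mu]_x (`|v n t x - u t x| `^ q)%:E <= eta%:E)%E.
Let phi0 x : 0 <= phi x := ltW (rw_gt0 W x).
Let mphi : measurable_fun setT phi := rw_meas W.
Let B0 : 0 <= B. Proof. exact: le_trans (phi0 0) (rw_le W 0). Qed.
Let A := C `^ (2 - p).
Let K := (2 - p) * A.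
Let A0 : 0 <= A. Proof. exact: powR_ge0. Qed.
Let q0 : 0 < 2 - p. Proof. by rewrite subr_gt0. Qed.
Let p10 : 0 < p - 1. Proof. by rewrite subr_gt0. Qed.
Let K0 : 0 <= K. Proof. by rewrite mulr_ge0// ltW. Qed.
Let mv n t : 0 <= t -> measurable_fun setT (v n t).
Proof. by move=> t0; exact: (Lfun_measurable (orbit_L2 (V n) t0)). Qed.
Let mz n t : 0 <= t -> t < T -> measurable_fun setT (fun x => `|v n t x - u t x|).
Proof.
move=> t0 tT; apply: measurable_absR.
by apply: measurable_funB; [exact: mv|exact: mu_].
Qed.

Let X t := (\int[mu]_x (u t x * phi x)%:E)%E.
Let x_ t := fine (X t).

Let X0 t : (0 <= X t)%E.
Proof. by apply: intR_ge0 => x; rewrite mulr_ge0. Qed.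

Let XE t : (X t < +oo)%E -> X t = (x_ t)%:E.
Proof. by move=> h; rewrite /x_ fineK// ge0_fin_numE. Qed.

Let x0 t : 0 <= x_ t. Proof. exact: fine_ge0. Qed.

Lemma conv_tail t d eta : 0 <= t -> t < T -> 0 < d -> 0 < eta ->
  exists n0, forall n, (n0 <= n)%N ->
  (\int[mu]_x (excess d `|v n t x - u t x| * phi x)%:E <= eta%:E)%E.
Proof.
move=> t0 tT d0 eta0.
pose k := B * d `^ (1 - q).
have k0 : 0 <= k by rewrite mulr_ge0 ?powR_ge0.
have k1 : 0 < k + 1 by lra.
have [n0 H] := conv t0 tT (divr_gt0 eta0 k1); exists n0 => n /H {}H.
have mzq : measurable_fun setT (fun x => `|v n t x - u t x| `^ q).
  by apply: measurable_powRl; exact: mz.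
apply: (@le_trans _ _ (\int[mu]_x (k * `|v n t x - u t x| `^ q)%:E)%E).
  apply: le_intR.
  - apply: measurable_funM => //.
    exact: (@measurable_excess _ _ d (fun x => `|v n t x - u t x|)  (mz n t0 tT)).
  - exact: measurable_funM.
  - by move=> x; rewrite mulr_ge0// excess_ge0.
  move=> x; rewrite [leRHS](_ : _ = d `^ (1 - q) * `|v n t x - u t x| `^ q * B).
    by rewrite ler_pM ?excess_ge0 ?(rw_le W)// excess_powR.
  by rewrite /k; ring.
rewrite (@intRZ _ _ _ mu k (fun x => `|v n t x - u t x| `^ q))//.
have kk : (k%:E <= (k + 1)%:E)%E by rewrite lee_fin lerDl.
apply: (@le_trans _ _ ((k + 1)%:E * (eta / (k + 1))%:E)%E).
  apply: lee_pmul => //; apply: intR_ge0 => x; exact: powR_ge0.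
by rewrite -EFinM mulrC divfK ?gt_eqF.
Qed.

(** In this and the next comparison, the error [z] of the approximation enters through
    [(|z| - e)^+] only, which is small in [L^1] when [z] is small in [L^q]. *)
Lemma trunc_mass_le t e eta n : 0 < e -> 0 <= t -> t < T -> (X t < +oo)%E ->
  (\int[mu]_x (excess e `|v n t x - u t x| * phi x)%:E <= eta%:E)%E ->
  trunc_mass phi e (v n t) <= x_ t + eta.
Proof.
move=> e0 t0 tT Xt Hn; rewrite -lee_fin EFinD -XE//.
have v2 := orbit_L2 (V n) t0.
rewrite -(functionalE (trunc_density W e0) v2).
apply: le_trans (leeD2l _ Hn).
rewrite -intRD//.
- apply: le_intR.
  + by apply: measurable_funM => //; apply: measurable_soft_abs => //; exact: mv.
  + apply: measurable_funD; apply: measurable_funM => //; first exact: mu_.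
    exact: (@measurable_excess _ _ e (fun x => `|v n t x - u t x|)  (mz n t0 tT)).
  + by move=> x; rewrite mulr_ge0 ?soft_abs_ge0.
  move=> x; rewrite -mulrDl ler_wpM2r//; apply: (le_trans (soft_abs_le e0 _)).
  have h1 := ler_normD (v n t x - u t x) (u t x).
  have h2 := excess_le e `|v n t x - u t x|; have h3 := excess_ge0 e `|v n t x - u t x|.
  have h4 := u0 t x; rewrite (ger0_norm h4) subrK in h1.
  rewrite {1}/excess ge_max; apply/andP; split; lra.
- by apply: measurable_funM => //; exact: mu_.
- apply: measurable_funM => //.
  exact: (@measurable_excess _ _ e (fun x => `|v n t x - u t x|)  (mz n t0 tT)).
- by move=> x; rewrite mulr_ge0.
- by move=> x; rewrite mulr_ge0// excess_ge0.
Qed.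

Lemma le_trunc_mass t e eta n : 0 < e -> 0 <= t -> t < T ->
  (\int[mu]_x (excess e `|v n t x - u t x| * phi x)%:E <= eta%:E)%E ->
  (\int[mu]_x (excess (3 * e) (u t x) * phi x)%:E <=
    (trunc_mass phi e (v n t) + eta)%:E)%E.
Proof.
move=> e0 t0 tT Hn; rewrite EFinD.
have v2 := orbit_L2 (V n) t0.
rewrite -(functionalE (trunc_density W e0) v2).
apply: le_trans (leeD2l _ Hn).
rewrite -intRD//.
- apply: le_intR.
  + by apply: measurable_funM => //; apply: (@measurable_excess _ _ (3 * e) (u t)); exact: mu_.
  + apply: measurable_funD; apply: measurable_funM => //.
      by apply: measurable_soft_abs => //; exact: mv.
    exact: (@measurable_excess _ _ e (fun x => `|v n t x - u t x|)  (mz n t0 tT)).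
  + by move=> x; rewrite mulr_ge0// excess_ge0.
  move=> x; rewrite -mulrDl ler_wpM2r//.
  have h1 := ler_normB (v n t x) (v n t x - u t x).
  have h2 := excess_le e `|v n t x - u t x|; have h3 := excess_ge0 e `|v n t x - u t x|.
  have h4 := le_soft_abs e0 (v n t x); have h5 := soft_abs_ge0 e0 (v n t x).
  have h6 := ler_norm (u t x).
  rewrite (_ : v n t x - (v n t x - u t x) = u t x) in h1; last by ring.
  rewrite {1}/excess ge_max; apply/andP; split; lra.
- by apply: measurable_funM => //; apply: measurable_soft_abs => //; exact: mv.
- apply: measurable_funM => //.
  exact: (@measurable_excess _ _ e (fun x => `|v n t x - u t x|)  (mz n t0 tT)).
- by move=> x; rewrite mulr_ge0 ?soft_abs_ge0.
- by move=> x; rewrite mulr_ge0// excess_ge0.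
Qed.

Let powq_root e : 0 < e -> exists2 d, 0 < d & d `^ (2 - p) = e.
Proof.
move=> e0; exists (e `^ (2 - p)^-1); first exact: powR_gt0.
by rewrite -powRrM mulVf ?gt_eqF// powRr1// ltW.
Qed.

Let q1' : 2 - p <= 1. Proof. by move: p1 => ?; lra. Qed.

(** The growth estimate passes to the limit for the mass of [(u - 3 e)^+], and then
    for the mass of [u]: finiteness of the mass propagates forward in time. *)
Lemma mass_growth t1 t2 : 0 <= t1 -> t1 <= t2 -> t2 < T -> (X t1 < +oo)%E ->
  (X t2 < +oo)%E /\ x_ t2 `^ (2 - p) <= x_ t1 `^ (2 - p) + K * (t2 - t1).
Proof.
move=> t10 t12 t2T Xt1.
have t1T : t1 < T by exact: le_lt_trans t2T.
have t20 : 0 <= t2 by exact: le_trans t12.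
pose Y := x_ t1 `^ (2 - p) + K * (t2 - t1).
have Y0 : 0 <= Y by rewrite addr_ge0 ?powR_ge0// mulr_ge0// subr_ge0.
have YE : (Y `^ (2 - p)^-1) `^ (2 - p) = Y by rewrite -powRrM mulVf ?gt_eqF// powRr1.
suff H : (X t2 <= (Y `^ (2 - p)^-1)%:E)%E.
  have Xt2 : (X t2 < +oo)%E by exact: le_lt_trans H (ltry _).
  split => //; rewrite -/Y -[leRHS]YE le_powR ?(ltW q0)//.
  by rewrite -lee_fin -XE.
apply: excess_sup => //; first exact: mu_.
move=> e3 e30; pose e := e3 / 3.
have e0 : 0 < e by rewrite divr_gt0.
have -> : e3 = 3 * e by rewrite /e mulrC divfK.
pose r := fine (\int[mu]_x (excess (3 * e) (u t2 x) * phi x)%:E)%E.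
have r0 : (0 <= \int[mu]_x (excess (3 * e) (u t2 x) * phi x)%:E)%E.
  by apply: intR_ge0 => x; rewrite mulr_ge0// excess_ge0.
have approx eta : 0 < eta -> exists n,
    trunc_mass phi e (v n t1) <= x_ t1 + eta /\
    (\int[mu]_x (excess (3 * e) (u t2 x) * phi x)%:E <=
      (trunc_mass phi e (v n t2) + eta)%:E)%E.
  move=> eta0; have [n1 H1] := conv_tail t10 t1T e0 eta0.
  have [n2 H2] := conv_tail t20 t2T e0 eta0.
  exists (maxn n1 n2); split.
    by apply: trunc_mass_le => //; apply: H1; exact: leq_maxl.
  by apply: le_trunc_mass => //; apply: H2; exact: leq_maxr.
have rE : (\int[mu]_x (excess (3 * e) (u t2 x) * phi x)%:E)%E = r%:E.
  rewrite /r fineK// ge0_fin_numE//.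
  by have [n [_ /le_lt_trans]] := approx 1 ltr01; apply; exact: ltry.
rewrite rE lee_fin.
suff rY : r `^ (2 - p) <= Y.
  have -> : r = (r `^ (2 - p)) `^ (2 - p)^-1.
    by rewrite -powRrM mulfV ?gt_eqF// powRr1// fine_ge0.
  by rewrite le_powR ?powR_ge0// invr_ge0 ltW.
apply/ler_addgt0Pr => e' e'0.
have [eta eta0 etaE] := powq_root (divr_gt0 e'0 (ltr0n _ 2)).
have [n [h1 h2]] := approx eta eta0.
rewrite rE lee_fin in h2.
have F10 := @trunc_mass_ge0 _ _ _ _ _ _ _ _ W e (v n t1) e0.
have F20 := @trunc_mass_ge0 _ _ _ _ _ _ _ _ W e (v n t2) e0.
have g := trunc_mass_growth W p1 p2 (V n) e0 t10 t12.
apply: (le_trans (le_powR (ltW q0) (fine_ge0 r0) h2)).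
apply: (le_trans (powRD_subadd q0 q1' F20 (ltW eta0))).
rewrite etaE (_ : Y + e' = Y + e' / 2 + e' / 2); last by field.
rewrite lerD2r; apply: (le_trans g).
rewrite /Y [leRHS]addrAC lerD2r.
apply: (le_trans (le_powR (ltW q0) F10 h1)).
by rewrite -etaE; exact: (powRD_subadd q0 q1' (x0 t1) (ltW eta0)).
Qed.

Let psi e x := excess e (phi x).
Let U e t := fine (\int[mu]_x (psi e x * u t x)%:E)%E.

Let psi_le e x : 0 < e -> psi e x <= phi x.
Proof. by move=> e0; rewrite /psi /excess ge_max phi0 andbT gerBl ltW. Qed.

Let mpsi e : measurable_fun setT (psi e).
Proof. exact: (@measurable_excess _ _ e phi). Qed.

Let psi_int e : 0 < e -> (\int[mu]_x (psi e x)%:E < +oo)%E.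
Proof.
move=> e0; have psi1 := excess_phi_Lfun W ltr01 e0.
have [_] := (LfunE mu (psi e) ltr01).1 psi1.
apply: le_lt_trans; apply: le_intR => //.
- by apply: measurable_powRl; exact: measurable_absR.
- by move=> x; exact: excess_ge0.
- by move=> x; rewrite powRr1// ler_norm.
Qed.

Let psiu_int e t : 0 < e -> 0 <= t -> t < T -> (X t < +oo)%E ->
  mu.-integrable setT (fun x => (psi e x * u t x)%:E).
Proof.
move=> e0 t0 tT Xt; apply: (@le_abs_integrable _ _ _ (fun x => u t x * phi x)) => //.
- by apply: measurable_funM => //; exact: mu_.
- move=> x; rewrite ger0_norm ?mulr_ge0 ?excess_ge0// mulrC.
  by rewrite ler_wpM2l// psi_le.
- by apply: measurable_funM => //; exact: mu_.
Qed.

Lemma L2dot_approx t e eps : 0 <= t -> t < T -> 0 < e -> 0 < eps -> (X t < +oo)%E ->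
  exists n0, forall n, (n0 <= n)%N -> `|L2dot mu (psi e) (v n t) - U e t| <= eps.
Proof.
move=> t0 tT e0 eps0 Xt.
pose I := fine (\int[mu]_x (psi e x)%:E)%E.
have Ige0 : (0 <= \int[mu]_x (psi e x)%:E)%E by apply: intR_ge0 => x; exact: excess_ge0.
have IE : (\int[mu]_x (psi e x)%:E)%E = I%:E.
  by rewrite /I fineK// ge0_fin_numE// psi_int.
have I0 : 0 <= I by exact: fine_ge0.
have I1 : 0 < 2 * (I + 1) by lra.
pose d := eps / (2 * (I + 1)).
have d0 : 0 < d by rewrite divr_gt0.
have dI : d * I <= eps / 2.
  by rewrite /d mulrAC ler_pdivrMr//; lra.
have eps20 : 0 < eps / 2 by rewrite divr_gt0.
have [n0 H] := conv_tail t0 tT d0 eps20; exists n0 => n /H {}H.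
have v2 := orbit_L2 (V n) t0.
have psi2 : psi e \in L2 by exact: (excess_phi_Lfun W).
have i1 := L2_int psi2 v2; have i2 := psiu_int e0 t0 tT Xt.
have UE : (\int[mu]_x (psi e x * u t x)%:E)%E = (U e t)%:E.
  by rewrite /U fineK//; exact: (integrable_fin_num measurableT i2).
have mpz : measurable_fun setT (fun x => excess d `|v n t x - u t x| * phi x).
  apply: measurable_funM => //.
  exact: (@measurable_excess _ _ d (fun x => `|v n t x - u t x|) (mz n t0 tT)).
rewrite -lee_fin -abse_EFin EFinB -L2dotE// -UE.
rewrite -(integralB measurableT i1 i2).
apply: (le_trans (le_abse_integral mu measurableT _)).
  exact: measurable_int (integrableB measurableT i1 i2).
apply: (@le_trans _ _ (\int[mu]_x (d * psi e x + excess d `|v n t x - u t x| * phi x)%:E)%E).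
  apply: ge0_le_integral => //.
  - apply: measurableT_comp => //.
    exact: measurable_int (integrableB measurableT i1 i2).
  - apply/measurable_EFinP; apply: measurable_funD => //.
    exact: measurable_funM.
  move=> x _; rewrite -EFinB abse_EFin lee_fin -mulrBr normrM.
  rewrite ger0_norm ?excess_ge0//.
  have h1 := excess_le d `|v n t x - u t x|.
  have h2 : psi e x * `|v n t x - u t x| <= psi e x * (d + excess d `|v n t x - u t x|).
    by rewrite ler_wpM2l ?excess_ge0//; lra.
  apply: (le_trans h2); rewrite mulrDr (mulrC _ d) lerD2l mulrC.
  by rewrite ler_wpM2l ?excess_ge0// psi_le.
rewrite (@intRD _ _ _ mu (fun x => d * psi e x) (fun x => excess d `|v n t x - u t x| * phi x))//.
- rewrite intRZ//; last 2 first.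
  + by move=> x; exact: excess_ge0.
  + exact: ltW.
  rewrite IE [in leRHS](splitr eps) EFinD; apply: leeD => //.
- exact: measurable_funM.
- by move=> x; rewrite mulr_ge0 ?excess_ge0// ltW.
- by move=> x; rewrite mulr_ge0// excess_ge0.
Qed.

Let decay_arith (h ep a Yb i1 i2 U1 U2 y : R) :
  - ep <= i1 - U1 -> i2 - U2 <= ep -> i1 - i2 <= h * (a * (Yb + ep) + ep) ->
  U2 <= y -> U1 <= y + h * (a * Yb) + ep * (2 + h * (a + 1)).
Proof. by move=> h1 h2 h3 h4; lra. Qed.

(** The approximation is refined first, then the truncation of [v], and last the
    truncation of the weight. *)
Lemma mass_decay t1 t2 : 0 <= t1 -> t1 <= t2 -> t2 < T -> (X t1 < +oo)%E ->
  x_ t1 - x_ t2 <= (t2 - t1) *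
    (A * (x_ t1 `^ (2 - p) + K * (t2 - t1)) `^ ((p - 1) / (2 - p))).
Proof.
move=> t10 t12 t2T Xt1.
have t1T : t1 < T by exact: le_lt_trans t2T.
have t20 : 0 <= t2 by exact: le_trans t12.
have [Xt2 _] := mass_growth t10 t12 t2T Xt1.
have h0 : 0 <= t2 - t1 by rewrite subr_ge0.
set Y := x_ t1 `^ (2 - p) + K * (t2 - t1).
set b := (p - 1) / (2 - p).
have b0 : 0 < b by rewrite divr_gt0.
have Y0 : 0 <= Y by rewrite addr_ge0 ?powR_ge0// mulr_ge0.
set c := _ * (_ * _).
have -> : c = (t2 - t1) * (A * Y `^ b) by [].
move: c => _.
have Yb0 : 0 <= Y `^ b by exact: powR_ge0.
rewrite lerBlDl -lee_fin -(XE Xt1).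
have -> : X t1 = (\int[mu]_x (phi x * u t1 x)%:E)%E.
  by apply: eq_integral => x _; rewrite mulrC.
apply: excess_sup => //; first exact: mu_.
move=> e' e'0.
have i1 := psiu_int e'0 t10 t1T Xt1; have i2 := psiu_int e'0 t20 t2T Xt2.
have U1E : (\int[mu]_x (psi e' x * u t1 x)%:E)%E = (U e' t1)%:E.
  by rewrite /U fineK//; exact: (integrable_fin_num measurableT i1).
have U2x : U e' t2 <= x_ t2.
  apply: fine_le.
  - exact: (integrable_fin_num measurableT i2).
  - by rewrite ge0_fin_numE.
  apply: le_intR.
  - by apply: measurable_funM => //; exact: mu_.
  - by apply: measurable_funM => //; exact: mu_.
  - by move=> x; rewrite mulr_ge0// excess_ge0.
  - by move=> x; rewrite mulrC ler_wpM2l// psi_le.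
rewrite U1E lee_fin; apply/ler_addgt0Pr => eps eps0.
pose k := 2 + (t2 - t1) * (A + 1).
have k0 : 0 < k by rewrite ltr_wpDr// mulr_ge0// addr_ge0.
pose ep := eps / k.
have ep0 : 0 < ep by rewrite divr_gt0.
have epE : ep * k = eps by rewrite divfK// gt_eqF.
have [s1 s10 s1E] := powR_right_continuous b0 Y0 ep0.
have [eta eta0 etaE] := powq_root s10.
pose M' := fine (\int[mu]_x Mop s p (psi e') x)%E.
have M'0 : 0 <= M'.
  by apply: fine_ge0; apply: integral_ge0 => x _; exact: Mop_ge0.
have M'1 : 0 < M' + 1 by lra.
pose w := ep / (M' + 1).
have w0 : 0 < w by rewrite divr_gt0.
pose e := w `^ (p - 1)^-1 / 2.
have e0 : 0 < e by rewrite divr_gt0// powR_gt0.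
have eE : (2 * e) `^ (p - 1) = w.
  by rewrite /e mulrC divfK// -powRrM mulVf ?gt_eqF// powRr1// ltW.
have wM : w * M' <= ep.
  by rewrite /w mulrAC ler_pdivrMr// ler_pM2l//; lra.
have [n1 H1] := conv_tail t10 t1T e0 eta0.
have [n2 H2] := L2dot_approx t10 t1T e'0 ep0 Xt1.
have [n3 H3] := L2dot_approx t20 t2T e'0 ep0 Xt2.
pose n := maxn n1 (maxn n2 n3).
have n1n : (n1 <= n)%N by exact: leq_maxl.
have n2n : (n2 <= n)%N by apply: leq_trans (leq_maxr _ _); exact: leq_maxl.
have n3n : (n3 <= n)%N by apply: leq_trans (leq_maxr _ _); exact: leq_maxr.
have F1 := trunc_mass_le e0 t10 t1T Xt1 (H1 n n1n).
have F10 := @trunc_mass_ge0 _ _ _ _ _ _ _ _ W e (v n t1) e0.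
have h1 : trunc_mass phi e (v n t1) `^ (2 - p) + K * (t2 - t1) <= Y + s1.
  rewrite /Y [leRHS]addrAC lerD2r -etaE.
  apply: (le_trans (le_powR (ltW q0) F10 F1)).
  exact: (powRD_subadd q0 q1' (x0 t1) (ltW eta0)).
have h2 : (trunc_mass phi e (v n t1) `^ (2 - p) + K * (t2 - t1)) `^ b <= Y `^ b + ep.
  refine (le_trans (le_powR (ltW b0) _ h1) s1E).
  by apply: addr_ge0; [exact: powR_ge0|exact: mulr_ge0].
have := linear_mass_decay W p1 p2 (V n) e0 e'0 t10 t12.
rewrite eE -/M' -/A -/K -/b => h3.
have := H2 n n2n; rewrite ler_norml => /andP[h4 _].
have := H3 n n3n; rewrite ler_norml => /andP[_ h5].
have {h2}h6 : (t2 - t1) * (A * (trunc_mass phi e (v n t1) `^ (2 - p) + K * (t2 - t1)) `^ b +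
    w * M') <= (t2 - t1) * (A * (Y `^ b + ep) + ep).
  by rewrite ler_wpM2l// lerD// ler_wpM2l.
have {h6}h7 := le_trans h3 h6.
rewrite -epE; exact: (decay_arith h4 h5 h7 U2x).
Qed.

Lemma mass_lipschitz t1 t2 : 0 <= t1 -> t1 <= t2 -> t2 < T -> (X t1 < +oo)%E ->
  `|x_ t1 `^ (2 - p) - x_ t2 `^ (2 - p)| <= K * (t2 - t1).
Proof.
move=> t10 t12 t2T Xt1; rewrite ler_norml; apply/andP; split.
  have [_ g] := mass_growth t10 t12 t2T Xt1.
  by rewrite lerNl opprB lerBlDl.
apply: (@powR_decay _ p A t1 t2 x_) => // t t' at_ tt' t'b.
  have t'T : t' < T by exact: le_lt_trans t2T.
  have [Xt _] := mass_growth t10 at_ (le_lt_trans tt' t'T) Xt1.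
  by have [_ g] := mass_growth (le_trans t10 at_) tt' t'T Xt.
have t'T : t' < T by exact: le_lt_trans t2T.
have [Xt _] := mass_growth t10 at_ (le_lt_trans tt' t'T) Xt1.
exact: (mass_decay (le_trans t10 at_) tt' t'T Xt).
Qed.

End approximation.

(** * Semigroup solutions *)
Section solutions.
Context {R : realType} {N : nat}.
Local Notation E := 'rV[R]_N.
Local Notation mu := (@leb R N).
Local Open Scope ereal_scope.

Lemma ae_eq_int (f g : E -> R) (P : E -> Prop) :
  measurable_fun setT f -> measurable_fun setT g ->
  {ae mu, forall x, P x} -> (forall x, P x -> f x = g x) ->
  \int[mu]_x (f x)%:E = \int[mu]_x (g x)%:E.
Proof.
move=> mf mg [Z [mZ Z0 subZ]] PE.
apply: ae_eq_integral => //; [exact/measurable_EFinP|exact/measurable_EFinP|].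
exists Z; split => // x nfg; apply: subZ => Px; apply: nfg => _.
by rewrite PE.
Qed.

Lemma dist_Lp_lt (q eta : R) (f g : E -> R) : (0 < q)%R -> (0 < eta)%R ->
  dist_Lp q f g < (eta `^ q^-1)%:E ->
  \int[mu]_x (`|f x - g x| `^ q)%:E <= eta%:E.
Proof.
move=> q0 eta0; rewrite /dist_Lp => H.
have NE : 'N[mu]_q%:E[EFin \o (f \- g)%R] `^ q = \int[mu]_x (`|f x - g x| `^ q)%:E.
  by rewrite poweR_Lnorm ?gt_eqF.
rewrite -NE.
have -> : eta%:E = (eta `^ q^-1)%:E `^ q.
  by rewrite poweR_EFin -powRrM mulVf ?gt_eqF// powRr1// ltW.
apply: gt0_ler_poweR; rewrite ?in_itv/= ?Lnorm_ge0 ?leey ?lee_fin ?powR_ge0//; exact: ltW.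
Qed.

End solutions.


Theorem theorem2p1 (R : realType) (N : nat) (s p : R)
    (hN : (1 <= N)%N) (hs0 : 0 < s) (hs1 : s < 1)
    (hp1 : 1 < p) (hp2 : p < 2) (hsp : s * p < 1)
    (phi : 'rV[R]_N -> R) (hphi : weight_class s p phi) :
  exists K : R, [/\ 0 < K,
    K = (2 - p) * (fine (weight_const s p phi)) `^ (2 - p) &
    forall (T : R) (u : R -> 'rV[R]_N -> R), 0 < T ->
      semigroup_solution s p T u -> nonnegative_on T u ->
      forall t1 t2 : R, 0 <= t1 -> t1 < T -> 0 <= t2 -> t2 < T ->
        (weighted_mass u phi t1 < +oo)%E -> (weighted_mass u phi t2 < +oo)%E ->
        `|(fine (weighted_mass u phi t1)) `^ (2 - p) -
          (fine (weighted_mass u phi t2)) `^ (2 - p)| <= K * `|t1 - t2| ].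
Proof.
have [m [B [W B0 C0]]] := weight_classP hN hp1 hp2 hphi.
exists ((2 - p) * fine (weight_const s p phi) `^ (2 - p)); split => //.
  by rewrite mulr_gt0 ?subr_gt0// powR_gt0.
move=> T u T0 [q [u0 [q1 [_ [v [V _ _ vu]]]]]] unn.
have q0 : 0 < q by exact: lt_le_trans q1.
pose w t x := `|u t x|.
have mphi := rw_meas W.
have mu_ t : 0 <= t -> t < T -> measurable_fun setT (u t).
  by move=> t0 tT; have [uq _] := vu t t0 tT; exact: Lfun_measurable uq.
have mw t : 0 <= t -> t < T -> measurable_fun setT (w t).
  by move=> t0 tT; apply: measurable_absR; exact: mu_.
have massE t : 0 <= t -> t < T ->
    (weighted_mass u phi t = \int[@leb R N]_x (w t x * phi x)%:E)%E.
  move=> t0 tT; apply: (ae_eq_int _ _ (unn t t0 tT)).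
  - by apply: measurable_funM => //; exact: mu_.
  - by apply: measurable_funM => //; exact: mw.
  - by move=> x ux; rewrite /w (ger0_norm ux).
have conv t eta : 0 <= t -> t < T -> 0 < eta -> exists n0, forall n, (n0 <= n)%N ->
    (\int[@leb R N]_x (`|v n t x - w t x| `^ q)%:E <= eta%:E)%E.
  move=> t0 tT eta0; have [_ vut] := vu t t0 tT.
  have [n0 _ H] := cvge0_lt _ (powR_gt0 q^-1 eta0) vut.
  exists n0 => n nn0; apply: le_trans (dist_Lp_lt q0 eta0 (H n nn0)).
  have mv : measurable_fun setT (v n t).
    exact: (Lfun_measurable (orbit_L2 (V n) t0)).
  rewrite le_eqVlt; apply/orP; left; apply/eqP.
  apply: (ae_eq_int _ _ (unn t t0 tT)).
  - apply: measurable_powRl; apply: measurable_absR.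
    exact: (measurable_funB mv (mw t t0 tT)).
  - apply: measurable_powRl; apply: measurable_absR.
    exact: (measurable_funB mv (mu_ t t0 tT)).
  - by move=> x ux; rewrite /w (ger0_norm ux). 
have w0 t x : 0 <= w t x by exact: normr_ge0.
move=> t1 t2; wlog t12 : t1 t2 / t1 <= t2.
  move=> H t10 t1T t20 t2T X1 X2; have /orP[t12|t21] := le_total t1 t2.
    exact: H.
  by rewrite distrC (distrC t1); exact: H.
move=> t10 t1T t20 t2T; rewrite !massE// => X1 _.
rewrite (distrC t1) (ger0_norm (_ : 0 <= t2 - t1)) ?subr_ge0//.
exact: (mass_lipschitz W hp1 hp2 V q1 w0 mw conv t10 t12 t2T X1).
Qed.
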